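(* There is a smooth function $a_0:\mathbb{T}\to(0,\infty)$ such that if $W(u)=\frac14(1-u^2)^2$, then, for $d=1$ and $a=a_0$, $\mathscr{E}^a(e)$ does not have a continuous minimizer in either direction $e\in S^0=\{1,-1\}$. This extends to any dimension: for every $d\ge2$ there is a smooth laminar, uniformly elliptic $\mathbb{Z}^d$-periodic $a:\mathbb{T}^d\to\mathcal{S}_d$ such that, with the same $W$, there are at least two directions $e\in S^{d-1}$ for which $\mathscr{T}^a_e$ does not have continuous minimizers.
   Context: $\mathbb{T}^d=\mathbb{R}^d/\mathbb{Z}^d$, $\mathbb{T}=\mathbb{T}^1$; $S^{d-1}$ is the unit sphere of $\mathbb{R}^d$; $\mathcal{S}_d$ the real symmetric $d\times d$ matrices. A $\mathbb{Z}^d$-periodic matrix field $a$ on $\mathbb{R}^d$ is laminar if for some $k\in\{1,\dots,d-1\}$, $a(x+y)=a(x)$ for all $x\in\mathbb{R}^d$ and $y\in\mathbb{Z}^k\times\mathbb{R}^{d-k}$. Uniformly elliptic means $\lambda\,\mathrm{Id}\le a\le\Lambda\,\mathrm{Id}$ for constants $0<\lambda\le\Lambda$. For $e\in S^{d-1}$ set $\mathcal{D}_e=e\,\partial_s+D_x$ (distributional derivatives on $\mathbb{R}\times\mathbb{T}^d$, with $s\in\mathbb{R}$, $x\in\mathbb{T}^d$) and $$\mathscr{T}^a_e(U)=\int_{\mathbb{R}\times\mathbb{T}^d}\Big(\tfrac12\langle a(x)\mathcal{D}_eU,\mathcal{D}_eU\rangle+W(U)\Big)dx\,ds$$ ($+\infty$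 if $\mathcal{D}_eU\notin L^2$), $$\mathscr{E}^a(e)=\inf\{\mathscr{T}^a_e(U):|U|\le1,\ U(\cdot+s,\cdot)\to\pm1\text{ in }L^1_{\mathrm{loc}}(\mathbb{R}\times\mathbb{T}^d)\text{ as }s\to\pm\infty\}.$$ A minimizer (of $\mathscr{E}^a(e)$, equivalently of $\mathscr{T}^a_e$) is any admissible $U$ attaining this infimum, considered up to a.e. equality; ''no continuous minimizer'' means that no minimizer agrees a.e. with a continuous function on $\mathbb{R}\times\mathbb{T}^d$. *)

(* Defs.v *)
From HB Require Import structures.
From mathcomp Require Import all_boot all_order all_algebra.
From mathcomp Require Import all_classical all_reals all_analysis.

Set Implicit Arguments.
Unset Strict Implicit.
Unset Printing Implicit Defensive.

Import Order.TTheory GRing.Theory Num.Theory.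
Import numFieldNormedType.Exports.
Local Open Scope classical_set_scope.
Local Open Scope ring_scope.

(* The sigma-algebra on row vectors generated by the coordinates, as in the
   library's instance on n.-tuple T. *)
Section measurable_rV.
Context {d} {T : sigmaRingType d} (n : nat).

Let coors : 'I_n -> 'rV[T]_n -> T := fun i x => x ord0 i.

Let rV_set0 : g_sigma_preimage coors set0.
Proof. exact: sigma_algebra0. Qed.

Let rV_setC A : g_sigma_preimage coors A -> g_sigma_preimage coors (~` A).
Proof. exact: sigma_algebraC. Qed.

Let rV_bigcup (F : (set 'rV[T]_n)^nat) :
  (forall i, g_sigma_preimage coors (F i)) ->
  g_sigma_preimage coors (\bigcup_i (F i)).
Proof. exact: sigma_algebra_bigcup. Qed.

HB.instance Definition _ := @isMeasurable.Build (measure_tuple_display d)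
  'rV[T]_n (g_sigma_preimage coors) rV_set0 rV_setC rV_bigcup.

End measurable_rV.

Section cons_rV.
Context {d} {T : measurableType d} (n : nat).

Definition cons_rV (p : T * 'rV[T]_n) : 'rV[T]_n.+1 :=
  \row_(j < n.+1) oapp (fun i => p.2 ord0 i) p.1 (unlift ord0 j).

Lemma measurable_cons_rV : measurable_fun setT cons_rV.
Proof.
have mcoor (i : 'I_n) : measurable_fun setT (fun x : 'rV[T]_n => x ord0 i).
  move=> _ Y mY; apply: sub_sigma_algebra; rewrite -bigcup_seq/=.
  by exists i => /=; [rewrite mem_index_enum|exists Y].
move=> _ A mA; rewrite setTI.
suff: <<s \big[setU/set0]_(i < n.+1) preimage_set_system setT
    (fun x : 'rV[T]_n.+1 => x ord0 i) measurable >>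
  `<=` [set B | measurable (cons_rV @^-1` B)] by apply.
apply: smallest_sub.
  split=> /=.
  - by rewrite preimage_set0; exact: measurable0.
  - by move=> B mB; rewrite setTD preimage_setC; exact: measurableC.
  - by move=> F mF; rewrite preimage_bigcup; exact: bigcupT_measurable.
rewrite -bigcup_seq/=; apply: bigcup_sub => j _ B [C mC <-] /=; rewrite setTI.
rewrite -comp_preimage -[X in measurable X]setTI.
suff : measurable_fun setT ((fun x : 'rV[T]_n.+1 => x ord0 j) \o cons_rV).
  by apply.
have -> : (fun x : 'rV[T]_n.+1 => x ord0 j) \o cons_rV =
    fun p => oapp (fun i => p.2 ord0 i) p.1 (unlift ord0 j).
  by apply/funext => p /=; rewrite mxE.
case: (unlift ord0 j) => [i|] /=; last exact: measurable_fst.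
by apply: (measurableT_comp (mcoor i)); exact: measurable_snd.
Qed.

HB.instance Definition _ :=
  @isMeasurableFun.Build _ _ _ _ cons_rV measurable_cons_rV.

End cons_rV.

(* T^n is represented by its fundamental cell [0, 1]^n with Lebesgue measure;
   functions on T^n are Z^n-periodic functions on R^n.  measurableTypeR R is R
   with the sigma-algebra on which lebesgue_measure is defined. *)
Fixpoint torus_measure (R : realType) (n : nat) :
    probability 'rV[measurableTypeR R]_n R :=
  match n with
  | 0 => \d_(0 : 'rV[measurableTypeR R]_0)
  | n.+1 => distribution
      (uniform_prob (@ltr01 R) \x torus_measure R n)%E (@cons_rV _ _ n)
  end.

Definition strip_measure (R : realType) (d : nat) :
    {measure set (measurableTypeR R * 'rV[measurableTypeR R]_d) -> \bar R} :=
  (@lebesgue_measure R \x torus_measure R d)%E.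

(* On finite-dimensional V this is C^n: for n.+1, f is Frechet differentiable
   and each directional derivative is C^n. *)
Fixpoint Cn (R : realType) (V : normedModType R) (n : nat) (f : V -> R) : Prop :=
  match n with
  | 0 => continuous f
  | n.+1 => (forall x, differentiable f x) /\ forall v, Cn n ('D_v f)
  end.

Definition smooth (R : realType) (V : normedModType R) (f : V -> R) : Prop :=
  forall n, Cn n f.

Section torus.
Context {R : realType} {d : nat}.
Implicit Types (x y : 'rV[R]_d).

(* invariance under Z^k x R^(d - k) *)
Definition invariant_upto (k : nat) {X : Type} (a : 'rV[R]_d -> X) : Prop :=
  forall x y, (forall i : 'I_d, (i < k)%N -> y ord0 i \is a Num.int) ->
    a (x + y) = a x.

Definition Zperiodic {X : Type} (a : 'rV[R]_d -> X) : Prop :=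
  invariant_upto d a.

Definition laminar {X : Type} (a : 'rV[R]_d -> X) : Prop :=
  exists k : nat, (1 <= k <= d.-1)%N /\ invariant_upto k a.

Definition dot x y : R := \sum_(i < d) x ord0 i * y ord0 i.

Definition sphere : set 'rV[R]_d := [set e | dot e e = 1].

Definition apply_mx (A : 'M[R]_d) x : 'rV[R]_d := (A *m x^T)^T.

Definition symmetric_field (a : 'rV[R]_d -> 'M[R]_d) : Prop :=
  forall x, (a x)^T = a x.

Definition smooth_field (a : 'rV[R]_d -> 'M[R]_d) : Prop :=
  forall i j, smooth (fun x => a x i j).

Definition uniformly_elliptic (a : 'rV[R]_d -> 'M[R]_d) : Prop :=
  exists l L : R, [/\ 0 < l, l <= L & forall x v,
    l * dot v v <= dot (apply_mx (a x) v) v <= L * dot v v].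

End torus.

Section energy.
Context {R : realType} {d : nat}.
Notation RxT := (R * 'rV[R]_d)%type.
Notation mu := (strip_measure R d).

Definition on_torus {X : Type} (f : RxT -> X) : Prop :=
  forall s, Zperiodic (fun x => f (s, x)).

Definition slab (M : R) : set RxT := [set z | `|z.1| <= M].

Definition test_function (phi : RxT -> R) : Prop :=
  [/\ smooth phi, on_torus phi &
      exists M, forall z, ~ slab M z -> phi z = 0].

(* the i-th component of e d/ds + D_x, applied to a smooth function *)
Definition De_smooth (e : 'rV[R]_d) (i : 'I_d) (phi : RxT -> R) : RxT -> R :=
  'D_((e ord0 i, delta_mx ord0 i) : RxT) phi.

(* V is square integrable and is the distributional D_e U *)
Definition is_De (e : 'rV[R]_d) (U : RxT -> R) (V : RxT -> 'rV[R]_d) : Prop :=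
  [/\ forall M, mu.-integrable (slab M) (EFin \o U),
      on_torus V,
      forall i, (fun z => V z ord0 i) \in Lfun mu 2%:E &
      forall phi, test_function phi -> forall i,
        \int[mu]_z (U z * De_smooth e i phi z)
        = - \int[mu]_z (V z ord0 i * phi z)].

Definition De (e : 'rV[R]_d) (U : RxT -> R) : RxT -> 'rV[R]_d :=
  xget (fun=> 0) [set V | is_De e U V].

Definition energy (W : R -> R) (a : 'rV[R]_d -> 'M[R]_d) (e : 'rV[R]_d)
    (U : RxT -> R) : \bar R :=
  if `[< exists V, is_De e U V >] then
    (\int[mu]_z (2^-1 * dot (apply_mx (a z.2) (De e U z)) (De e U z)
                 + W (U z))%:E)%E
  else +oo%E.

(* L^1_loc convergence is tested on the slabs [-M, M] x T^d, which are compact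
   and exhaust R x T^d. *)
Definition admissible (U : RxT -> R) : Prop :=
  [/\ measurable_fun setT
        (U : measurableTypeR R * 'rV[measurableTypeR R]_d -> R),
      on_torus U,
      {ae mu, forall z, `|U z| <= 1},
      forall M, (\int[mu]_(z in slab M) `|U (z.1 + s, z.2) - 1|%:E)%E
        @[s --> +oo] --> 0%E &
      forall M, (\int[mu]_(z in slab M) `|U (z.1 + s, z.2) + 1|%:E)%E
        @[s --> -oo] --> 0%E].

Definition min_energy W a e : \bar R :=
  ereal_inf [set energy W a e U | U in admissible].

Definition minimizer W a e (U : RxT -> R) : Prop :=
  admissible U /\ energy W a e U = min_energy W a e.

Definition has_continuous_minimizer W a e : Prop :=
  exists U g : RxT -> R, [/\ minimizer W a e U, continuous g, on_torus g &
    {ae mu, forall z, U z = g z}].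

End energy.

Definition double_well (R : realType) (u : R) : R := 4^-1 * (1 - u ^+ 2) ^+ 2.

(* Main.v *)
Require Import Defs.
From HB Require Import structures.
From mathcomp Require Import all_boot all_order all_algebra.
From mathcomp Require Import all_classical all_reals all_analysis.
From mathcomp Require Import measurable_realfun ring lra.
Set Implicit Arguments.
Unset Strict Implicit.
Unset Printing Implicit Defensive.
Import Order.TTheory GRing.Theory Num.Theory.
Import numFieldNormedType.Exports.
Local Open Scope classical_set_scope.
Local Open Scope ring_scope.

(** Why the theorem holds. In every dimension the coefficient depends on the first coordinate only, [a(x) = a0(x_1) Id] with [a0] smooth, even and 1-periodic, and the directions are [e_1] and [- e_1]. Write [e = sg e_1]. The first component of [e d/ds + D_x] is then, up to the sign [sg], the derivative along the lines [s |-> (s, y + sg s e_1)], and these lines foliate the cylinder. Since [a0] is even and periodic, every line sees the coefficient [a0] once its parameter is shifted by [sg y_1]; so the energy of a line is the one-dimensional energy [density] of the function restricted to it.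

Upper bound. A one-dimensional profile [p] can be copied on all lines at once, with a phase that makes the result periodic ([competitor]). The result is discontinuous, but it is admissible, its weak derivative is the expected one, and its energy is that of [p]. Hence the minimal energy is at most the energy of any profile ([min_energy_le]). As [a0 <= w^2] on [[- w, w]], a piecewise linear transition there costs at most [3 w / 2] ([clamp_energy]), which is below [1/64].

Lower bound. Let [g] be a continuous minimizer. On almost every line [g] is a profile: it is absolutely continuous there ([lines_primitive]), has the right signs at both ends ([line_signs]), and finite energy then forces the limits [-1] and [1] ([profile_intro]). So almost every line costs at least the minimal energy ([line_energy_ge]), whereas on average the lines cost at most that much. On the other hand [g] is negative far to the left and positive far to the right, so that, being continuous, it vanishes at some point with [x_1] close to [1/2] ([zero_in_window]), and the lines passing close to this point form a set of positive measure ([labels_near_zero]). Near [1/2] the coefficient is at least [1/64]; a line on which [g] is small there either leaves [[-1/2, 1/2]] against this coefficient or lingers in it and pays for the potential, and in both cases it costs at least [1/64] ([exit_energy], [line_energy_exit]). The average cost is therefore larger than the minimal energy, a contradiction.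

Passing from the weak derivative on the cylinder to the lines needs a supply of smooth periodic test functions, built from [exp(-1/r)], and the fundamental lemma of the calculus of variations ([strip_fundamental], [torus_fundamental], [du_bois_reymond]). *)

(** * Smooth functions by closure rules *)

Section smooth_calculus.
Context {R : realType}.

(** The whole sequence of derivatives is kept, so that composing with a member of it stays in the class [elementary] after derivation. *)
Definition derivative_tower (hs : nat -> R -> R) : Prop :=
  forall k (x : R), is_derive x (1 : R) (hs k) (hs k.+1 x).

Context {V : normedModType R}.

Lemma smooth_coind (P : (V -> R) -> Prop) :
    (forall f, P f -> forall x, differentiable f x) ->
    (forall f v, P f -> P ('D_v f)) ->
  forall f, P f -> smooth f.
Proof.
move=> Pdiff Pder f Pf n; elim: n f Pf => [|n IHn] f Pf /=.
  by move=> x; apply: differentiable_continuous; exact: Pdiff.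
by split=> [x|v]; [exact: Pdiff|exact/IHn/Pder].
Qed.

(** A class of differentiable functions that is stable under directional derivatives by construction: smoothness of explicit functions then reduces to closure rules. *)
Inductive elementary : (V -> R) -> Prop :=
| elementary_cst c : elementary (cst c)
| elementary_lin (L : {linear V -> R^o}) : continuous L -> elementary L
| elementary_comp hs k f : derivative_tower hs -> elementary f ->
    elementary (hs k \o f)
| elementaryD f g : elementary f -> elementary g -> elementary (f \+ g)
| elementaryM f g : elementary f -> elementary g -> elementary (f \* g).

Lemma elementary_differentiable f x : elementary f -> differentiable f x.
Proof.
elim=> {f} [c|L Lc|hs k f hsP _ df|f g _ df _ dg|f g _ df _ dg].
- exact: differentiable_cst.
- exact: linear_differentiable.
- apply: differentiable_comp; first exact: df.
  by apply/derivable1_diffP; have [] := hsP k (f x).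
- exact: differentiableD.
- exact: differentiableM.
Qed.

Lemma derive_comp_tower hs k (f : V -> R) v x :
  derivative_tower hs -> differentiable f x ->
  'D_v (hs k \o f) x = hs k.+1 (f x) * 'D_v f x.
Proof.
move=> hsP df; have dh : differentiable (hs k) (f x).
  by apply/derivable1_diffP; have [] := hsP k (f x).
rewrite deriveE; last exact: differentiable_comp.
rewrite diff_comp//= diff1E//= derive1E -deriveE//.
by have [_ ->] := hsP k (f x); rewrite mulrC.
Qed.

Lemma derive_linear (L : {linear V -> R^o}) v : continuous L ->
  'D_v L = cst (L v).
Proof.
move=> Lc; apply/funext => x; rewrite deriveE; last exact: linear_differentiable.
by rewrite diff_lin.
Qed.

Lemma elementary_derive f v : elementary f -> elementary ('D_v f).
Proof.
elim=> {f} [c|L Lc|hs k f hsP ef df|f g ef df eg dg|f g ef df eg dg].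
- have -> : 'D_v (cst c) = cst 0 :> (V -> R).
    by apply/funext => x; rewrite derive_cst.
  exact: elementary_cst.
- by rewrite derive_linear//; exact: elementary_cst.
- have -> : 'D_v (hs k \o f) = (hs k.+1 \o f) \* 'D_v f.
    apply/funext => x; rewrite derive_comp_tower//.
    exact: elementary_differentiable.
  by apply: elementaryM => //; exact: elementary_comp.
- have -> : 'D_v (f \+ g) = 'D_v f \+ 'D_v g.
    apply/funext => x; rewrite [LHS](@deriveD _ _ _ f g)//;
      exact/diff_derivable/elementary_differentiable.
  exact: elementaryD.
- have -> : 'D_v (f \* g) = (f \* 'D_v g) \+ (g \* 'D_v f).
    apply/funext => x; rewrite [LHS](@deriveM _ _ f g)//;
      exact/diff_derivable/elementary_differentiable.
  by apply: elementaryD; exact: elementaryM.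
Qed.

Lemma elementary_smooth f : elementary f -> smooth f.
Proof.
apply: smooth_coind => [g eg x|g v]; first exact: elementary_differentiable.
exact: elementary_derive.
Qed.

Lemma elementary_prod (I : Type) (s : seq I) (f : I -> V -> R) :
  (forall i, elementary (f i)) -> elementary (fun x => \prod_(i <- s) f i x).
Proof.
move=> ef; elim: s => [|i s IHs].
  have -> : (fun x => \prod_(i <- [::]) f i x) = cst 1.
    by apply/funext => x; rewrite big_nil.
  exact: elementary_cst.
have -> : (fun x => \prod_(j <- i :: s) f j x) =
    f i \* (fun x => \prod_(j <- s) f j x).
  by apply/funext => x; rewrite big_cons.
exact: elementaryM.
Qed.

End smooth_calculus.

(** * A smooth bump *)

Section bump.
Context {R : realType}.
Implicit Types (p : {poly R}) (r : R).

(** With polynomial factors in [1/r], the functions [exp(-1/r)] extended by 0 form a family stable under derivation. *)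
Definition flat_poly p r : R := if 0 < r then p.[r^-1] * expR (- r^-1) else 0.

Definition flat_next p : {poly R} := 'X^2 * (p - p^`()).

Lemma expR_ge_powerS n (x : R) : 0 <= x -> x ^+ n.+1 / n.+1%:R ^+ n.+1 <= expR x.
Proof.
move=> x0; rewrite -expr_div_n.
rewrite [leRHS](_ : _ = expR (x / n.+1%:R) ^+ n.+1); last first.
  by rewrite -expRM_natl mulrC divfK.
apply: lerXn2r; rewrite ?nnegrE ?divr_ge0 ?expR_ge0//.
by rewrite (le_trans _ (expR_ge1Dx _))// lerDr ler01.
Qed.

Lemma flat_monomial_le n r : 0 < r ->
  r^-1 ^+ n * expR (- r^-1) <= n.+2%:R ^+ n.+2 * r ^+ 2.
Proof.
move=> r0; have := @expR_ge_powerS n.+1 r^-1.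
rewrite invr_ge0 ltW// => /(_ isT) H.
rewrite expRN ler_pdivrMr ?expR_gt0//.
have: n.+2%:R ^+ n.+2 * r ^+ 2 * (r^-1 ^+ n.+2 / n.+2%:R ^+ n.+2) <=
  n.+2%:R ^+ n.+2 * r ^+ 2 * expR r^-1.
  by rewrite ler_pM2l// mulr_gt0 ?exprn_gt0.
apply: le_trans; rewrite le_eqVlt; apply/orP; left; apply/eqP.
set A := n.+2%:R ^+ n.+2; have A0 : A != 0 by rewrite expf_neq0.
have r0' : r != 0 by rewrite gt_eqF.
by rewrite -[n.+2]addn2 exprD; field; rewrite A0.
Qed.

(** A quadratic bound at 0 gives both continuity and a zero derivative there. *)
Lemma flat_poly_le p : exists C, forall r, r <= 1 -> `|flat_poly p r| <= C * r ^+ 2.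
Proof.
exists (\sum_(i < size p) `|p`_i| * i.+2%:R ^+ i.+2) => r r1.
rewrite /flat_poly; case: ifPn => [r0|_]; last first.
  by rewrite normr0 mulr_ge0 ?sqr_ge0// sumr_ge0// => i _; rewrite mulr_ge0.
rewrite horner_coef mulr_suml mulr_suml (le_trans (ler_norm_sum _ _ _))//.
apply: ler_sum => i _; rewrite !normrM -[leLHS]mulrA -[leRHS]mulrA ler_wpM2l//.
rewrite (ger0_norm (expR_ge0 _)) ger0_norm ?exprn_ge0 ?invr_ge0 ?(ltW r0)//.
exact: flat_monomial_le.
Qed.

Lemma is_derive_flat_poly p (r : R) :
  is_derive r (1 : R) (flat_poly p) (flat_poly (flat_next p) r).
Proof.
have [r0|r0|->] := ltgtP r 0.
- rewrite {2}/flat_poly ltNge ltW//=.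
  apply: (@near_eq_is_derive _ _ _ (cst 0)).
  near=> x; rewrite /flat_poly ifF//; apply/negbTE; rewrite -leNgt.
  by apply: ltW; near: x; exact: lt_nbhsl.
- rewrite {2}/flat_poly r0.
  apply: (@near_eq_is_derive _ _ _ (fun r => p.[r^-1] * expR (- r^-1))).
    near=> x; rewrite /flat_poly ifT//; near: x; exact: lt_nbhsr.
  have rn0 : r != 0 by rewrite gt_eqF.
  have dV : is_derive r (1 : R) (fun x : R => x^-1) (- r ^- 2).
    apply: DeriveDef; first exact: derivableV.
    by rewrite (@deriveV _ _ id)// derive_id scaler1.
  have dp := @is_derive1_comp _ (horner p) (fun x : R => x^-1) r _ _
    (is_derive_poly p r^-1) dV.
  have de := @is_derive1_comp _ expR (fun x : R => - x^-1) r _ _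
    (is_derive_expR _) (is_deriveN dV).
  apply: is_derive_eq; rewrite /flat_next hornerE !hornerE.
  transitivity (p.[r^-1] * (expR (- r^-1) * - - r ^- 2) +
    expR (- r^-1) * (p^`().[r^-1] * - r ^- 2)); first by [].
  by field.
- rewrite {2}/flat_poly ltxx; have [C HC] := flat_poly_le p.
  have F0 : flat_poly p 0 = 0 by rewrite /flat_poly ltxx.
  have cv : (fun h : R => h^-1 *: (flat_poly p (h *: 1 + 0) - flat_poly p 0))
      @ 0^' --> (0 : R).
    apply/cvgr0Pnorm_le => e e0; near=> h.
    have h0 : h != 0 by near: h; exact: nbhs_dnbhs_neq.
    rewrite F0 subr0 addr0 /GRing.scale/= mulr1 normrM normfV.
    rewrite ler_pdivrMl ?normr_gt0//.
    have h1 : `|h| <= 1 by near: h; apply: dnbhs0_le.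
    have /le_trans -> // := HC h (le_trans (ler_norm _) h1).
    rewrite -[h ^+ 2]ger0_norm ?sqr_ge0// normrX expr2 mulrCA ler_pM2l ?normr_gt0//.
    apply: (@le_trans _ _ ((`|C| + 1) * `|h|)).
      by rewrite ler_wpM2r// (le_trans (ler_norm _))// lerDl.
    rewrite -ler_pdivlMl ?ltr_wpDl//.
    by near: h; apply: dnbhs0_le; rewrite mulr_gt0// invr_gt0 ltr_wpDl.
  by apply: DeriveDef; [apply/cvg_ex; exists 0|exact: cvg_lim cv].
Unshelve. all: by end_near. Qed.

Definition bump : R -> R := flat_poly 1.

Definition bump_tower k : R -> R := flat_poly (iter k flat_next 1).

Lemma bump_towerP : derivative_tower bump_tower.
Proof. by move=> k x; exact: is_derive_flat_poly. Qed.

Lemma bumpE r : 0 < r -> bump r = expR (- r^-1).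
Proof. by move=> r0; rewrite /bump /flat_poly r0 hornerE mul1r. Qed.

Lemma bump0 r : r <= 0 -> bump r = 0.
Proof. by move=> r0; rewrite /bump /flat_poly ltNge r0. Qed.

Lemma bump_gt0 r : (0 < bump r) = (0 < r).
Proof.
have [r0|r0] := ltP 0 r; first by rewrite bumpE// expR_gt0.
by rewrite bump0// ltxx.
Qed.

Lemma bump_ge0 r : 0 <= bump r.
Proof.
have [r0|r0] := ltP 0 r; first by rewrite ltW// bump_gt0.
by rewrite bump0.
Qed.

Lemma bump_le1 r : bump r <= 1.
Proof.
have [r0|r0] := ltP 0 r; last by rewrite bump0.
by rewrite bumpE// -expR0 ler_expR oppr_le0 invr_ge0 ltW.
Qed.

Lemma bump_cvg r : bump (n%:R * r) @[n --> \oo] --> ((0 < r)%R%:R : R).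
Proof.
case: ltP => [r0|r0] /=; last first.
  apply: cvg_near_cst; near=> n; apply/eqP; rewrite bump0//.
  by rewrite mulr_ge0_le0.
suff : bump (n%:R * r) @[n --> \oo] --> expR (- (r^-1 * 0)).
  by rewrite mulr0 oppr0 expR0.
apply: (@cvg_trans _ ((fun n : nat => expR (- (r^-1 * n%:R^-1))) @ \oo)).
  apply: near_eq_cvg; near=> n.
  have n0 : (0 < n)%N by near: n; exact: nbhs_infty_gt.
  have nr0 : 0 < n%:R * r by rewrite mulr_gt0 ?ltr0n.
  by rewrite (bumpE nr0) invfM mulrC.
apply: continuous_cvg; first exact: continuous_expR.
apply: cvgN; apply: cvgMr; apply/gtr0_cvgV0; last exact: cvgr_idn.
by near=> n; rewrite ltr0n; near: n; exact: nbhs_infty_gt.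
Unshelve. all: by end_near. Qed.

Definition cos_tower k (x : R) := cos (x + k%:R * (pi / 2)).

Lemma cos_towerP : derivative_tower cos_tower.
Proof.
move=> k x; rewrite /cos_tower -(@natr1 _ k).
rewrite (mulrDl _ _ (pi / 2)) mul1r addrA cosDpihalf.
have dl : is_derive x (1 : R) (fun x : R => x + k%:R * (pi / 2)) (1 + 0).
  exact: is_deriveD.
have := @is_derive1_comp _ cos (fun x : R => x + k%:R * (pi / 2)) x _ _
    (is_derive_cos _) dl.
by rewrite addr0 mulr1.
Qed.

Lemma elementary_cos (V : normedModType R) (f : V -> R) :
  elementary f -> elementary (cos \o f).
Proof.
have -> : cos = cos_tower 0 by apply/funext => x; rewrite /cos_tower mul0r addr0.
by move=> ef; apply: elementary_comp => //; exact: cos_towerP.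
Qed.

Lemma elementary_bump (V : normedModType R) (f : V -> R) :
  elementary f -> elementary (bump \o f).
Proof.
by move=> ef; apply: (@elementary_comp _ _ bump_tower 0%N) => //; exact: bump_towerP.
Qed.

End bump.

(** * Translations of the line and of the torus *)

Section lebesgue_translation.
Context {R : realType}.
Local Notation mR := (measurableTypeR R).
Local Notation leb := (@lebesgue_measure R).

Let tr (h : R) : mR -> mR := fun t => t + h.

Let measurable_tr h : measurable_fun setT (tr h).
Proof.
by have : measurable_fun setT (fun t : R => t + h) by exact: measurable_funD.
Qed.

HB.instance Definition _ h :=
  @isMeasurableFun.Build _ _ _ _ (tr h) (measurable_tr h).

Lemma lebesgue_measure_translate h (A : set R) : measurable A ->
  pushforward leb (tr h) A = leb A.
Proof.
move=> mA; apply/esym/lebesgue_measure_unique => //= _ [[a b]] _ <-.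
rewrite /pushforward.
have -> : tr h @^-1` `]a, b] = `]a - h, b - h]%classic.
  by apply/seteqP; split => x; rewrite /tr/= !in_itv/= ltrBlDr lerBrDr.
by rewrite !lebesgue_measure_itv/= !lte_fin ltrD2r -!EFinD opprB addrA subrK.
Qed.

Lemma ge0_integral_translate h (f : R -> \bar R) :
  measurable_fun setT f -> (forall t, (0 <= f t)%E) ->
  (\int[leb]_t f (t + h)%R = \int[leb]_t f t)%E.
Proof.
move=> mf f0.
rewrite -(ge0_integral_pushforward (measurable_tr h) _ measurableT)//.
apply: eq_measure_integral => A mA _; exact: lebesgue_measure_translate.
Qed.

Let integral_itv_translate h a b (f : R -> \bar R) :
  measurable_fun setT f -> (forall t, (0 <= f t)%E) ->
  (\int[leb]_(t in `[a, b[) f (t + h)%R =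
   \int[leb]_(t in `[(a + h)%R, (b + h)%R[) f t)%E.
Proof.
move=> mf f0; rewrite integral_mkcond [RHS]integral_mkcond.
rewrite -[RHS](ge0_integral_translate h); last 2 first.
- by apply/(measurable_restrictT _ _).1 => //; exact: measurable_funTS.
- by move=> t; apply: erestrict_ge0.
apply: eq_integral => t _; rewrite !patchE; congr (if _ then _ else _).
by apply/idP/idP; rewrite !inE/= !in_itv/= lerD2r ltrD2r.
Qed.

(** On periodic functions the uniform measure of the unit interval is the invariant measure of the circle: after removing the integer part of [h], cut the moved interval at 1. *)
Lemma integral_uniform_translate h (f : R -> \bar R) :
  measurable_fun setT f -> (forall t, (0 <= f t)%E) ->
  (forall t z, z \is a Num.int -> f (t + z)%R = f t) ->
  (\int[uniform_prob (@ltr01 R)]_t f (t + h)%R =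
   \int[uniform_prob (@ltr01 R)]_t f t)%E.
Proof.
move=> mf f0 fper.
have mfh k : measurable_fun [set: mR] (fun t : R => f (t + k)).
  exact: (measurableT_comp mf (measurable_tr k)).
have -> : (fun t => f (t + h)) = fun t => f (t + (h - (Num.floor h)%:~R)).
  apply/funext => t; rewrite addrA -[in LHS](fper _ (- (Num.floor h)%:~R))//.
  by rewrite rpredN intr_int.
set r := h - _.
have /andP[r0 r1] : 0 <= r < 1.
  rewrite /r subr_ge0 floor_le/= ltrBlDl -[X in _ < _ + X]/(1%:~R) -intrD.
  exact: floorD1_gt.
rewrite !integral_uniform//; congr (_ * _)%E.
have mI (A : set R) g : measurable_fun setT g -> measurable_fun A (g : R -> \bar R).
  exact: measurable_funTS.
rewrite -!integral_itv_bndo_bndc//.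
rewrite integral_itv_translate// add0r.
have cat (a b c : R) : a <= b -> b <= c ->
    (\int[leb]_(t in `[a, c[) f t =
     \int[leb]_(t in `[a, b[) f t + \int[leb]_(t in `[b, c[) f t)%E.
  move=> ab bc; rewrite -ge0_integral_setU//=; last 2 first.
  - exact: mI.
  - rewrite disj_set2E; apply/eqP/seteqP; split => // x/=.
    by rewrite !in_itv/= => -[/andP[_ xb] /andP[bx _]]; move: xb; rewrite ltNge bx.
  by rewrite -itv_bndbnd_setU// bnd_simp.
rewrite (cat r 1 _) ?lerDl// ?(ltW r1)//.
rewrite (cat 0 r 1) ?(ltW r1)// addeC; congr (_ + _)%E.
have := @integral_itv_translate 1 0 r f mf f0; rewrite add0r [r + 1]addrC => <-.
- by apply: eq_integral => t _; rewrite fper// int_num1.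
- exact: (mI _ _ mf).
- exact: (mI _ _ (mfh r)).
Qed.

End lebesgue_translation.

Section rV_measurability.
Context {d} {T : measurableType d} (n : nat).

Lemma measurable_rV_coord (i : 'I_n) :
  measurable_fun setT (fun x : 'rV[T]_n => x ord0 i).
Proof.
move=> _ Y mY; apply: sub_sigma_algebra; rewrite -bigcup_seq/=.
by exists i => /=; [rewrite mem_index_enum|exists Y].
Qed.

Lemma measurable_fun_rV d' (T' : measurableType d') (f : T' -> 'rV[T]_n) :
  (forall i, measurable_fun setT (fun t => f t ord0 i)) -> measurable_fun setT f.
Proof.
move=> mf _ A mA; rewrite setTI.
suff: <<s \big[setU/set0]_(i < n) preimage_set_system setT
    (fun x : 'rV[T]_n => x ord0 i) measurable >>
  `<=` [set B | measurable (f @^-1` B)] by apply.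
apply: smallest_sub.
  split=> /=.
  - by rewrite preimage_set0; exact: measurable0.
  - by move=> B mB; rewrite setTD preimage_setC; exact: measurableC.
  - by move=> F mF; rewrite preimage_bigcup; exact: bigcupT_measurable.
rewrite -bigcup_seq/=; apply: bigcup_sub => j _ B [C mC <-] /=; rewrite setTI.
by rewrite -comp_preimage -[X in measurable X]setTI; exact: mf.
Qed.

End rV_measurability.

Section torus_translation.
Context {R : realType}.
Local Notation mR := (measurableTypeR R).

Lemma measurable_shift_coord n (i : 'I_n) (h : R) :
  measurable_fun setT
    ((fun x : 'rV[R]_n => x + h *: delta_mx 0 i) : 'rV[mR]_n -> 'rV[mR]_n).
Proof.
apply: measurable_fun_rV => j.
rewrite [X in measurable_fun _ X](_ : _ =
    fun x : 'rV[mR]_n => (x ord0 j : R) + h * (j == i)%:R); last first.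
  by apply/funext => x; rewrite !mxE eqxx.
by apply: measurable_funD; [exact: measurable_rV_coord|exact: measurable_cst].
Qed.

Lemma ge0_torus_integralS n (f : 'rV[mR]_n.+1 -> \bar R) :
  measurable_fun setT f -> (forall x, (0 <= f x)%E) ->
  (\int[torus_measure R n.+1]_x f x =
   \int[(uniform_prob (@ltr01 R) \x torus_measure R n)]_p f (cons_rV p))%E.
Proof. by move=> mf f0; rewrite ge0_integral_distribution. Qed.

Lemma torus_integral_shift n (i : 'I_n) (h : R) (f : 'rV[mR]_n -> \bar R) :
  measurable_fun setT f -> (forall x, (0 <= f x)%E) ->
  Zperiodic (f : 'rV[R]_n -> _) ->
  (\int[torus_measure R n]_x f ((x : 'rV[R]_n) + h *: delta_mx 0 i)%R =
   \int[torus_measure R n]_x f x)%E.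
Proof.
elim: n => [|n IHn] in i f *; first by case: i.
move=> mf f0 fper.
have mfs : measurable_fun [set: 'rV[mR]_n.+1]
    (fun x => f ((x : 'rV[R]_n.+1) + h *: delta_mx 0 i)).
  exact: (measurableT_comp mf (measurable_shift_coord i h)).
have mc : measurable_fun setT (@cons_rV _ mR n) by exact: measurable_cons_rV.
have mfc : measurable_fun setT (f \o @cons_rV _ mR n).
  exact: measurableT_comp.
have mfsc : measurable_fun setT ((fun x : 'rV[mR]_n.+1 =>
    f ((x : 'rV[R]_n.+1) + h *: delta_mx 0 i)) \o @cons_rV _ mR n).
  exact: measurableT_comp.
rewrite !ge0_torus_integralS//.
have f0c p : (0 <= (f \o @cons_rV _ mR n) p)%E by exact: f0.
have f0sc p : (0 <= ((fun x : 'rV[mR]_n.+1 =>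
    f ((x : 'rV[R]_n.+1) + h *: delta_mx 0 i)%R) \o @cons_rV _ mR n) p)%E by exact: f0.
case: (unliftP ord0 i) mfsc f0sc => [j ->|->] mfsc f0sc.
- rewrite [LHS](fubini_tonelli1 _ mfsc f0sc) [RHS](fubini_tonelli1 _ mfc f0c) /fubini_F/=; apply: eq_integral => t _.
  rewrite -(IHn j (fun x => f (cons_rV (t, x)))).
  + apply: eq_integral => x _; congr f; apply/rowP => k; rewrite !mxE/= ?eqxx/=.
    case: unliftP => [l ->|->]/=; rewrite ?mxE ?eqxx/=.
      by rewrite (inj_eq (@lift_inj _ _)).
    by rewrite mulr0 addr0.
  + exact: (measurableT_comp mfc (pair1_measurable t)).
  + by move=> x.
  + move=> x y yZ; rewrite -(fper (cons_rV (t, x)) (cons_rV (0 : R, y))).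
      congr f; apply/rowP => k; rewrite !mxE.
      by case: unlift => [l|]/=; rewrite ?mxE// addr0.
    move=> k _; rewrite mxE; case: unlift => [l|]/=; last exact: int_num0.
    exact: yZ.
- rewrite [LHS](fubini_tonelli2 _ mfsc f0sc) [RHS](fubini_tonelli2 _ mfc f0c) /fubini_G/=; apply: eq_integral => x _.
  rewrite -(@integral_uniform_translate _ h (fun t => f (cons_rV (t, x)))).
  + apply: eq_integral => t _; congr f; apply/rowP => k; rewrite !mxE/= ?eqxx/=.
    case: unliftP => [l ->|->]/=; last by rewrite mulr1.
    by rewrite mulr0 addr0.
  + exact: (measurableT_comp mfc (pair2_measurable x)).
  + by move=> t.
  + move=> t z zZ; rewrite -(fper (cons_rV (t, x)) (cons_rV (z, 0))).
      congr f; apply/rowP => k; rewrite !mxE.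
      by case: unlift => [l|]/=; rewrite ?mxE// addr0.
    move=> k _; rewrite mxE; case: unlift => [l|]//=; rewrite mxE.
    exact: int_num0.
Qed.

End torus_translation.

(** * Open sets and shears of the cylinder *)

Section strip_measurability.
Context {R : realType} {d : nat}.
Local Notation mR := (measurableTypeR R).
Local Notation RxT := (R * 'rV[R]_d)%type.
Local Notation mRxT := (mR * 'rV[mR]_d)%type.

Lemma measurable_rV_box d' (T : measurableType d') (B : 'I_d -> set T) :
  (forall i, measurable (B i)) ->
  measurable [set x : 'rV[T]_d | forall i, B i (x ord0 i)].
Proof.
move=> mB; have -> : [set x : 'rV[T]_d | forall i, B i (x ord0 i)] =
    \bigcap_(i in [set: 'I_d]) ((fun x : 'rV[T]_d => x ord0 i) @^-1` B i).
  by apply/seteqP; split => [x xB i _|x xB i]; exact: xB.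
apply: fin_bigcap_measurable => //.
by move=> i _; rewrite -[X in measurable X]setTI; exact: measurable_rV_coord.
Qed.

Definition box (z : RxT) (e : R) : set RxT :=
  [set w : RxT | `|w.1 - z.1| < e /\
    forall i, `|w.2 ord0 i - z.2 ord0 i| < e].

Lemma nbhs_box (z : RxT) (A : set RxT) : nbhs z A ->
  exists2 e, 0 < e & box z e `<=` A.
Proof.
move=> /nbhs_ballP[e /= e0 zA]; exists e => // w [w1 w2]; apply: zA.
split; first by rewrite /= -ball_normE/= distrC.
split=> // i j; rewrite (ord1 i) -ball_normE/= distrC; exact: w2.
Qed.

Lemma measurable_box (z : RxT) (e : R) : measurable (box z e : set mRxT).
Proof.
have mB (r : R) : measurable ([set t : R | `|t - r| < e] : set mR).
  rewrite (_ : [set t : R | `|t - r| < e] = ball r e); last first.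
    by rewrite -ball_normE/=; apply/seteqP; split => t/=; rewrite distrC.
  exact: measurable_ball.
have -> : box z e = [set t : R | `|t - z.1| < e] `*`
    [set x : 'rV[R]_d | forall i, [set t : R | `|t - z.2 ord0 i| < e] (x ord0 i)].
  by apply/seteqP; split => w /=.
apply: measurableX; first exact: mB.
exact: (@measurable_rV_box _ mR (fun i => [set t : R | `|t - z.2 ord0 i| < e])).

Qed.

(** Rational boxes are a countable base of the topology and belong to the product sigma-algebra. *)
Lemma open_measurable_strip (O : set RxT) : open O -> measurable (O : set mRxT).
Proof.
move=> oO; pose I := (rat * 'rV[rat]_d * nat)%type.
pose c (p : I) : RxT := (ratr p.1.1, \row_i ratr (p.1.2 ord0 i)).
pose F (p : I) : set RxT :=
  if `[< box (c p) p.2.+1%:R^-1 `<=` O >] then box (c p) p.2.+1%:R^-1 else set0.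
have -> : O = \bigcup_p F p; last first.
  apply: countable_bigcupT_measurable; first by apply: (countableP [set: (rat * 'rV[rat]_d * nat)%type]).
  by move=> p; rewrite /F; case: ifP => _; [exact: measurable_box|exact: measurable0].
apply/seteqP; split => [z Oz|z [p _]]; last first.
  by rewrite /F; case: ifPn => // /asboolP; exact.
have [e e0 eO] := nbhs_box (open_nbhs_nbhs (conj oO Oz)).
pose k := Num.truncn (e / 2)^-1.
have ke : k.+1%:R^-1 < e / 2.
  by rewrite invf_plt ?posrE ?divr_gt0// truncnS_gt.
have k0 : 0 < k.+1%:R^-1 :> R by rewrite invr_gt0.
have rq (t : R) : {q : rat | `|t - ratr q| < k.+1%:R^-1}.
  apply: cid; have := @rat_in_itvoo R (t - k.+1%:R^-1) (t + k.+1%:R^-1).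
  rewrite ltrBlDr -addrA ltrDl addr_gt0// => /(_ isT)[q].
  by rewrite in_itv/= => /andP[q1 q2]; exists q; rewrite ltr_distlC q1 q2.
exists (sval (rq z.1), \row_i sval (rq (z.2 ord0 i)), k) => //.
rewrite /F asboolT; last first.
  move=> w [/= w1 w2]; apply: eO; split => /=.
    rewrite (le_lt_trans (ler_distD (ratr (sval (rq z.1))) _ _))//.
    rewrite [ltRHS](splitr e) ltrD ?(lt_trans _ ke)// distrC.
    exact: (svalP (rq z.1)).
  move=> i; have := w2 i; rewrite !mxE => w2i.
  rewrite (le_lt_trans (ler_distD (ratr (sval (rq (z.2 ord0 i)))) _ _))//.
  rewrite [ltRHS](splitr e) ltrD ?(lt_trans _ ke)// distrC.
  exact: (svalP (rq (z.2 ord0 i))).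
split=> /=; first exact: (svalP (rq z.1)).
by move=> i; rewrite !mxE; exact: (svalP (rq (z.2 ord0 i))).
Qed.

Lemma continuous_measurable_strip (f : RxT -> R) : continuous f ->
  measurable_fun setT (f : mRxT -> R).
Proof.
move=> cf; apply: (measurability _ (RGenOInfty.measurableE R)) => //.
move=> _ [_ [a ->] <-]; rewrite setTI; apply: open_measurable_strip.
by apply: open_comp => //; exact: open_gt.
Qed.

End strip_measurability.

Section slide.
Context {R : realType} {d : nat}.
Local Notation mR := (measurableTypeR R).
Local Notation RxT := (R * 'rV[R]_d)%type.
Local Notation mRxT := (mR * 'rV[mR]_d)%type.
Local Notation mu := (strip_measure R d).

(** A translation along the [i]-th circle by an amount that depends on [s]; it preserves the measure of the cylinder. *)
Definition slide (i : 'I_d) (c : R -> R) (z : RxT) : RxT :=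
  (z.1, z.2 + c z.1 *: delta_mx 0 i).

Variables (i : 'I_d) (c : R -> R).
Hypothesis mc : measurable_fun setT c.

Lemma measurable_slide : measurable_fun setT (slide i c : mRxT -> mRxT).
Proof.
apply: measurable_fun_pair; first exact: measurable_fst.
apply: measurable_fun_rV => j.
rewrite [X in measurable_fun _ X](_ : _ = fun z : mRxT =>
    (z.2 ord0 j : R) + c z.1 * (j == i)%:R); last first.
  by apply/funext => x; rewrite !mxE eqxx.
apply: measurable_funD.
  exact: (measurableT_comp (measurable_rV_coord j) measurable_snd).
apply: measurable_funM; last exact: measurable_cst.
exact: (measurableT_comp mc measurable_fst).
Qed.

(** For each [s] this is a translation of the torus. *)
Lemma ge0_slide_integral (F : RxT -> \bar R) :
  measurable_fun setT (F : mRxT -> _) -> (forall z, (0 <= F z)%E) ->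
  on_torus F -> (\int[mu]_z F (slide i c z) = \int[mu]_z F z)%E.
Proof.
move=> mF F0 perF; rewrite /strip_measure.
have mFs : measurable_fun setT (F \o slide i c : mRxT -> _).
  exact: (measurableT_comp mF measurable_slide).
have F0s z : (0 <= (F \o slide i c) z)%E by exact: F0.
rewrite [LHS](fubini_tonelli1 (F \o slide i c : mRxT -> _) mFs F0s).
rewrite [RHS](fubini_tonelli1 (F : mRxT -> _) mF F0).
apply: eq_integral => s _; rewrite /fubini_F/=.
rewrite -(torus_integral_shift i (c s) (f := fun x => F (s, x)))//.
exact: (measurableT_comp mF (pair1_measurable s)).
Qed.

Lemma slide_integrable (F : RxT -> \bar R) : on_torus F ->
  mu.-integrable setT (F : mRxT -> _) -> mu.-integrable setT (F \o slide i c : mRxT -> _).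
Proof.
move=> perF /integrableP[mF iF]; apply/integrableP; split.
  exact: (measurableT_comp mF measurable_slide).
rewrite (ge0_slide_integral (F := abse \o F))//.
- exact: measurableT_comp.
- by move=> z; exact: abse_ge0.
- by move=> s x y xy; rewrite /= perF.
Qed.

Lemma slide_integral (F : RxT -> \bar R) : on_torus F ->
  measurable_fun setT (F : mRxT -> _) ->
  (\int[mu]_z F (slide i c z) = \int[mu]_z F z)%E.
Proof.
move=> perF mF; rewrite -[LHS]/(integral mu setT (F \o slide i c)).
rewrite integralE [RHS]integralE funepos_comp funeneg_comp.
have perP : on_torus F^\+%E by move=> s x y xy; rewrite !funeposE perF.
have perN : on_torus F^\-%E by move=> s x y xy; rewrite !funenegE perF.
congr (_ - _)%E.
- exact: (@ge0_slide_integral F^\+%E (measurable_funepos mF)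
    (funepos_ge0 _) perP).
- exact: (@ge0_slide_integral F^\-%E (measurable_funeneg mF)
    (funeneg_ge0 _) perN).
Qed.

End slide.

Section shear.
Context {R : realType} {n : nat}.
Local Notation mR := (measurableTypeR R).
Local Notation RxT := (R * 'rV[R]_n.+1)%type.

(** Straightens the oblique lines: the vertical line above [y] is sent onto the line of direction [(1, sg e_1)] through [(0, y)]. *)
Definition shear (sg : R) : RxT -> RxT := slide ord0 ( *%R sg).

Lemma measurable_mulrl (sg : R) : measurable_fun setT ( *%R sg : mR -> R).
Proof. by apply: measurable_funM; [exact: measurable_cst|exact: measurable_id]. Qed.

End shear.

(** * Smooth periodic bumps *)

Section elementary_linear.
Context {R : realType}.

Lemma elementary_linear (V : normedModType R) (f : V -> R) :
  (forall a u v, f (a *: u + v) = a * f u + f v) -> continuous f -> elementary f.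
Proof.
move=> lf cf; pose m := GRing.isLinear.Build R V R^o _ f lf.
pose L : {linear V -> R^o} := HB.pack f m.
exact: (@elementary_lin _ _ L).
Qed.

Lemma elementary_sin (V : normedModType R) (f : V -> R) :
  elementary f -> elementary (sin \o f).
Proof.
move=> ef; have -> : sin \o f = cos \o (f \+ cst (- (pi / 2))).
  by apply/funext => x /=; rewrite cosBpihalf.
by apply: elementary_cos; apply: elementaryD => //; exact: elementary_cst.
Qed.

End elementary_linear.

Section arcs.
Context {R : realType}.
Implicit Types (a b t : R).

(** A trigonometric function on the circle that is positive exactly on the arc from [a] to [b], for [0 <= a < b <= 1]. *)
Definition arc a b t : R := sin (pi * (t - a)) * sin (pi * (b - t)).

Lemma arc_periodic a b t z : z \is a Num.int -> arc a b (t + z) = arc a b t.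
Proof.
have step s : arc a b (s + 1) = arc a b s.
  rewrite /arc [s + 1 - a]addrAC mulrDr mulr1 sinDpi.
  rewrite [b - (s + 1)](_ : _ = b - s - 1); last by ring.
  have := sinDpi (pi * (b - s - 1)); rewrite -[X in sin (_ + X)]mulr1 -mulrDr subrK.
  by move=> ->; rewrite mulrN mulNr.
have nat_step (n : nat) s : arc a b (s + n%:R) = arc a b s.
  elim: n => [|n IHn]; first by rewrite addr0.
  by rewrite -(@natr1 _ n) addrA step.
move=> /intrP[m ->]; case: m => [n|n]; first exact: nat_step.
by rewrite NegzE -(nat_step n.+1 (t + _)) intrN subrK.
Qed.

Lemma sin_pi_gt0 t : 0 < t < 1 -> 0 < sin (pi * t) :> R.
Proof.
move=> /andP[t0 t1]; apply: sin_gt0_pi; rewrite mulr_gt0 ?pi_gt0//=.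
by rewrite -[ltRHS]mulr1 ltr_pM2l ?pi_gt0.
Qed.

Lemma sin_pi_le0 t : - 1 < t <= 0 -> sin (pi * t) <= 0 :> R.
Proof.
move=> /andP[t1 t0]; rewrite -oppr_ge0 -sinN -mulrN sin_ge0_pi//.
rewrite mulr_ge0 ?pi_ge0 ?oppr_ge0//= -[leRHS]mulr1 ler_wpM2l ?pi_ge0//.
by rewrite lerNl ltW.
Qed.

Lemma arc_gt0 a b t : 0 <= a -> a < b -> b <= 1 -> 0 < t < 1 ->
  (0 < arc a b t) = (a < t < b).
Proof.
move=> a0 ab b1 /andP[t0 t1]; rewrite /arc.
have [at'|ta] := ltP a t; last first.
  apply/negbTE; rewrite -leNgt; apply: mulr_le0_ge0.
    by apply: sin_pi_le0; lra.
  by apply/ltW/sin_pi_gt0; lra.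
have [tb|bt] := ltP t b; first by apply: mulr_gt0; apply: sin_pi_gt0; lra.
apply/negbTE; rewrite -leNgt; apply: mulr_ge0_le0.
  by apply/ltW/sin_pi_gt0; lra.
by apply: sin_pi_le0; lra.
Qed.

Context {d : nat}.
Implicit Types (al be : 'I_d -> R) (x : 'rV[R]_d).

(** A periodic bump, tending inside the unit cell to the indicator of the box of sides [(al i, be i)] as [k] grows. *)
Definition theta al be k x : R :=
  \prod_(i < d) bump (k%:R * arc (al i) (be i) (x ord0 i)).

Lemma theta_ge0 al be k x : 0 <= theta al be k x.
Proof. by apply: prodr_ge0 => i _; exact: bump_ge0. Qed.

Lemma theta_le1 al be k x : theta al be k x <= 1.
Proof. by apply: prodr_ile1 => i _; rewrite bump_ge0 bump_le1. Qed.

Lemma theta_periodic al be k : Zperiodic (theta al be k).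
Proof.
move=> x y yZ; apply: eq_bigr => i _; rewrite mxE arc_periodic//.
exact: yZ.
Qed.

Lemma theta_cvg al be x : (forall i, 0 <= al i) -> (forall i, al i < be i) ->
  (forall i, be i <= 1) -> (forall i, 0 < x ord0 i < 1) ->
  theta al be k x @[k --> \oo] -->
    (([forall i, al i < x ord0 i < be i])%:R : R).
Proof.
move=> al0 albe be1 x01.
have -> : ([forall i, al i < x ord0 i < be i])%:R =
    \prod_(i < d) (0 < arc (al i) (be i) (x ord0 i))%R%:R :> R.
  case: (boolP [forall i, al i < x ord0 i < be i]) => [/forallP H|].
    by rewrite big1// => i _; rewrite arc_gt0// H.
  rewrite negb_forall => /existsP[i /negbTE ni].
  by rewrite (bigD1 i)//= arc_gt0// ni mul0r.
rewrite /theta; elim: (index_enum _) => [|i s IHs].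
  by under eq_fun do rewrite big_nil; rewrite big_nil; exact: cvg_cst.
under eq_fun do rewrite big_cons; rewrite big_cons.
by apply: cvgM => //; exact: bump_cvg.
Qed.

Lemma elementary_theta (V : normedModType R) al be k (u : 'I_d -> V -> R) :
  (forall i, elementary (u i)) ->
  elementary (fun z => theta al be k (\row_i u i z)).
Proof.
move=> eu; apply: elementary_prod => i.
apply: (@elementary_bump _ _ (fun z => k%:R * arc (al i) (be i) ((\row_i u i z) ord0 i))).
have -> : (fun z => k%:R * arc (al i) (be i) ((\row_i0 u i0 z) ord0 i)) =
   cst k%:R \* ((sin \o (cst pi \* (u i \+ cst (- al i)))) \*
                (sin \o (cst pi \* (cst (be i) \+ (cst (- 1) \* u i))))).
  by apply/funext => z; rewrite mxE /arc/= mulN1r.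
apply: elementaryM; first exact: elementary_cst.
apply: elementaryM; apply: elementary_sin; apply: elementaryM;
  try exact: elementary_cst; apply: elementaryD => //; try exact: elementary_cst.
by apply: elementaryM => //; exact: elementary_cst.
Qed.

(** Positive exactly between [s1] and [s2], and tending to the indicator as [k] grows. *)
Definition itv_bump (s1 s2 : R) k (s : R) : R := bump (k%:R * ((s - s1) * (s2 - s))).

Lemma itv_bump_ge0 s1 s2 k s : 0 <= itv_bump s1 s2 k s.
Proof. exact: bump_ge0. Qed.

Lemma itv_bump_le1 s1 s2 k s : itv_bump s1 s2 k s <= 1.
Proof. exact: bump_le1. Qed.

Lemma itv_prod_gt0 (s1 s2 s : R) : s1 < s2 -> (0 < (s - s1) * (s2 - s)) = (s1 < s < s2).
Proof.
move=> s12; have [h1|h1] := ltP s1 s; have [h2|h2] := ltP s s2 => /=.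
- by rewrite mulr_gt0 ?subr_gt0.
- by apply/negbTE; rewrite -leNgt mulr_ge0_le0 ?subr_le0 ?subr_ge0// ltW.
- by apply/negbTE; rewrite -leNgt mulr_le0_ge0 ?subr_le0 ?subr_ge0// ltW.
- by have := le_lt_trans (le_trans h2 h1) s12; rewrite ltxx.
Qed.

Lemma itv_bump_cvg s1 s2 s : s1 < s2 ->
  itv_bump s1 s2 k s @[k --> \oo] --> ((s1 < s < s2)%R%:R : R).
Proof. by move=> s12; rewrite -itv_prod_gt0//; exact: bump_cvg. Qed.

Lemma itv_bump_out s1 s2 k s : s1 < s2 -> ~~ (s1 < s < s2) -> itv_bump s1 s2 k s = 0.
Proof.
by move=> s12; rewrite -itv_prod_gt0// -leNgt => h; rewrite /itv_bump bump0// mulr_ge0_le0.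
Qed.

Lemma elementary_itv_bump (V : normedModType R) s1 s2 k (u : V -> R) :
  elementary u -> elementary (fun z => itv_bump s1 s2 k (u z)).
Proof.
move=> eu; apply: (@elementary_bump _ _ (fun z => k%:R * ((u z - s1) * (s2 - u z)))).
have -> : (fun z => k%:R * ((u z - s1) * (s2 - u z))) =
    cst k%:R \* ((u \+ cst (- s1)) \* (cst s2 \+ (cst (- 1) \* u))).
  by apply/funext => z /=; rewrite mulN1r.
by repeat (try exact: elementary_cst; try exact: eu; first [apply: elementaryM|apply: elementaryD]).
Qed.

End arcs.

(** * Boxes in the cylinder *)

Section null_integrals.
Local Open Scope ereal_scope.
Context d {T : measurableType d} {R : realType}.
Variable mu : {measure set T -> \bar R}.

(** The measurable sets of zero integral form a Dynkin system. *)
Lemma integral_null_generated (G : set (set T)) (f : T -> \bar R) :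
    @measurable _ T = <<s G >> -> setI_closed G ->
    mu.-integrable setT f -> \int[mu]_x f x = 0 ->
    (forall A, G A -> \int[mu]_(x in A) f x = 0) ->
  {ae mu, forall x, f x = 0}.
Proof.
move=> mG GI fi fT fG.
have f0 A : measurable A -> \int[mu]_(x in A) f x = 0.
  rewrite mG; apply: (@dynkin_induction _ _ _ (fun A => \int[mu]_(x in A) f x = 0) mG GI) => //.
  - move=> S mS fS; have mCS := measurableC mS.
    have mfU : measurable_fun (S `|` ~` S) f.
      by rewrite setUv; exact: measurable_int fi.
    have dS : [disjoint S & ~` S] by rewrite disj_set2E setICr.
    have := integral_setU mu mS mCS mfU dS.
    by rewrite setUv fS fT add0e => <-.
  - move=> F mF tF fF; rewrite integral_bigcup//; last first.
      by apply: (integrableS measurableT) => //; exact: bigcup_measurable.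
    by rewrite eseries0// => i _ _; exact: fF.
have : ae_eq mu setT f (cst 0).
  apply: integral_ae_eq => //.
  by move=> A _ mA; rewrite f0// integral0.
by apply: filterS => x /= /(_ I).
Qed.

End null_integrals.

Section torus_box.
Context {R : realType}.
Local Notation mR := (measurableTypeR R).

Lemma uniform_itvoo (a b : R) : 0 <= a -> a <= b -> b <= 1 ->
  uniform_prob (@ltr01 R) `]a, b[%classic = (b - a)%:E.
Proof.
move=> a0 ab b1; rewrite /uniform_prob.
rewrite (eq_integral (cst 1%E)); last first.
  move=> x; rewrite inE/= in_itv/= => /andP[ax xb]; rewrite /uniform_pdf.
  by rewrite (ltW (le_lt_trans a0 ax)) (ltW (lt_le_trans xb b1)) subr0 invr1.
rewrite integral_cst//= mul1e lebesgue_measure_itv/= lte_fin.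
by case: ltP => // ba; rewrite (@le_anti _ _ a b) ?subrr// ab.
Qed.

Lemma measurable_rV_itvoo n (al be : 'I_n -> R) :
  measurable ([set x : 'rV[R]_n | forall i, al i < x ord0 i < be i]
    : set 'rV[mR]_n).
Proof.
rewrite (_ : mkset _ = [set x : 'rV[mR]_n | forall i,
    `]al i, be i[%classic (x ord0 i)]); first by apply: (@measurable_rV_box n _ mR (fun i => `]al i, be i[%classic)) => i.
by apply/seteqP; split => x xi i; have := xi i; rewrite /= in_itv.
Qed.

Lemma torus_box n (al be : 'I_n -> R) : (forall i, 0 <= al i) ->
  (forall i, al i <= be i) -> (forall i, be i <= 1) ->
  torus_measure R n [set x : 'rV[R]_n | forall i, al i < x ord0 i < be i] =
  (\prod_(i < n) (be i - al i))%:E.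
Proof.
elim: n => [|n IHn] in al be *.
  move=> _ _ _; rewrite big_ord0 /= diracE.
  by rewrite mem_set// => -[].
move=> al0 albe be1; rewrite big_ord_recl EFinM.
rewrite -(@uniform_itvoo (al ord0) (be ord0))// -(IHn (al \o lift ord0) (be \o lift ord0))//=.
rewrite /distribution/pushforward/= -product_measure1E//; last first.
  exact: measurable_rV_itvoo.
congr (_ _); apply/seteqP; split => [[t x] /= H|[t x] [/= H1 H2] i].
  split=> [|i] /=; first by have := H ord0; rewrite mxE unlift_none in_itv.
  by have := H (lift ord0 i); rewrite mxE liftK.
by rewrite mxE; case: unliftP => [j ->|->] /=; [exact: H2|rewrite in_itv/= in H1].
Qed.

End torus_box.

Section strip_boxes.
Context {R : realType} {d : nat}.
Local Notation mR := (measurableTypeR R).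
Local Notation RxT := (R * 'rV[R]_d)%type.
Local Notation mRxT := (mR * 'rV[mR]_d)%type.
Local Notation mu := (strip_measure R d).

Definition obox (a b : R) (al be : 'I_d -> R) : set RxT :=
  [set z : RxT | a < z.1 < b /\ forall i, al i < z.2 ord0 i < be i].

Lemma measurable_obox a b al be : measurable (obox a b al be : set mRxT).
Proof.
have -> : obox a b al be = `]a, b[%classic `*`
    [set x : 'rV[R]_d | forall i, al i < x ord0 i < be i].
  by apply/seteqP; split => z /=; rewrite in_itv.
by apply: measurableX; [exact: measurable_itv|exact: measurable_rV_itvoo].
Qed.

Lemma setI_obox a b al be a' b' al' be' : obox a b al be `&` obox a' b' al' be' =
  obox (Num.max a a') (Num.min b b') (fun i => Num.max (al i) (al' i))
    (fun i => Num.min (be i) (be' i)).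
Proof.
apply/seteqP; split => z /=; rewrite /obox/= !lt_min !gt_max.
  move=> [[/andP[-> ->] z2] [/andP[-> ->] z2']]; split=> // i.
  by rewrite lt_min gt_max; move: (z2 i) (z2' i) => /andP[-> ->] /andP[-> ->].
move=> [/andP[/andP[-> ->] /andP[-> ->]] z2]; split; split=> // i;
  by have := z2 i; rewrite lt_min gt_max => /andP[/andP[a1 a2] /andP[b1 b2]];
  rewrite ?a1 ?a2 ?b1 ?b2.
Qed.

Definition oboxes : set (set RxT) :=
  [set A | exists a b al be, A = obox a b al be].

(** Both coordinates are measurable for the sigma-algebra of boxes, since half-spaces are countable unions of boxes. *)
Lemma measurable_oboxes : @measurable _ mRxT = <<s oboxes >>.
Proof.
apply/seteqP; split; last first.
  apply: smallest_sub; first exact: sigma_algebra_measurable.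
  by move=> _ [a [b [al [be ->]]]]; exact: measurable_obox.
pose T' := g_sigma_algebraType oboxes.
have bound (z : RxT) : exists N : nat, `|z.1| < N%:R /\ forall i, `|z.2 ord0 i| < N%:R.
  exists (Num.truncn (`|z.1| + \sum_(i < d) `|z.2 ord0 i|)).+1.
  split=> [|i]; apply: le_lt_trans (truncnS_gt _).
    by rewrite lerDl sumr_ge0.
  rewrite (bigD1 i)//= addrCA lerDl addr_ge0//= sumr_ge0//.
have mO a b al be : @measurable _ T' (obox a b al be).
  by apply: sub_sigma_algebra; exists a, b, al, be.
suff mid : measurable_fun setT (id : T' -> mRxT).
  by move=> A mA; have := mid measurableT A mA; rewrite setTI.
apply/measurable_fun_pairP; split.
  apply: (measurability _ (RGenOInfty.measurableE R)) => //.
  move=> _ [_ [c ->] <-]; rewrite setTI.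
  have -> : (fst \o (id : T' -> mRxT)) @^-1` `]c, +oo[ =
      \bigcup_(N : nat) obox c N%:R (fun=> - N%:R) (fun=> N%:R).
    apply/seteqP; split => z /=; rewrite in_itv/= andbT; last first.
      by move=> [N _ []] /andP[].
    move=> cz; have [N [z1 z2]] := bound z; exists N => //; split.
      by rewrite cz (le_lt_trans (ler_norm _)).
    by move=> i; have := z2 i; rewrite ltr_norml.
  exact: bigcupT_measurable.
apply: measurable_fun_rV => i.
apply: (measurability _ (RGenOInfty.measurableE R)) => //.
move=> _ [_ [c ->] <-]; rewrite setTI.
have -> : (fun t : T' => (snd \o (id : T' -> mRxT)) t ord0 i) @^-1` `]c, +oo[ =
    \bigcup_(N : nat) obox (- N%:R) N%:R
      (fun j => if j == i then c else - N%:R) (fun=> N%:R).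
  apply/seteqP; split => z /=; rewrite in_itv/= andbT; last first.
    by move=> [N _ [_ /(_ i)]]; rewrite eqxx => /andP[].
  move=> cz; have [N [z1 z2]] := bound z; exists N => //; split.
    by move: z1; rewrite ltr_norml.
  move=> j; have := z2 j; rewrite ltr_norml => /andP[Nz ->].
  by case: eqP => [->|_]; rewrite ?cz ?Nz.
exact: bigcupT_measurable.
Qed.

(** The faces of the fundamental cell are null, so that boxes inside the open cell see almost every point. *)
Lemma strip_cell_ae :
  {ae mu, forall z : RxT, forall i, 0 < z.2 ord0 i < 1}.
Proof.
pose C := [set x : 'rV[R]_d | forall i, 0 < x ord0 i < 1].
have mC : measurable (C : set 'rV[mR]_d) by exact: measurable_rV_itvoo.
suff: mu.-negligible (setT `*` ~` C : set mRxT).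
  apply: negligibleS => z /= zC; split => // Cz; apply: zC => i; exact: Cz.
apply/negligibleP; first by apply: measurableX => //; exact: measurableC.
have nuC : torus_measure R d (~` C) = 0.
  rewrite (@probability_setC _ _ _ (torus_measure R d) _ mC).
  rewrite (@torus_box R d (fun=> 0) (fun=> 1))//.
  by rewrite big1 => [|i _]; rewrite ?subee// subr0.
have E := product_measure1E (@lebesgue_measure R) (torus_measure R d) measurableT
  (measurableC mC).
by apply: (etrans E); rewrite [X in (_ * X)%E]nuC mule0.
Qed.

End strip_boxes.

(** * The fundamental lemma of the calculus of variations *)

Lemma ae_imply d (T : measurableType d) (R : realType)
    (mu : {measure set T -> \bar R}) (P Q : T -> Prop) :
  (forall x, P x -> Q x) -> {ae mu, forall x, P x} -> {ae mu, forall x, Q x}.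
Proof. by move=> PQ; apply: filterS. Qed.

Lemma ae_imply2 d (T : measurableType d) (R : realType)
    (mu : {measure set T -> \bar R}) (P Q S : T -> Prop) :
  (forall x, P x -> Q x -> S x) -> {ae mu, forall x, P x} ->
  {ae mu, forall x, Q x} -> {ae mu, forall x, S x}.
Proof. by move=> PQ; apply: filterS2. Qed.

Section fundamental_lemma.
Context {R : realType} {d : nat}.
Local Notation mR := (measurableTypeR R).
Local Notation RxT := (R * 'rV[R]_d)%type.
Local Notation mRxT := (mR * 'rV[mR]_d)%type.
Local Notation mu := (strip_measure R d).

Lemma elementary_fst : elementary (fun z : RxT => z.1).
Proof. by apply: elementary_linear => // z; exact: cvg_fst. Qed.

Lemma elementary_snd i : elementary (fun z : RxT => z.2 ord0 i).
Proof.
apply: elementary_linear => [a u v|z]; first by rewrite !mxE.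
apply: (@continuous_comp _ _ _ snd (fun x : 'rV[R]_d => x ord0 i)).
  exact: cvg_snd.
exact: coord_continuous.
Qed.

Definition strip_test (a b : R) (al be : 'I_d -> R) (k : nat) (z : RxT) : R :=
  itv_bump a b k z.1 * theta al be k z.2.

Lemma elementary_strip_test a b al be k : elementary (strip_test a b al be k).
Proof.
apply: (@elementaryM _ _ (fun z : RxT => itv_bump a b k z.1)
  (fun z : RxT => theta al be k z.2)).
  exact/elementary_itv_bump/elementary_fst.
rewrite (_ : (fun _ => _) = fun z : RxT => theta al be k (\row_i z.2 ord0 i)).
  exact/elementary_theta/elementary_snd.
by apply/funext => z; congr theta; apply/rowP => i; rewrite mxE.
Qed.

Lemma elementary_measurable (f : RxT -> R) : elementary f ->
  measurable_fun setT (f : mRxT -> R).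
Proof.
by move=> /elementary_smooth /(_ 0%N) cf; exact: continuous_measurable_strip.
Qed.

Lemma strip_test_bound a b al be k z : a < b ->
  `|strip_test a b al be k z| <= (a < z.1 < b)%R%:R.
Proof.
move=> ab; rewrite /strip_test; case: (boolP (a < z.1 < b)) => [_|nab] /=.
  rewrite normrM !ger0_norm ?itv_bump_ge0 ?theta_ge0//.
  by rewrite mulr_ile1 ?itv_bump_ge0 ?theta_ge0 ?itv_bump_le1 ?theta_le1.
by rewrite itv_bump_out// mul0r normr0.
Qed.

Lemma measurable_slab M : measurable (slab M : set mRxT).
Proof.
have -> : (slab M : set mRxT) = `[- M, M]%classic `*` setT.
  by apply/seteqP; split => z; rewrite /slab/= in_itv/= ler_norml;
    [|case].
by apply: measurableX => //; exact: measurable_itv.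
Qed.

Lemma itv_slab (a b s : R) : a < s < b -> `|s| <= `|a| + `|b|.
Proof.
move=> /andP[as_ sb]; rewrite ler_norml; apply/andP; split.
  by rewrite lerNl; have := ler_norm (- a); have := normr_ge0 b; rewrite normrN; lra.
by have := ler_norm b; have := normr_ge0 a; lra.
Qed.

Variable f : RxT -> R.
Hypothesis mf : measurable_fun setT (f : mRxT -> R).
Hypothesis f_loc : forall M, mu.-integrable (slab M : set mRxT) (EFin \o f).
Hypothesis f_null : forall a b al be k, a < b -> (forall i, 0 <= al i) ->
  (forall i, al i < be i) -> (forall i, be i <= 1) ->
  \int[mu]_z (f z * strip_test a b al be k z) = 0.

Let integrable_restrict_slab M : mu.-integrable setT (EFin \o (f \_ (slab M)) : mRxT -> _).
Proof.
rewrite -restrict_EFin.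
by apply/integrable_restrict => //; [exact: measurable_slab|rewrite setTI; exact: f_loc].
Qed.

Let f_null_box a b al be : a < b -> (forall i, 0 <= al i) ->
  (forall i, al i < be i) -> (forall i, be i <= 1) ->
  (\int[mu]_(z in (obox a b al be : set mRxT)) (f z)%:E = 0)%E.
Proof.
move=> ab al0 albe be1; rewrite integral_mkcond.
pose g := fun z : mRxT => `|(f \_ (slab (`|a| + `|b|))) z|%:E.
have mtest k : measurable_fun setT (strip_test a b al be k : mRxT -> R).
  by apply: elementary_measurable; apply: elementary_strip_test.
have fbound k z : (`|f z * strip_test a b al be k z| <= `|(f \_ (slab (`|a| + `|b|))) z|)%R.
  rewrite normrM (le_trans (ler_wpM2l _ (strip_test_bound _ _ _ _ ab)))//.
  case: (boolP (a < z.1 < b)) => [zab|_]; last by rewrite mulr0.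
  by rewrite mulr1 patchE mem_set// /slab/= itv_slab.
have ig : mu.-integrable setT g.
  have := integrable_abse (integrable_restrict_slab (`|a| + `|b|)).
  by apply: eq_integrable.
have mft k : measurable_fun setT (fun z : mRxT => (f z * strip_test a b al be k z)%:E).
  by apply/measurable_EFinP; exact: measurable_funM.
have fin k : (\int[mu]_z (f z * strip_test a b al be k z)%:E = 0)%E.
  have := f_null k ab al0 albe be1; rewrite /Rintegral => H.
  rewrite -[LHS]fineK ?H//; apply: integrable_fin_num => //.
  by apply: le_integrable ig => // z _; rewrite /= lee_fin normr_id; exact: fbound.
have cvf : {ae mu, forall z : mRxT, setT z ->
    (fun k => (f z * strip_test a b al be k z)%:E) @ \oo -->
    (((EFin \o f) : mRxT -> \bar R) \_ (obox a b al be)) z}.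
  apply: ae_imply (@strip_cell_ae R d) => z z01 _.
  have cv : f z * strip_test a b al be k z @[k --> \oo] --> f z *
      ((a < z.1 < b)%R%:R * ([forall i, al i < z.2 ord0 i < be i])%:R).
    apply: cvgMr; rewrite /strip_test; apply: cvgM.
      exact: itv_bump_cvg.
    exact: theta_cvg.
  have -> : (((EFin \o f) : mRxT -> \bar R) \_ (obox a b al be)) z =
     (f z * ((a < z.1 < b)%R%:R * ([forall i, al i < z.2 ord0 i < be i])%:R))%:E.
    rewrite patchE; case: ifPn => [|].
      by rewrite inE => -[-> /forallP ->]; rewrite !mulr1.
    rewrite notin_setE => nz; rewrite -natrM mulnb; case: andP => [[z1 /forallP z2]|_].
      by exfalso; apply: nz.
    by rewrite mulr0.
  by apply: cvg_EFin; [exact: nearW|exact: cv].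
have fg : {ae mu, forall (z : mRxT) k, setT z ->
    (`|(f z * strip_test a b al be k z)%:E| <= g z)%E}.
  by apply: aeW => z k _; rewrite lee_fin; exact: fbound.
have mlim : measurable_fun setT (((EFin \o f) : mRxT -> \bar R) \_ (obox a b al be)).
  apply/(measurable_restrictT _ (measurable_obox a b al be)).
  by apply: measurable_funTS; exact/measurable_EFinP.
have [_ _] := dominated_convergence measurableT mft mlim cvf ig fg.
under eq_fun do rewrite fin.
by move=> /(cvg_unique _ (cvg_cst _)) ->.
Qed.

(** The tests converge to indicators of boxes, so [f] has zero integral over every box by dominated convergence; boxes are stable under intersection and generate the sigma-algebra, and countably many cells exhaust the cylinder. *)
Lemma strip_fundamental : {ae mu, forall z, f z = 0}.
Proof.
pose C (N : nat) : set RxT := obox (- N.+1%:R) N.+1%:R (fun=> 0) (fun=> 1).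
have C0 N : {ae mu, forall z : mRxT, C N z -> f z = 0}.
  pose F : mRxT -> \bar R := (EFin \o f : mRxT -> \bar R) \_ (C N).
  have mC : measurable (C N : set mRxT) by exact: measurable_obox.
  have iF : mu.-integrable setT F.
    apply/integrable_restrict => //; rewrite setTI.
    apply: (integrableS (measurable_slab N.+1%:R)) => //.
    by move=> z [/andP[z1 z2] _]; rewrite /slab/= ler_norml !ltW.
  have FE A : (\int[mu]_(z in A) F z = \int[mu]_(z in A `&` C N) (f z)%:E)%E.
    by rewrite /F -integral_mkcondr.
  have N0 : - N.+1%:R < N.+1%:R :> R by rewrite gtrN.
  have F0 : {ae mu, forall z : mRxT, F z = 0%E}.
    apply: (@integral_null_generated _ mRxT R mu (@oboxes R d) F) => //.
    - exact: measurable_oboxes.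
    - move=> _ _ [a [b [al [be ->]]]] [a' [b' [al' [be' ->]]]].
      by rewrite setI_obox; do 4 eexists.
    - by rewrite FE setTI f_null_box// => i; rewrite ltr01.
    - move=> _ [a [b [al [be ->]]]]; rewrite FE setI_obox.
      set a' := Num.max _ _; set b' := Num.min _ _.
      set al' := fun i => _; set be' := fun i => _.
      have [ab|ba] := ltP a' b'; last first.
        rewrite (_ : obox _ _ _ _ = set0) ?integral_set0//.
        apply/seteqP; split => // z [/andP[z1 z2] _].
        by have := le_lt_trans ba (lt_trans z1 z2); rewrite ltxx.
      have [/forallP H|] := boolP [forall i, al' i < be' i]; last first.
        rewrite negb_forall => /existsP[i]; rewrite -leNgt => ba.
        rewrite (_ : obox _ _ _ _ = set0) ?integral_set0//.
        apply/seteqP; split => // z [_ /(_ i) /andP[z1 z2]].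
        by have := le_lt_trans ba (lt_trans z1 z2); rewrite ltxx.
      apply: f_null_box => // i; first by rewrite /al' le_max lexx orbT.
      by rewrite /be' ge_min lexx orbT.
  apply: ae_imply F0 => z + Cz; by rewrite /F patchE mem_set// => -[].
apply: ae_imply2 (@strip_cell_ae R d) (ae_foralln C0) => z z01 Cz.
apply: (Cz (Num.truncn `|z.1|)); split => //.
by rewrite -ltr_norml truncnS_gt.
Qed.

End fundamental_lemma.

Section tensor.
Context d1 d2 (T1 : measurableType d1) (T2 : measurableType d2) {R : realType}.
Variable m1 : {sigma_finite_measure set T1 -> \bar R}.
Variable m2 : {sigma_finite_measure set T2 -> \bar R}.

Lemma integrable_tensor (h : T1 -> R) (A : T2 -> R) :
  m1.-integrable setT (EFin \o h) -> m2.-integrable setT (EFin \o A) ->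
  (m1 \x m2)%E.-integrable setT (fun z => (h z.1 * A z.2)%:E).
Proof.
move=> ih iA.
have mh : measurable_fun setT h by apply/measurable_EFinP; exact: measurable_int ih.
have mA : measurable_fun setT A by apply/measurable_EFinP; exact: measurable_int iA.
have mhA : measurable_fun setT (fun z : T1 * T2 => (h z.1 * A z.2)%:E).
  apply/measurable_EFinP; apply: measurable_funM.
    exact: (measurableT_comp mh measurable_fst).
  exact: (measurableT_comp mA measurable_snd).
apply/(integrable12ltyP m1 m2 mhA).
have -> : (fun x => \int[m2]_y `|(h (x, y).1 * A (x, y).2)%:E|)%E =
    (fun x => (`|h x|%:E * \int[m2]_y `|(A y)%:E|)%E).
  apply/funext => x /=; rewrite -ge0_integralZl//.
  - by apply: eq_integral => y _; rewrite -EFinM normrM.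
  - by apply/measurable_EFinP; exact: measurableT_comp.
have [_ ltA] := integrableP _ _ _ iA; have [_ lth] := integrableP _ _ _ ih.
rewrite ge0_integralZr//; last 2 first.
- by apply/measurable_EFinP; exact: measurableT_comp.
- exact: integral_ge0.
by apply: lte_mul_pinfty => //; [exact: integral_ge0|rewrite ge0_fin_numE// integral_ge0].
Qed.

End tensor.

Section torus_fundamental_lemma.
Context {R : realType} {d : nat}.
Local Notation mR := (measurableTypeR R).
Local Notation RxT := (R * 'rV[R]_d)%type.
Local Notation mRxT := (mR * 'rV[mR]_d)%type.
Local Notation mu := (strip_measure R d).
Local Notation nu := (torus_measure R d).
Local Notation leb := (@lebesgue_measure R).

Lemma measurable_theta al be k :
  measurable_fun setT (theta al be k : 'rV[mR]_d -> R).
Proof.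
have := elementary_measurable (@elementary_theta R d _ al be k
  (fun i (z : RxT) => z.2 ord0 i) elementary_snd).
move=> /measurableT_comp /(_ (pair1_measurable (0 : mR))) /=.
congr measurable_fun; apply/funext => y /=; congr theta.
by apply/rowP => i; rewrite mxE.
Qed.

(** The function [A], seen as a function on the cylinder that is constant in [s], satisfies the hypotheses on the cylinder because the tests are products. *)
Lemma torus_fundamental (A : 'rV[R]_d -> R) :
    nu.-integrable setT (EFin \o A : 'rV[mR]_d -> _) ->
    (forall al be k, (forall i, 0 <= al i) -> (forall i, al i < be i) ->
       (forall i, be i <= 1) -> \int[nu]_y (A y * theta al be k y) = 0) ->
  {ae nu, forall y, A y = 0}.
Proof.
move=> iA A0.
have mA : measurable_fun setT (A : 'rV[mR]_d -> R).
  by apply/measurable_EFinP; exact: measurable_int iA.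
have mth al be k := measurable_theta al be k.
have ith al be k : nu.-integrable setT ((fun y => (A y * theta al be k y)%:E) : 'rV[mR]_d -> _).
  apply: le_integrable iA => //.
    by apply/measurable_EFinP; exact: measurable_funM.
  move=> y _; rewrite /= lee_fin normrM ler_piMr// ger0_norm ?theta_ge0//.
  exact: theta_le1.
have ib a b k : a < b -> leb.-integrable setT (EFin \o (itv_bump a b k : R -> R)).
  move=> ab; apply: le_integrable (integrable_indic_itv a b true false) => //.
  - apply/measurable_EFinP; apply: continuous_measurable_fun.
    have : elementary (fun s : R => itv_bump a b k s).
      by apply: elementary_itv_bump; apply: elementary_linear => // z.
    by move=> /elementary_smooth /(_ 0%N).
  - move=> s _; rewrite /= lee_fin ger0_norm ?itv_bump_ge0// ger0_norm// indicE.
    have [sab|sab] := boolP (a < s < b); last by rewrite itv_bump_out.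
    rewrite mem_set ?itv_bump_le1//= in_itv/=.
    by move: sab => /andP[? ?]; rewrite !ltW.
have : {ae mu, forall z : mRxT, A z.2 = 0}.
  apply: (@strip_fundamental R d (fun z => A z.2)).
  - exact: (measurableT_comp mA measurable_snd).
  - move=> M; have := integrable_tensor (integrable_indic_itv (- M) M true false) iA.
    move=> /integrableS -/(_ (slab M : set mRxT)) H.
    have := H measurableT (measurable_slab M) (@subsetT _ _).
    apply: eq_integrable; first exact: measurable_slab.
    move=> z; rewrite inE /slab/= ler_norml => zM; rewrite indicE mem_set ?mul1r//.
  - move=> a b al be k ab al0 albe be1; rewrite /Rintegral.
    have := integral12_prod_meas1 (integrable_tensor (ib a b k ab) (ith al be k)).
    rewrite /fubini_F/=.
    rewrite (eq_integral (cst 0%E)) ?integral0; last first.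
      move=> s _ /=; under eq_integral do rewrite EFinM.
      rewrite integralZl//= -[X in (_ * X)%E]fineK; last exact: integrable_fin_num.
      by rewrite [fine _]A0// mule0.
    move=> /esym E; rewrite -[RHS]/(fine 0%E) -[in RHS]E; congr fine.
    by apply: eq_integral => z _; rewrite /strip_test mulrCA.
pose N := [set y : 'rV[mR]_d | A y != 0].
have mN : measurable N.
  have -> : N = setT `&` (A : 'rV[mR]_d -> R) @^-1` [set~ 0].
    by rewrite setTI; apply/seteqP; split => y /= /eqP.
  by apply: mA => //; exact: measurableC.
move=> aeA.
have muN : mu (setT `*` N : set mRxT) = 0.
  apply: measure_negligible; first exact: measurableX.
  by move: aeA; apply: negligibleS => z [_ /= /eqP].
have E := product_measure1E leb nu measurableT mN.
have : (leb setT * nu N = 0)%E by rewrite -E; exact: muN.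
move=> /eqP; rewrite mule_eq0 => /orP[/eqP l0|/eqP nuN].
  have : (leb `[0%R, 1%R]%classic <= leb setT)%E by rewrite le_measure ?inE//=.
  by rewrite l0 lebesgue_measure_itv/= lte_fin ltr01 oppr0 adde0 lee_fin ler10.
suff: nu.-negligible N by apply: negligibleS => y /= /eqP.
exact/negligibleP.
Qed.

End torus_fundamental_lemma.

Section square_integrable.
Context {R : realType} {d : nat}.
Local Notation mR := (measurableTypeR R).
Local Notation RxT := (R * 'rV[R]_d)%type.
Local Notation mRxT := (mR * 'rV[mR]_d)%type.
Local Notation mu := (strip_measure R d).

Lemma strip_measure_slab M : (mu (slab M : set mRxT) < +oo)%E.
Proof.
have -> : (slab M : set mRxT) = `[- M, M]%classic `*` setT.
  by apply/seteqP; split => z; rewrite /slab/= in_itv/= ler_norml;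
    [|case].
have E := product_measure1E (@lebesgue_measure R) (torus_measure R d)
  (measurable_itv `[- M, M]) measurableT.
apply: (@eq_ind_r _ _ (fun x => x < +oo)%E _ _ E).
rewrite [X in (_ * X)%E]probability_setT mule1 [X in (X < _)%E]lebesgue_measure_itv/=.
by case: ifP => _; rewrite ?ltry// -EFinN -EFinD ltry.
Qed.

(** On a set of finite measure, [`|f|] is bounded by [f^2 + 1]. *)
Lemma Lfun2_slab (f : RxT -> R) M :
  (f : mRxT -> R) \in Lfun mu 2%:E -> mu.-integrable (slab M : set mRxT) (EFin \o f).
Proof.
move=> f2; have mf : measurable_fun setT (f : mRxT -> R).
  by have := sub_Lfun_mfun f2; rewrite inE.
have i2 := Lfun2_integrable_sqr f2.
have i21 : mu.-integrable (slab M : set mRxT) (fun z => (f z ^+ 2)%:E + 1%:E)%E.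
  apply: integrableD; first exact: measurable_slab.
    by apply: integrableS i2 => //; exact: measurable_slab.
  apply/integrableP; split; first exact/measurable_EFinP.
  rewrite integral_cst; last exact: measurable_slab.
  by rewrite normr1 mul1e strip_measure_slab.
apply: le_integrable i21.
- exact: measurable_slab.
- by apply/measurable_EFinP; exact: measurable_funTS.
move=> z _; rewrite /= lee_fin [leRHS]ger0_norm; last by rewrite addr_ge0 ?sqr_ge0.
rewrite ler_norml; nra.
Qed.

End square_integrable.

(** * Primitives of locally integrable functions *)

Section absolutely_continuous.
Context {R : realType}.
Local Notation mR := (measurableTypeR R).
Local Notation leb := (@lebesgue_measure R).
Implicit Types (p dp psi dpsi : R -> R).

(** Absolute continuity on bounded intervals, with a chosen representative [dp] of the derivative. *)
Definition primitive p dp : Prop :=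
  (forall a b, leb.-integrable `[a, b]%classic (EFin \o dp)) /\
  (forall s t, s <= t -> p t - p s = \int[leb]_(r in `[s, t]) dp r).

Lemma primitive_measurable p dp : primitive p dp -> measurable_fun setT dp.
Proof.
move=> [idp _]; have -> : [set: R] = \bigcup_(n : nat) `[- n%:R, n%:R]%classic.
  apply/seteqP; split => // x _; exists (Num.truncn `|x|).+1 => //=.
  by rewrite in_itv/= -ler_norml ltW// truncnS_gt.
apply/measurable_fun_bigcup => n; first exact: measurable_itv.
by apply/measurable_EFinP; exact: measurable_int (idp _ _).
Qed.

Lemma derive_eq0_out psi dpsi M : (forall t : R, is_derive t (1 : R) psi (dpsi t)) ->
  (forall t, M < `|t| -> psi t = 0) -> forall t, M < `|t| -> dpsi t = 0.
Proof.
move=> dpsiP psi0 t Mt.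
have : is_derive t (1 : R) psi 0.
  apply: (@near_eq_is_derive _ _ _ (cst 0)).
  near=> s; rewrite psi0//; near: s.
  have : {for t, continuous (fun s : R => `|s|)} by exact: norm_continuous.
  by move/(_ _ (lt_nbhsr Mt)).
by move=> [_ <-]; have [_ ->] := dpsiP t.
Unshelve. all: by end_near. Qed.

Lemma Rintegral_support (f : R -> R) (A : set R) : (forall t, ~ A t -> f t = 0) ->
  \int[leb]_t f t = \int[leb]_(t in A) f t.
Proof.
move=> f0; rewrite [RHS]Rintegral_mkcond; apply: eq_Rintegral => t _.
by rewrite patchE; case: ifPn => //; rewrite notin_setE => /f0.
Qed.

Lemma FTC_cc psi dpsi a b : a <= b ->
  (forall t : R, is_derive t (1 : R) psi (dpsi t)) -> continuous dpsi ->
  (\int[leb]_(t in `[a, b]) (dpsi t)%:E = (psi b - psi a)%:E)%E.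
Proof.
rewrite le_eqVlt => /predU1P[->|ab] dpsiP cd.
  by rewrite set_itv1 integral_set1 subrr.
have cpsi : continuous psi.
  move=> t; apply: differentiable_continuous; apply/derivable1_diffP.
  by have [] := dpsiP t.
rewrite (@continuous_FTC2 _ dpsi psi)//.
- exact: continuous_subspaceT.
- split.
  + by move=> t _; have [] := dpsiP t.
  + exact/cvg_at_right_filter/cpsi.
  + exact/cvg_at_left_filter/cpsi.
- by move=> t _; rewrite derive1E; have [_ ->] := dpsiP t.
Qed.

Lemma integrable_continuous_cc (f : R -> R) a b : continuous f ->
  leb.-integrable `[a, b]%classic (EFin \o f).
Proof.
move=> cf; apply: continuous_compact_integrable; first exact: segment_compact.
exact: continuous_subspaceT.
Qed.

(** Fubini's theorem for [dp r * dpsi t] on the triangle [r <= t]. *)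
Lemma primitive_by_parts p dp psi dpsi M :
    primitive p dp -> continuous p ->
    (forall t : R, is_derive t (1 : R) psi (dpsi t)) -> continuous dpsi ->
    (forall t, M < `|t| -> psi t = 0) ->
  \int[leb]_t (p t * dpsi t) = - \int[leb]_t (dp t * psi t).
Proof.
move=> pdp cp dpsiP cd psi0.
have cpsi : continuous psi.
  move=> t; apply: differentiable_continuous; apply/derivable1_diffP.
  by have [] := dpsiP t.
have dpsi0 := derive_eq0_out dpsiP psi0.
have [idp pE] := pdp.
pose N := `|M| + 1; have N0 : 0 < N by rewrite ltr_wpDl.
have MN : M < N by rewrite (le_lt_trans (ler_norm _))// ltrDl.
pose I := `[- N, N]%classic : set R.
have outI t : ~ I t -> M < `|t|.
  move=> nI; apply: (lt_trans MN); rewrite ltNge ler_norml; apply/negP => H.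
  by apply: nI; rewrite /I/= in_itv.
rewrite (@Rintegral_support _ I); last by move=> t /outI /dpsi0 ->; rewrite mulr0.
rewrite (@Rintegral_support _ I); last by move=> t /outI /psi0 ->; rewrite mulr0.
have psiN : psi N = 0 by apply: psi0; rewrite ger0_norm// ltW.
have psiNN : psi (- N) = 0 by apply: psi0; rewrite normrN ger0_norm// ltW.
have mI : measurable (I : set mR) by exact: measurable_itv.
have mdp := primitive_measurable pdp.
have iA : leb.-integrable setT (EFin \o (dp \_ I)).
  by rewrite -restrict_EFin; apply/integrable_restrict => //; rewrite setTI; exact: idp.
have ih : leb.-integrable setT (EFin \o (dpsi \_ I)).
  rewrite -restrict_EFin; apply/integrable_restrict => //; rewrite setTI.
  exact: integrable_continuous_cc.
pose F (z : mR * mR) : \bar R :=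
  ((dp \_ I) z.1 * (dpsi \_ I) z.2 * (if z.1 <= z.2 then 1 else 0))%:E.
have iF : (leb \x leb)%E.-integrable setT F.
  apply: le_integrable (integrable_tensor iA ih) => //.
    apply/measurable_EFinP; apply: measurable_funM.
      by apply/measurable_EFinP; exact: measurable_int (integrable_tensor iA ih).
    apply: measurable_fun_ifT => //.
    exact: (measurable_fun_ler measurable_fst measurable_snd).
  move=> z _; rewrite lee_fin normrM ler_piMr//.
  by case: ifP; rewrite ?normr1 ?normr0.
have fub := Fubini iF.
have E1 : (\int[leb]_y \int[leb]_x F (x, y) =
    \int[leb]_(t in I) (dpsi t * (p t - p (- N)))%:E)%E.
  clear fub iF ih iA cp cpsi cd dpsiP psi0 dpsi0 outI psiN psiNN MN N0 mdp.
  rewrite [RHS]integral_mkcond; apply: eq_integral => t _ /=; rewrite [RHS]patchE.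
  case: ifPn => [|tI]; last first.
    rewrite (eq_integral (cst 0%E)) ?integral0// => r _.
    by rewrite /F/= [X in _ * X * _]patchE (negbTE tI) mulr0 mul0r.
  rewrite inE => tI; move: (tI); rewrite /I/= in_itv/= => /andP[Nt tN].
  rewrite (pdp.2 _ _ Nt) EFinM /Rintegral fineK; last first.
    by apply: integrable_fin_num => //; exact: idp.
  rewrite -integralZl//=.
  rewrite [RHS]integral_mkcond; apply: eq_integral => r _; rewrite /F/=.
  rewrite !patchE (mem_set tI) /=.
  have -> : (r \in `[(- N), t]%classic) = (r \in I) && (r <= t).
    rewrite /I !mem_setE !in_itv/=; have [rt|] := leP r t; rewrite ?andbF//.
    by rewrite (le_trans rt tN) !andbT.
  by case: (r \in I) => /=; case: (r <= t) => /=; rewrite ?mulr1 ?mulr0 ?mul0r// mulrC.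
have G r : (\int[leb]_x F (r, x) =
    ((fun r => (- 1 * (dp r * psi r))%:E) \_ I) r)%E.
  clear E1 fub iF ih iA cp cpsi psi0 dpsi0 outI psiNN MN N0 mdp idp pE pdp.
  rewrite [RHS]patchE.
  case: ifPn => [|rI]; last first.
    rewrite (eq_integral (cst 0%E)) ?integral0// => t _.
    by rewrite /F/= [X in X * _ * _]patchE (negbTE rI) !mul0r.
  rewrite inE => rI; move: (rI); rewrite /I/= in_itv/= => /andP[Nr rN].
  transitivity ((dp r)%:E * (psi N - psi r)%:E)%E; last first.
    by rewrite psiN sub0r -EFinM mulrN mulN1r.
  rewrite -(FTC_cc rN dpsiP cd) -integralZl//=; last exact: integrable_continuous_cc.
  rewrite [RHS]integral_mkcond; apply: eq_integral => t _; rewrite /F/=.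
  rewrite !patchE (mem_set rI) /=.
  have -> : (t \in `[r, N]%classic) = (t \in I) && (r <= t).
    rewrite /I !mem_setE !in_itv/=; have [rt|] := leP r t; rewrite ?andbF//.
    by rewrite (le_trans Nr rt) andbT.
  by case: (t \in I) => /=; case: (r <= t) => /=; rewrite ?mulr1 ?mulr0 ?mul0r.
have E2 : (\int[leb]_x \int[leb]_y F (x, y) =
    \int[leb]_(r in I) (- 1 * (dp r * psi r))%:E)%E.
  by rewrite [RHS]integral_mkcond; apply: eq_integral => r _; exact: G.
have idppsi : leb.-integrable I (fun r => (dp r * psi r)%:E).
  have : leb.-integrable I (fun r => (- 1 * (dp r * psi r))%:E).
    have := integrable_fubini_F iF; rewrite /fubini_F (funext G).
    by move/(integrable_restrict _ mI measurableT _).2; rewrite setTI.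
  move=> /integrableN; apply: eq_integrable => // r _ /=.
  by rewrite mulN1r opprK.
have ip : leb.-integrable I (EFin \o (fun t => p t * dpsi t)).
  by apply: integrable_continuous_cc => t; apply: cvgM; [exact: cp|exact: cd].
have id0 : leb.-integrable I (EFin \o (fun t => p (- N) * dpsi t)).
  by apply: integrable_continuous_cc => t; apply: cvgM; [exact: cvg_cst|exact: cd].
have idpsi : leb.-integrable I (EFin \o dpsi) by exact: integrable_continuous_cc.
have c0 : \int[leb]_(t in I) (p (- N) * dpsi t) = 0.
  clear E1 E2 fub G iF iA ih pdp pE idp outI dpsi0 psi0 mdp idppsi ip MN.
  rewrite RintegralZl// [X in _ * X](_ : _ = 0) ?mulr0//.
  rewrite /Rintegral FTC_cc ?psiN ?psiNN ?subrr//.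
  by rewrite ge0_cp// ltW.
transitivity (\int[leb]_(t in I) (dpsi t * (p t - p (- N)))).
  rewrite -[LHS]subr0 -[X in _ - X]c0 -RintegralB//.
  by apply: eq_Rintegral => t _; ring.
transitivity (\int[leb]_(r in I) (- 1 * (dp r * psi r))).
  by rewrite /Rintegral -E1 -fub E2.
by rewrite RintegralZl// mulN1r.
Qed.

End absolutely_continuous.

Section primitives.
Context {R : realType}.
Local Notation leb := (@lebesgue_measure R).
Implicit Types (p dp : R -> R).

Lemma Rintegral_chasles dp a b c : a <= b -> b <= c ->
  leb.-integrable `[a, c]%classic (EFin \o dp) ->
  \int[leb]_(r in `[a, c]) dp r =
  \int[leb]_(r in `[a, b]) dp r + \int[leb]_(r in `[b, c]) dp r.
Proof.
move=> ab bc idp.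
have ibc : leb.-integrable `]b, c]%classic (EFin \o dp).
  apply: integrableS idp => //= r /=; rewrite !in_itv/= => /andP[br ->].
  by rewrite (le_trans ab (ltW br)).
rewrite -[in X in _ = _ + X]Rintegral_itv_obnd_cbnd//.
rewrite -(@Rintegral_itvB _ _ (BLeft a) (BRight c) b)//.
by rewrite addrC subrK.
Qed.

Lemma primitive_exists dp :
  (forall a b, leb.-integrable `[a, b]%classic (EFin \o dp)) ->
  exists p, primitive p dp.
Proof.
move=> idp; pose I (a b : R) := \int[leb]_(r in `[a, b]) dp r.
have I0 a b : b <= a -> I a b = 0.
  rewrite le_eqVlt => /predU1P[->|ba]; rewrite /I.
    by rewrite set_itv1 Rintegral_set1.
  by rewrite set_itv_ge ?Rintegral_set0// bnd_simp -ltNge.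
(* one of the two integrals is over an empty or trivial interval *)
exists (fun s => I 0 s - I s 0); split=> // s t st.
rewrite -[RHS]/(I s t).
have ch a b c : a <= b -> b <= c -> I a c = I a b + I b c.
  by move=> ab bc; exact: Rintegral_chasles.
have [s0|s0] := leP 0 s; have [t0|t0] := leP 0 t.
- by rewrite (ch 0 s t)// (I0 t 0)// (I0 s 0)//; ring.
- by have := le_lt_trans (le_trans s0 st) t0; rewrite ltxx.
- by rewrite (ch s 0 t) ?(ltW s0)// (I0 t 0)// (I0 0 s) ?(ltW s0)//; ring.
- by rewrite (ch s t 0) ?(ltW t0)// (I0 0 t) ?(ltW t0)// (I0 0 s) ?(ltW s0)//; ring.
Qed.

Lemma primitive_continuous p dp : primitive p dp -> continuous p.
Proof.
move=> [idp pE] t.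
have tt : t - 1 <= t + 1 by lra.
have tin : t \in `](t - 1), (t + 1)[ by rewrite in_itv/=; lra.
have := parameterized_integral_continuous tt (idp _ _).
move=> /continuous_within_itvP -/(_ ltac:(lra)) [+ _ _] => /(_ t tin) ct.
have E s : t - 1 <= s ->
    p (t - 1) + parameterized_integral leb (t - 1) s dp = p s.
  by move=> ts; rewrite /parameterized_integral -pE// addrC subrK.
have ct' : p (t - 1) + parameterized_integral leb (t - 1) s dp @[s --> t]
    --> p (t - 1) + parameterized_integral leb (t - 1) t dp.
  by apply: cvgD; [exact: cvg_cst|exact: ct].
rewrite E in ct'; last by lra.
apply: cvg_trans ct'; apply: near_eq_cvg; near=> s; rewrite E//.
by apply: ltW; near: s; apply: lt_nbhsr; lra.
Unshelve. all: by end_near. Qed.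

End primitives.

Section narrow_bumps.
Context {R : realType}.
Local Notation leb := (@lebesgue_measure R).

Definition derivative_seq (f : R -> R) (k : nat) : R -> R :=
  iter k (fun g : R -> R => 'D_1 g) f.

Lemma derivative_seqP (f : R -> R) : elementary f ->
  derivative_tower (derivative_seq f).
Proof.
move=> ef k x; have ek : elementary (derivative_seq f k).
  by elim: k => //= k; exact: elementary_derive.
apply: DeriveDef => //.
exact/diff_derivable/elementary_differentiable.
Qed.

Definition chi (k : nat) : R -> R := itv_bump (- k.+1%:R^-1) k.+1%:R^-1 1.

Let kN (k : nat) : - k.+1%:R^-1 < k.+1%:R^-1 :> R.
Proof. by rewrite gtrN. Qed.

Let k1 (k : nat) : k.+1%:R^-1 <= 1 :> R.
Proof. by rewrite invf_le1// ler1n. Qed.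

Lemma elementary_chi k : elementary (chi k).
Proof.
by apply: (@elementary_itv_bump _ _ _ _ _ id); apply: elementary_linear => // z.
Qed.

Lemma continuous_chi k : continuous (chi k).
Proof. exact: (elementary_smooth (elementary_chi k) 0%N). Qed.

Lemma chi_ge0 k s : 0 <= chi k s. Proof. exact: itv_bump_ge0. Qed.

Lemma chi_gt0 k s : (0 < chi k s) = (`|s| < k.+1%:R^-1).
Proof.
by rewrite /chi /itv_bump bump_gt0 mul1r itv_prod_gt0// ltr_norml.
Qed.

Lemma chi_out k s : k.+1%:R^-1 <= `|s| -> chi k s = 0.
Proof. by move=> h; rewrite /chi itv_bump_out// -ltr_norml -leNgt. Qed.

(** The lower end [- 2] lies to the left of the supports of all the [chi k]. *)
Definition step (k : nat) (s : R) : R := \int[leb]_(r in `[- 2, s]) chi k r.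

Lemma step_left k s : s <= - 1 -> step k s = 0.
Proof.
move=> s1; rewrite /step (@eq_Rintegral _ _ _ leb _ (fun=> 0)).
  rewrite /Rintegral integral0_eq//.
move=> r; rewrite inE/= in_itv/= => /andP[_ rs]; rewrite chi_out//.
rewrite (le_trans (k1 k))// ler0_norm; lra.
Qed.

Lemma step_right k s : 1 <= s -> step k s = step k 1.
Proof.
move=> s1; have h : - 2 <= 1 :> R by lra.
rewrite /step (Rintegral_chasles h s1); last first.
  exact/integrable_continuous_cc/continuous_chi.
rewrite [X in _ + X](_ : _ = 0) ?addr0// (@eq_Rintegral _ _ _ leb _ (fun=> 0)).
  by rewrite /Rintegral integral0_eq.
move=> r; rewrite inE/= in_itv/= => /andP[rs _]; rewrite chi_out//.
rewrite (le_trans (k1 k))// ger0_norm; lra.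
Qed.

Lemma is_derive_step k (s : R) : is_derive s (1 : R) (step k) (chi k s).
Proof.
have [s1|s1] := ltP s (- 1).
  rewrite chi_out; last by rewrite (le_trans (k1 k))// ler0_norm; lra.
  apply: (@near_eq_is_derive _ _ _ (cst 0)).
  near=> r; rewrite step_left//; apply: ltW.
  by near: r; exact: lt_nbhsl.
have ss : s < s + 1 by lra.
have [|d1 d2] := @continuous_FTC1 R (chi k) (BLeft (- 2)) s (s + 1) ss
  (integrable_continuous_cc _ _ (@continuous_chi k)) _ (@continuous_chi k s).
  by rewrite lte_fin; lra.
by apply: DeriveDef; [exact: d1|rewrite -derive1E].
Unshelve. all: by end_near. Qed.

Definition step_tower k (j : nat) : R -> R :=
  if j is j'.+1 then derivative_seq (chi k) j' else step k.

Lemma step_towerP k : derivative_tower (step_tower k).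
Proof.
case=> [|j] x; first exact: is_derive_step.
exact: derivative_seqP (elementary_chi k) j x.
Qed.

(** Test functions whose derivative, for large [k], compares the values taken at [q1] and at [q2]. *)
Definition plateau (q1 q2 : R) k (s : R) : R := step k (s - q1) - step k (s - q2).

Definition dplateau (q1 q2 : R) k (s : R) : R := chi k (s - q1) - chi k (s - q2).

Lemma plateau_out q1 q2 k s : `|q1| + `|q2| + 1 < `|s| -> plateau q1 q2 k s = 0.
Proof.
have := ler_norm q1; have := ler_norm (- q1); have := ler_norm q2.
have := ler_norm (- q2); rewrite !normrN => a1 a2 a3 a4 H; move: H.
have n1 := normr_ge0 q1; have n2 := normr_ge0 q2; rewrite /plateau.
have [s0|s0] := leP 0 s.
  rewrite (ger0_norm s0) => H.
  by rewrite (@step_right _ (s - q1)) ?(@step_right _ (s - q2)) ?subrr//; lra.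
rewrite (ltr0_norm s0) => H.
by rewrite !step_left ?subrr//; lra.
Qed.

Lemma elementary_plateau (V : normedModType R) q1 q2 k (f : V -> R) :
  elementary f -> elementary (fun z => plateau q1 q2 k (f z)).
Proof.
move=> ef; have es q : elementary (fun z => step k (f z - q)).
  apply: (@elementary_comp _ _ (step_tower k) 0 (f \+ cst (- q))).
    exact: step_towerP.
  by apply: elementaryD => //; exact: elementary_cst.
have -> : (fun z => plateau q1 q2 k (f z)) =
    (fun z => step k (f z - q1)) \+ (cst (- 1) \* (fun z => step k (f z - q2))).
  by apply/funext => z /=; rewrite mulN1r.
by apply: elementaryD => //; apply: elementaryM => //; exact: elementary_cst.
Qed.

Lemma is_derive_plateau q1 q2 k (s : R) :
  is_derive s (1 : R) (plateau q1 q2 k) (dplateau q1 q2 k s).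
Proof.
have ds q : is_derive s (1 : R) (fun s => step k (s - q)) (chi k (s - q)).
  have dl : is_derive s (1 : R) (fun x : R => x - q) (1 - 0) by exact: is_deriveB.
  have := @is_derive1_comp _ (step k) (fun x : R => x - q) s _ _
    (is_derive_step k (s - q)) dl.
  by rewrite subr0 mulr1.
exact: is_deriveB.
Qed.

Lemma continuous_dplateau q1 q2 k : continuous (dplateau q1 q2 k).
Proof.
have cs q : continuous (fun s => chi k (s - q)).
  move=> s; apply: (@continuous_comp _ _ _ (fun s => s - q) (chi k)).
    by apply: cvgB; [exact: cvg_id|exact: cvg_cst].
  exact: continuous_chi.
by move=> s; apply: cvgB; exact: cs.
Qed.

End narrow_bumps.

(** * The lemma of du Bois-Reymond *)

Section du_bois_reymond.
Context {R : realType}.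
Local Notation mR := (measurableTypeR R).
Local Notation leb := (@lebesgue_measure R).
Implicit Types (w f : R -> R).

Lemma integrable_compact_support f M : continuous f ->
  (forall t, M < `|t| -> f t = 0) -> leb.-integrable setT (EFin \o f).
Proof.
move=> cf f0; have mI := measurable_itv `[- M, M].
have : leb.-integrable setT ((EFin \o f) \_ `[- M, M]%classic).
  apply/integrable_restrict => //; rewrite setTI.
  exact: integrable_continuous_cc.
apply: eq_integrable => // t _; rewrite patchE; case: ifPn => //=.
rewrite notin_setE/= in_itv/= -ler_norml => /negP; rewrite -ltNge => Mt.
by rewrite f0.
Qed.

Lemma chi_integral_gt0 k : (0 < \int[leb]_s (@chi R k s)%:E)%E.
Proof.
have c0 : 0 < @chi R k 0 by rewrite chi_gt0 normr0 invr_gt0.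
have c02 : @chi R k 0 / 2 < @chi R k 0 by lra.
have [d /= d0 dchi] : exists2 d, 0 < d & forall s, `|s| < d -> @chi R k 0 / 2 < chi k s.
  have := @continuous_chi R k 0 _ (lt_nbhsr c02) => /nbhs_ballP[d d0 H].
  by exists d => // s sd; apply: H; rewrite -ball_normE/= sub0r normrN.
pose I : set R := `](- d), d[%classic.
have mI : measurable (I : set mR) by exact: measurable_itv.
have mchi : measurable_fun setT (fun s => (@chi R k s)%:E).
  apply/measurable_EFinP; apply: continuous_measurable_fun; exact: continuous_chi.
have H1 : (0 < \int[leb]_(s in I) (@chi R k 0 / 2)%:E)%E.
  rewrite integral_cst//= /I lebesgue_measure_itv/= lte_fin.
  rewrite ifT; last by lra.
  by rewrite -EFinD -EFinM lte_fin mulr_gt0 ?divr_gt0//; lra.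
have H2 : (\int[leb]_(s in I) (@chi R k 0 / 2)%:E <=
           \int[leb]_(s in I) (@chi R k s)%:E)%E.
  apply: ge0_le_integral => //.
  - by move=> s _; rewrite lee_fin ltW// divr_gt0.
  - exact: measurable_funTS.
  - move=> s; rewrite /I/= in_itv/= -ltr_norml => sd.
    by rewrite lee_fin ltW// dchi.
have H3 : (\int[leb]_(s in I) (@chi R k s)%:E <= \int[leb]_s (@chi R k s)%:E)%E.
  by apply: ge0_subset_integral => // s _; rewrite lee_fin chi_ge0.
exact: (lt_le_trans H1 (le_trans H2 H3)).
Qed.

Lemma continuous_chi_shift k q : continuous (fun s : R => chi k (s - q)).
Proof.
move=> s; apply: (@continuous_comp _ _ _ (fun s => s - q) (chi k)).
  by apply: cvgB; [exact: cvg_id|exact: cvg_cst].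
exact: continuous_chi.
Qed.

Lemma chi_shift_out k (q : R) t : `|q| + 1 < `|t| -> chi k (t - q) = 0.
Proof.
move=> qt; rewrite chi_out//.
have k1 : k.+1%:R^-1 <= 1 :> R by rewrite invf_le1// ler1n.
apply: le_trans k1 (le_trans _ (lerB_dist _ _)).
by rewrite lerBrDl ltW.
Qed.

(** If the two values differed, averages of [w] against narrow bumps at [q1] and [q2] would differ as well. *)
Lemma du_bois_reymond w q1 q2 : continuous w ->
  (forall k, \int[leb]_s (w s * dplateau q1 q2 k s) = 0) -> w q1 = w q2.
Proof.
have half w' : continuous w' ->
    (forall k, \int[leb]_s (w' s * dplateau q1 q2 k s) = 0) -> w' q2 <= w' q1.
  move=> cw w0; rewrite leNgt; apply/negP => w12.
  (* a quarter of the gap leaves room between the two averages *)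
  pose D := (w' q2 - w' q1) / 4; have D0 : 0 < D by rewrite /D; lra.
  have DD : w' q1 + D < w' q2 - D by rewrite /D; lra.
  have near q : exists2 d, 0 < d & forall s, `|s - q| < d -> `|w' s - w' q| < D.
    have /cvgrPdist_lt /(_ _ D0) /nbhs_ballP[d d0 H] := cw q.
    exists d => // s sd; rewrite distrC; apply: H.
    by rewrite -ball_normE/= distrC.
  have [d1 d10 h1] := near q1; have [d2 d20 h2] := near q2.
  pose k := Num.truncn (Num.min d1 d2)^-1.
  have kd : k.+1%:R^-1 < Num.min d1 d2.
    by rewrite invf_plt ?posrE ?lt_min ?d10// truncnS_gt.
  move: kd; rewrite lt_min => /andP[kd1 kd2].
  have cwc q : continuous (fun s => w' s * chi k (s - q)).
    by move=> s; apply: cvgM; [exact: cw|exact: continuous_chi_shift].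
  have iwc q : leb.-integrable setT (EFin \o (fun s => w' s * chi k (s - q))).
    apply: (@integrable_compact_support _ (`|q| + 1)) => // t qt.
    by rewrite chi_shift_out ?mulr0.
  have ic q : leb.-integrable setT (EFin \o (fun s => chi k (s - q))).
    apply: (@integrable_compact_support _ (`|q| + 1)) => [|t qt].
      exact: continuous_chi_shift.
    by rewrite chi_shift_out.
  have icZ q r : leb.-integrable setT (EFin \o (fun s => r * chi k (s - q))).
    exact: (integrableZl _ r (ic q)).
  pose c := \int[leb]_s (@chi R k s).
  have cE q : \int[leb]_s (chi k (s - q)) = c.
    rewrite /c /Rintegral (ge0_integral_translate (- q) (f := fun s => (chi k s)%:E))//.
      by apply/measurable_EFinP; apply: continuous_measurable_fun; exact: continuous_chi.
    by move=> t; rewrite lee_fin chi_ge0.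
  have c0 : 0 < c.
    rewrite -lte_fin /c /Rintegral fineK ?chi_integral_gt0//.
    by apply: integrable_fin_num => //; have := ic 0; apply: eq_integrable => // s _ /=; rewrite subr0.
  have up : \int[leb]_s (w' s * chi k (s - q1)) <= (w' q1 + D) * c.
    rewrite -(cE q1) -RintegralZl//; apply: le_Rintegral => // s _.
    have [|sq] := ltP `|s - q1| k.+1%:R^-1; last by rewrite chi_out ?mulr0.
    move=> sq; rewrite ler_wpM2r ?chi_ge0//.
    have := h1 s (lt_trans sq kd1); rewrite ltr_distl => /andP[_ ?]; exact: ltW.
  have down : (w' q2 - D) * c <= \int[leb]_s (w' s * chi k (s - q2)).
    rewrite -(cE q2) -RintegralZl//; apply: le_Rintegral => // s _.
    have [|sq] := ltP `|s - q2| k.+1%:R^-1; last by rewrite chi_out ?mulr0.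
    move=> sq; rewrite ler_wpM2r ?chi_ge0//.
    have := h2 s (lt_trans sq kd2); rewrite ltr_distl => /andP[? _]; exact: ltW.
  have := w0 k; under eq_Rintegral do rewrite /dplateau mulrBr.
  rewrite RintegralB// => /eqP; rewrite subr_eq0 => /eqP E.
  have := le_trans down (le_trans _ up).
  rewrite E lexx => /(_ isT).
  by rewrite ler_pM2r// leNgt DD.
move=> cw w0; apply/le_anti/andP; split; last exact: half.
rewrite -lerN2; apply: (half (fun s => - w s)).
  by move=> s; apply: cvgN; exact: cw.
move=> k; have := w0 k => E.
have cwd : continuous (fun s => w s * dplateau q1 q2 k s).
  by move=> s; apply: cvgM; [exact: cw|exact: continuous_dplateau].
under eq_Rintegral do rewrite mulNr -mulN1r.
rewrite RintegralZl//; first by rewrite E mulr0.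
apply: (@integrable_compact_support _ (`|q1| + `|q2| + 1)) => // t qt.
have n1 := normr_ge0 q1; have n2 := normr_ge0 q2.
by rewrite /dplateau !chi_shift_out ?subrr ?mulr0//; lra.
Qed.

Lemma continuous_eq_rat f (g : R -> R) : continuous f -> continuous g ->
  (forall q : rat, f (ratr q) = g (ratr q)) -> forall t, f t = g t.
Proof.
move=> cf cg fg t; apply/eqP; rewrite -subr_eq0; apply/eqP.
apply: contrapT => /eqP h0.
have ch : {for t, continuous (fun s => f s - g s)}.
  by apply: cvgB; [exact: cf|exact: cg].
have h1 : 0 < `|f t - g t| by rewrite normr_gt0.
have /cvgrPdist_lt /(_ _ h1) /nbhs_ballP[d d0 H] := ch.
have [|q] := @rat_in_itvoo R (t - d) (t + d).
  by move: d0 => /= d0; lra.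
rewrite in_itv/= => /andP[q1 q2].
have /H/= : ball t d (ratr q) by rewrite -ball_normE/= ltr_distlC q1 q2.
by rewrite fg subrr subr0 ltxx.
Qed.

(** Integrating by parts, [u] minus a primitive of [v] is orthogonal to the derivatives of the plateaus, hence takes the same value at any two rationals. Only countably many tests are involved, so that on almost every line all of them can be used together. *)
Lemma primitive_of_plateaus (u v : R -> R) : continuous u ->
  (forall a b, leb.-integrable `[a, b]%classic (EFin \o v)) ->
  (forall (q1 q2 : rat) k, \int[leb]_s (u s * dplateau (ratr q1) (ratr q2) k s) =
     - \int[leb]_s (v s * plateau (ratr q1) (ratr q2) k s)) ->
  primitive u v.
Proof.
move=> cu iv uv; have [p pv] := primitive_exists iv.
have cp := primitive_continuous pv.
have E (q1 q2 : rat) : u (ratr q1) - p (ratr q1) = u (ratr q2) - p (ratr q2).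
  apply: (@du_bois_reymond (fun s => u s - p s)) => [s|k].
    by apply: cvgB; [exact: cu|exact: cp].
  have cd := @continuous_dplateau R (ratr q1) (ratr q2) k.
  have iw f : continuous f ->
      leb.-integrable setT (EFin \o (fun s => f s * dplateau (ratr q1) (ratr q2) k s)).
    move=> cf; apply: (@integrable_compact_support _ (`|ratr q1| + `|ratr q2| + 1)).
      by move=> s; apply: cvgM; [exact: cf|exact: cd].
    move=> t qt; have n1 := normr_ge0 (ratr q1 : R); have n2 := normr_ge0 (ratr q2 : R).
    by rewrite /dplateau !chi_shift_out ?subrr ?mulr0//; lra.
  under eq_Rintegral do rewrite mulrBl.
  rewrite RintegralB//; [|exact: iw|exact: iw].
  rewrite uv (primitive_by_parts (M := `|ratr q1| + `|ratr q2| + 1) pv cp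
    (@is_derive_plateau R (ratr q1) (ratr q2) k) cd) ?subrr//.
  exact: plateau_out.
split=> // s t st; rewrite -(proj2 pv _ _ st).
pose c := u (ratr 0) - p (ratr 0).
have uE r : u r = p r + c.
  apply: (continuous_eq_rat cu (g := fun r => p r + c)) => [x|q].
    by apply: cvgD; [exact: cp|exact: cvg_cst].
  by rewrite /c -(E q 0) addrC subrK.
by rewrite !uE; ring.
Qed.

End du_bois_reymond.

(** * The one-dimensional energy *)

Section one_dimensional_energy.
Context {R : realType}.
Local Notation leb := (@lebesgue_measure R).
Implicit Types (a p dp : R -> R).

Definition density a p dp (t : R) : R :=
  2^-1 * (a t * dp t ^+ 2) + double_well (p t).

Lemma double_well_ge0 (u : R) : 0 <= double_well u.
Proof. by rewrite /double_well mulr_ge0// sqr_ge0. Qed.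

Lemma double_well_le (u q : R) : `|u| <= q -> q <= 1 -> double_well q <= double_well u.
Proof.
move=> uq q1; have q0 : 0 <= q by exact: le_trans uq.
have u2 : u ^+ 2 <= q ^+ 2 by rewrite -real_normK ?num_real// lerXn2r ?nnegrE.
have q21 : q ^+ 2 <= 1 by rewrite expr_le1.
rewrite /double_well ler_pM2l// lerXn2r ?nnegrE ?subr_ge0 ?(le_trans u2)//.
by rewrite lerB.
Qed.

Lemma double_well_gt0 (q : R) : 0 <= q < 1 -> 0 < double_well q.
Proof.
move=> /andP[q0 q1]; rewrite /double_well mulr_gt0// exprn_gt0// subr_gt0.
by rewrite exprn_ilt1.
Qed.

Lemma density_ge0 a p dp t : 0 <= a t -> 0 <= density a p dp t.
Proof.
move=> a0; apply: addr_ge0; last exact: double_well_ge0.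
by apply: mulr_ge0 => //; apply: mulr_ge0 => //; exact: sqr_ge0.
Qed.

Lemma measurable_double_well : measurable_fun setT (@double_well R).
Proof.
apply: measurable_funM; first exact: measurable_cst.
apply: measurable_funX; apply: measurable_funB; first exact: measurable_cst.
by apply: measurable_funX.
Qed.

Lemma measurable_density d (T : measurableType d) (al u v : T -> R) :
  measurable_fun setT al -> measurable_fun setT u -> measurable_fun setT v ->
  measurable_fun setT (fun t => 2^-1 * (al t * v t ^+ 2) + double_well (u t)).
Proof.
move=> mal mu mv; apply: measurable_funD.
  apply: measurable_funM; first exact: measurable_cst.
  by apply: measurable_funM => //; exact: measurable_funX.
exact: (measurableT_comp measurable_double_well).
Qed.

(** The inequality of Modica and Mortola: the quadratic part and the potential bound the product [c * `|dp t|] as long as [p] stays away from the wells. *)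
Lemma density_ge a p dp t (A q c : R) : 0 < A -> A <= a t -> `|p t| <= q -> q <= 1 ->
  c ^+ 2 <= 2 * A * double_well q -> c * `|dp t| <= density a p dp t.
Proof.
move=> A0 Aa pq q1 cA; rewrite /density.
have w := double_well_le pq q1.
have h : A * `|dp t| ^+ 2 <= a t * dp t ^+ 2.
  by rewrite real_normK ?num_real// ler_wpM2r ?sqr_ge0.
set x := `|dp t| in h *; set W := double_well q in cA w.
suff : c * x <= 2^-1 * (A * x ^+ 2) + W by lra.
have A2 : 0 < 2 * A by rewrite mulr_gt0.
rewrite -(ler_pM2l A2) -subr_ge0.
have -> : 2 * A * (2^-1 * (A * x ^+ 2) + W) - 2 * A * (c * x) =
  (A * x - c) ^+ 2 + (2 * A * W - c ^+ 2) by field.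
by rewrite addr_ge0 ?sqr_ge0// subr_ge0.
Qed.

(** The infimum of the times at which [f] has reached [q]. *)
Lemma first_exit (f : R -> R) (t0 t1 q : R) : continuous f -> t0 <= t1 -> q < f t1 ->
  exists2 s, t0 <= s <= t1 & q <= f s /\ forall t, t0 <= t < s -> f t < q.
Proof.
move=> cf t01 qt1; pose S := [set t | t0 <= t <= t1 /\ q <= f t].
have S1 : S t1 by split; rewrite ?lexx ?t01// ltW.
have Slb : lbound S t0 by move=> t [/andP[]].
have hS : has_inf S by split; [exists t1|exists t0].
have i0 : t0 <= inf S by apply: lb_le_inf => //; exists t1.
have i1 : inf S <= t1 by apply: ge_inf => //; exists t0.
exists (inf S); first by rewrite i0.
split; last first.
  move=> t /andP[t0t ti]; rewrite ltNge; apply/negP => qt.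
  suff it : inf S <= t by have := le_lt_trans it ti; rewrite ltxx.
  apply: ge_inf; first by exists t0.
  by split=> //; rewrite t0t (le_trans (ltW ti)).
rewrite leNgt; apply/negP => iq.
have /nbhs_ballP[d /= d0 H] := cf (inf S) _ (lt_nbhsl iq).
have [s Ss sd] := inf_adherent d0 hS.
have is_ : inf S <= s by apply: ge_inf => //; exists t0.
have /H /= : ball (inf S) d s.
  by rewrite -ball_normE/= distrC ger0_norm ?subr_ge0// ltrBlDl.
by rewrite ltNge; case: Ss => _ ->.
Qed.

(** Either [`|p|] stays below [q] during a time [r], and the potential alone costs [r * double_well q]; or it rises from [p0] to [q], and the inequality of Modica and Mortola charges the distance. *)
Lemma exit_energy a p dp (t0 r A p0 q c : R) :
    primitive p dp -> measurable_fun setT a -> (forall t, 0 <= a t) ->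
    0 < r -> 0 < A -> (forall t, t0 <= t <= t0 + r -> A <= a t) ->
    `|p t0| <= p0 -> q <= 1 -> 0 <= c -> c ^+ 2 <= 2 * A * double_well q ->
  ((Num.min (r * double_well q) (c * (q - p0)))%:E <=
   \int[leb]_(t in `[t0, (t0 + r)%R]) (density a p dp t)%:E)%E.
Proof.
move=> pdp ma a0 r0 A0 Aa pt0 q1 c0 cA.
have cp := primitive_continuous pdp; have mdp := primitive_measurable pdp.
have mp : measurable_fun setT p by exact: continuous_measurable_fun.
have mD : measurable_fun setT (fun t => (density a p dp t)%:E).
  by apply/measurable_EFinP; exact: measurable_density.
have mDS (I : set R) : measurable_fun I (fun t => (density a p dp t)%:E).
  exact: measurable_funTS.
have D0 t : (0 <= (density a p dp t)%:E)%E by rewrite lee_fin density_ge0.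
have [all|/existsNP[t1 /not_implyP[t1I /negP]]] :=
    pselect (forall t, t0 <= t <= t0 + r -> `|p t| <= q).
  apply: (@le_trans _ _ (r * double_well q)%:E); first by rewrite lee_fin ge_min lexx.
  have <- : (\int[leb]_(t in `[t0, (t0 + r)%R]) (double_well q)%:E = (r * double_well q)%:E)%E.
    rewrite integral_cst//= lebesgue_measure_itv/= lte_fin ltrDl r0.
    by rewrite -EFinD -EFinM addrAC subrr add0r mulrC.
  apply: ge0_le_integral => //.
  - by move=> t _; rewrite lee_fin double_well_ge0.
  - exact: mDS.
  - move=> t; rewrite /= ?in_itv/= => /all pq; rewrite lee_fin /density.
    rewrite (le_trans (double_well_le pq q1))// lerDr.
    by apply: mulr_ge0 => //; apply: mulr_ge0 => //; exact: sqr_ge0.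
rewrite -ltNge => qt1; have /andP[t01 t1r] := t1I.
have cn : continuous (fun t => `|p t|).
  by move=> t; apply: (@continuous_comp _ _ _ p (fun x => `|x|)); [exact: cp|exact: norm_continuous].
have [s /andP[t0s st1] [qs Hs]] := first_exit cn t01 qt1.
apply: (@le_trans _ _ (c * (q - p0))%:E); first by rewrite lee_fin ge_min lexx orbT.
have idp : leb.-integrable `[t0, s]%classic (EFin \o dp) by exact: (proj1 pdp).
have indp : leb.-integrable `[t0, s]%classic (EFin \o (fun t => `|dp t|)).
  exact: integrable_norm.
have H1 : ((c * (q - p0))%:E <= \int[leb]_(t in `[t0, s]) (c * `|dp t|)%:E)%E.
  under eq_integral do rewrite EFinM.
  rewrite integralZl// -[X in (_ <= _ * X)%E]fineK; last exact: integrable_fin_num.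
  rewrite lee_fin ler_wpM2l//.
  have := @le_normr_Rintegral _ _ _ leb `[t0, s]%classic dp (measurable_itv _) idp.
  rewrite -(proj2 pdp _ _ t0s); apply: le_trans.
  by apply: le_trans (lerB_dist _ _); rewrite lerB.
have H2 : (\int[leb]_(t in `[t0, s]) (c * `|dp t|)%:E <=
           \int[leb]_(t in `[t0, s[) (density a p dp t)%:E)%E.
  have mc : measurable_fun setT (fun t => (c * `|dp t|)%:E).
    apply/measurable_EFinP; apply: measurable_funM; first exact: measurable_cst.
    exact: measurableT_comp.
  rewrite -integral_itv_bndo_bndc; last exact: measurable_funTS.
  apply: ge0_le_integral => //.
  - by move=> t _; rewrite lee_fin mulr_ge0.
  - exact: measurable_funTS.
  - exact: mDS.
  - move=> t; rewrite /= ?in_itv/= => ts; rewrite lee_fin.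
    apply: density_ge A0 _ (ltW (Hs _ ts)) q1 cA; apply: Aa.
    move: ts => /andP[-> ts]; rewrite /= (le_trans (ltW ts))//.
    exact: le_trans st1 t1r.
apply: (le_trans H1 (le_trans H2 _)).
apply: ge0_subset_integral => //.
- exact: mDS.
- by move=> t; rewrite /= ?in_itv/= => /andP[-> ts]; rewrite (le_trans (ltW ts))// (le_trans st1).
Qed.

End one_dimensional_energy.

(** * Heteroclinic profiles *)

Section profiles.
Context {R : realType}.
Local Notation mR := (measurableTypeR R).
Local Notation leb := (@lebesgue_measure R).
Implicit Types (a p dp : R -> R).

Lemma tail_small (f : R -> \bar R) (k : R) : measurable_fun setT f ->
  (forall t, (0 <= f t)%E) -> (\int[leb]_t f t < +oo)%E -> 0 < k ->
  exists N : nat, forall I : set R, measurable I ->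
    (forall t, I t -> N%:R < `|t|) -> (\int[leb]_(t in I) f t < k%:E)%E.
Proof.
move=> mf f0 foo k0.
pose F (i : nat) : set R := `[- i%:R, i%:R]%classic.
have mF i : measurable (F i : set mR) by exact: measurable_itv.
have ndF : nondecreasing_seq F.
  move=> i j ij; apply/subsetPset => t; rewrite /F/= !in_itv/= => /andP[t1 t2].
  have ijR : i%:R <= j%:R :> R by rewrite ler_nat.
  by rewrite (le_trans _ t1) ?lerN2// (le_trans t2).
have FT : \bigcup_i F i = setT.
  apply/seteqP; split => // t _; exists (Num.truncn `|t|).+1 => //.
  by rewrite /F/= in_itv/= -ler_norml ltW// truncnS_gt.
have cv := @ge0_nondecreasing_set_cvg_integral _ mR R F f leb ndF mF
  (fun i => measurable_funTS mf) (fun i x _ => f0 x).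
rewrite FT in cv.
have fin : (\int[leb]_t f t)%E \is a fin_num.
  by rewrite ge0_fin_numE// integral_ge0.
have [N HN] : exists N : nat, (\int[leb]_t f t - k%:E < \int[leb]_(t in F N) f t)%E.
  have lt1 : (\int[leb]_t f t - k%:E < \int[leb]_t f t)%E.
    by rewrite lteBlDr// lteDl// lte_fin.
  have [N _ HN] := cv _ (open_ereal_gt' lt1).
  by exists N; apply: HN => /=.
exists N => I mI IN.
have mCF := measurableC (mF N).
have sub : (\int[leb]_(t in I) f t <= \int[leb]_(t in ~` F N) f t)%E.
  apply: ge0_subset_integral => //; first exact: measurable_funTS.
  move=> t /IN Nt; rewrite /F/= in_itv/= -ler_norml => /negP.
  by rewrite leNgt Nt.
apply: (le_lt_trans sub).
have mfU : measurable_fun (F N `|` ~` F N) f by rewrite setUv.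
have dF : [disjoint F N & ~` F N] by rewrite disj_set2E setICr.
have split := integral_setU leb (mF N) mCF mfU dF.
rewrite setUv in split; rewrite split in HN fin.
move: HN fin; rewrite fin_numD => HN /andP[finF finC].
by move: HN; rewrite lteBlDr// lteD2lE.
Qed.

(** Otherwise, arbitrarily far away, [exit_energy] would find intervals of length 1 that carry a fixed amount of energy. *)
Lemma energy_limit a p dp A eta : primitive p dp -> measurable_fun setT a ->
    0 < A -> (forall t, A <= a t) -> (\int[leb]_t (density a p dp t)%:E < +oo)%E ->
    0 < eta < 1 ->
  exists N : R, forall t, N < `|t| -> 1 - eta < `|p t|.
Proof.
move=> pdp ma A0 Aa Eoo /andP[e0 e1].
have a0 t : 0 <= a t by rewrite (le_trans (ltW A0)).
have mp : measurable_fun setT p.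
  by apply: continuous_measurable_fun; exact: primitive_continuous pdp.
have mD : measurable_fun setT (fun t => (density a p dp t)%:E).
  by apply/measurable_EFinP; apply: measurable_density => //; exact: primitive_measurable pdp.
have D0 t : (0 <= (density a p dp t)%:E)%E by rewrite lee_fin density_ge0.
pose q := 1 - eta / 2; pose p0 := 1 - eta.
have q1 : q <= 1 by rewrite /q; lra.
have q01 : 0 <= q < 1 by rewrite /q; lra.
pose W := double_well q; have W0 : 0 < W by exact: double_well_gt0.
pose c := Num.sqrt (2 * A * W).
have AW : 0 < 2 * A * W by apply: mulr_gt0 => //; exact: mulr_gt0.
have c0 : 0 < c by rewrite sqrtr_gt0.
have cA : c ^+ 2 <= 2 * A * W by rewrite sqr_sqrtr// ltW.
(* the bound of exit_energy for intervals of length 1 *)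
pose k := Num.min (1 * W) (c * (q - p0)).
have k0 : 0 < k by rewrite lt_min mul1r W0 mulr_gt0// /q /p0; lra.
have [N HN] := tail_small mD D0 Eoo k0.
exists (N.+1%:R) => t Nt; rewrite ltNge; apply/negP => pt.
have := @exit_energy R a p dp t 1 A p0 q c pdp ma a0 ltr01 A0
  (fun t _ => Aa t) pt q1 (ltW c0) cA.
apply/negP; rewrite -ltNge; apply: HN; first exact: measurable_itv.
move=> s; rewrite /= in_itv/= => /andP[ts st].
have ts1 : `|t - s| <= 1 by rewrite ler_norml; lra.
have := ler_normD (t - s) s; rewrite subrK => tn.
move: Nt; rewrite -(@natr1 _ N) => Nt.
by have := lt_le_trans Nt (le_trans tn (lerD ts1 (lexx _))); rewrite addrC ltrD2l.
Qed.

(** Heteroclinic connections from [- 1] to [1]: the one-dimensional analogue of the admissible functions. *)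
Definition profile p dp : Prop :=
  [/\ primitive p dp, forall t, `|p t| <= 1,
      leb.-integrable setT (EFin \o (fun t => dp t ^+ 2)),
      forall eta, 0 < eta -> exists N, forall t, N < t -> `|p t - 1| <= eta &
      forall eta, 0 < eta -> exists N, forall t, t < - N -> `|p t + 1| <= eta].

(** Far away [`|p|] is close to 1, so [p] cannot change sign there, and a single value at each end decides which well is approached. *)
Lemma profile_intro a p dp A : primitive p dp -> measurable_fun setT a ->
    0 < A -> (forall t, A <= a t) -> (\int[leb]_t (density a p dp t)%:E < +oo)%E ->
    (forall t, `|p t| <= 1) ->
    (forall N, exists2 t, N < t & 0 < p t) ->
    (forall N, exists2 t, t < - N & p t < 0) ->
  profile p dp.
Proof.
move=> pdp ma A0 Aa Eoo p1 pos neg.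
have cp := primitive_continuous pdp.
have lim eta : 0 < eta -> exists N, forall t, N < `|t| -> 1 - eta < `|p t| /\ 0 < `|p t|.
  move=> e0; pose e := Num.min eta (1 / 2).
  have e01 : 0 < e < 1 by rewrite lt_min gt_min e0/=; lra.
  have [N HN] := energy_limit pdp ma A0 Aa Eoo e01.
  exists N => t /HN; have le1 : e <= eta by rewrite ge_min lexx.
  by have /andP[_ e1] := e01; lra.
split=> //.
- have a0 t : 0 <= a t by rewrite (le_trans (ltW A0)).
  have mp : measurable_fun setT p by exact: continuous_measurable_fun.
  have mdp := primitive_measurable pdp.
  have iD : leb.-integrable setT (fun t => (density a p dp t)%:E).
    apply/integrableP; split; first exact/measurable_EFinP/measurable_density.
    by under eq_integral do rewrite gee0_abs ?lee_fin ?density_ge0//.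
  apply: le_integrable (integrableZl _ (2 / A) iD) => //.
  + by apply/measurable_EFinP; apply: measurable_funX; exact: primitive_measurable pdp.
  + move=> t _ /=; rewrite lee_fin ger0_norm ?sqr_ge0// ger0_norm; last first.
      by rewrite mulr_ge0 ?density_ge0// divr_ge0// ltW.
    rewrite mulrAC ler_pdivlMr// /density.
    have h : dp t ^+ 2 * A <= a t * dp t ^+ 2 by rewrite mulrC ler_wpM2r ?sqr_ge0.
    by rewrite mulrDr mulrA mulfV// mul1r (le_trans h)// lerDl mulr_ge0 ?double_well_ge0.
- move=> eta e0; have [N HN] := lim _ e0; exists `|N| => t Nt.
  have t0 : 0 < t by exact: le_lt_trans Nt.
  have Nt' s : t <= s -> N < `|s|.
    by move=> ts; rewrite ger0_norm ?(le_trans (ltW t0))// (lt_le_trans _ ts)// (le_lt_trans (ler_norm _)).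
  have [Ht Ht0] := HN t (Nt' t (lexx _)).
  have pt0 : 0 < p t.
    rewrite ltNge; apply/negP => pt0; have [s ts ps] := pos t.
    have [r rI pr] : exists2 r, r \in `[t, s] & p r = 0.
      apply: IVT => //; first exact: ltW.
        exact: continuous_subspaceT.
      by rewrite ge_min le_max pt0 (ltW ps) orbT.
    move: rI; rewrite in_itv/= => /andP[tr _].
    by have [_] := HN r (Nt' r tr); rewrite pr normr0 ltxx.
  rewrite ger0_norm in Ht; last exact: ltW.
  have := p1 t; rewrite (ger0_norm (ltW pt0)) => pt1.
  by rewrite ler0_norm ?subr_le0//; lra.
- move=> eta e0; have [N HN] := lim _ e0; exists `|N| => t Nt.
  have t0 : t < 0 by rewrite (lt_le_trans Nt)// oppr_le0.
  have Nt' s : s <= t -> N < `|s|.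
    move=> st; rewrite ltr0_norm ?(le_lt_trans st)// ltrNr (le_lt_trans st)//.
    by rewrite (lt_le_trans Nt)// lerN2 ler_norm.
  have [Ht Ht0] := HN t (Nt' t (lexx _)).
  have pt0 : p t < 0.
    rewrite ltNge; apply/negP => pt0; have [s ts ps] := neg (- t).
    rewrite opprK in ts.
    have [r rI pr] : exists2 r, r \in `[s, t] & p r = 0.
      apply: IVT => //; first exact: ltW.
        exact: continuous_subspaceT.
      by rewrite ge_min le_max pt0 (ltW ps) orbT.
    move: rI; rewrite in_itv/= => /andP[_ tr].
    by have [_] := HN r (Nt' r tr); rewrite pr normr0 ltxx.
  rewrite (ltr0_norm pt0) in Ht.
  have := p1 t; rewrite (ltr0_norm pt0) => pt1.
  by rewrite ger0_norm; lra.
Qed.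

End profiles.

(** * Test functions and uniqueness of weak derivatives *)

Section test_functions.
Context {R : realType} {d : nat}.
Local Notation mR := (measurableTypeR R).
Local Notation RxT := (R * 'rV[R]_d)%type.
Local Notation mRxT := (mR * 'rV[mR]_d)%type.
Local Notation mu := (strip_measure R d).

Definition compactly_supported (f : RxT -> R) : Prop :=
  [/\ continuous f, on_torus f & exists M, forall z, ~ slab M z -> f z = 0].

Lemma frac_bounds (t : R) : 0 <= t - (Num.floor t)%:~R <= 1.
Proof.
rewrite subr_ge0 floor_le lerBlDl -[X in _ <= _ + X]/(1%:~R) -intrD.
by rewrite ltW// floorD1_gt.
Qed.

(** By periodicity the supremum is attained on a compact fundamental domain. *)
Lemma compactly_supported_bounded f : compactly_supported f ->
  exists M C, 0 <= C /\ forall z, `|f z| <= C * (`[< slab M z >])%:R.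
Proof.
move=> [cf perf [M0 f0]]; pose M : R := `|M0|.
pose K : set RxT := `[- M, M]%classic `*`
  [set x : 'rV[R]_d | forall i : 'I_d, `[0, 1]%classic (x ord0 i)].
have cK : compact K.
  apply: compact_setX; first exact: segment_compact.
  by apply: (@rV_compact R d (fun=> `[0, 1]%classic)) => i; exact: segment_compact.
have K0 : K !=set0.
  exists (0, 0); split; first by rewrite /= in_itv/= oppr_le0 normr_ge0.
  by move=> i; rewrite mxE /= in_itv/= lexx ler01.
have cn : continuous (fun z => `|f z|).
  move=> z; apply: (@continuous_comp _ _ _ f (fun x => `|x|)); first exact: cf.
  exact: norm_continuous.
have [c _ Hc] := compact_EVT_max K0 cK (continuous_subspaceT cn).
exists M, `|f c|; split=> // -[s x].
have [zM|zM] := asboolP (slab M (s, x)); last first.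
  rewrite mulr0 f0 ?normr0// => z0; apply: zM; rewrite /slab/= in z0 *.
  exact: le_trans z0 (ler_norm _).
rewrite mulr1; pose y : 'rV[R]_d := \row_i (- (Num.floor (x ord0 i))%:~R).
rewrite -(perf s x y); last by move=> i _; rewrite mxE rpredN intr_int.
apply: Hc; rewrite inE; split; first by rewrite /= in_itv/= -ler_norml.
by move=> i; rewrite !mxE /= in_itv/= frac_bounds.
Qed.

(** Off the slab [phi] vanishes in a neighbourhood of each point. *)
Lemma derive_compactly_supported phi v : test_function phi ->
  compactly_supported ('D_v phi).
Proof.
move=> [sphi perphi [M phi0]]; split.
- by have [_ /(_ v)] := sphi 1%N.
- move=> s x y yZ; rewrite /derive.
  have E (h : R) : h^-1 *: ((phi \o shift (s, x + y)) (h *: v) - phi (s, x + y)) =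
      h^-1 *: ((phi \o shift (s, x)) (h *: v) - phi (s, x)).
    rewrite perphi//; congr (_ *: (_ - _)).
    rewrite /= -[RHS](perphi _ _ y)//; congr phi.
    transitivity ((h *: v).1 + s, (h *: v).2 + (x + y)); first by [].
    by rewrite addrA.
  by rewrite (funext E).
- exists M => z zM.
  have nz : \forall w \near z, phi w = cst 0 w.
    have cn : {for z, continuous (fun z : RxT => `|z.1|)}.
      apply: (@continuous_comp _ _ _ fst (fun x : R => `|x|)).
        exact: cvg_fst.
      exact: norm_continuous.
    have Mz : M < `|z.1| by rewrite ltNge; apply/negP.
    have : \forall w \near z, M < `|w.1| by exact: (cn _ (lt_nbhsr Mz)).
    apply: filterS => w Mw; apply: phi0; rewrite /slab/=.
    by apply/negP; rewrite -ltNge.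
  by rewrite (near_eq_derive _ nz) derive_cst.
Qed.

Lemma test_compactly_supported phi : test_function phi -> compactly_supported phi.
Proof. by move=> [sphi perphi phi0]; split => //; exact: (sphi 0%N). Qed.

Lemma compactly_supported_integrable (g f : RxT -> R) :
    measurable_fun setT (g : mRxT -> R) ->
    (forall M, mu.-integrable (slab M : set mRxT) (EFin \o g)) ->
    compactly_supported f ->
  mu.-integrable setT ((fun z => (g z * f z)%:E) : mRxT -> _).
Proof.
move=> mg ig csf; have [M [C [C0 fC]]] := compactly_supported_bounded csf.
have mf : measurable_fun setT (f : mRxT -> R).
  by apply: continuous_measurable_strip; have [] := csf.
have mS := @measurable_slab R d M.
have ir : mu.-integrable setT ((EFin \o g : mRxT -> _) \_ (slab M)).
  by apply/integrable_restrict => //; rewrite setTI; exact: ig.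
apply: le_integrable (integrableZl _ C ir) => //.
  by apply/measurable_EFinP; exact: measurable_funM.
move=> z _; rewrite patchE; have := fC z.
have [zM|zM] := asboolP (slab M z); last first.
  rewrite mulr0 => /le_trans /(_ (lexx _)) f0.
  have -> : f z = 0 by apply/eqP; rewrite -normr_le0.
  by rewrite mulr0 abse0 abse_ge0.
rewrite mulr1 mem_set// => fzC; rewrite -EFinM lee_fin !normrM mulrC.
by rewrite ler_wpM2r// (le_trans fzC)// ler_norm.
Qed.

Lemma strip_test_test a b al be k : a < b -> test_function (strip_test a b al be k : RxT -> R).
Proof.
move=> ab; split.
- exact/elementary_smooth/elementary_strip_test.
- by move=> s x y yZ; rewrite /strip_test/= theta_periodic.
- exists (`|a| + `|b|) => z zM; rewrite /strip_test itv_bump_out ?mul0r//.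
  by apply/negP => /itv_slab.
Qed.

Lemma Lfun2_intro (f : RxT -> R) : measurable_fun setT (f : mRxT -> R) ->
  mu.-integrable setT ((fun z => (f z ^+ 2)%:E) : mRxT -> _) ->
  (f : mRxT -> R) \in Lfun mu 2%:E.
Proof.
move=> mf /integrableP[_ i2]; rewrite inE; apply/andP; split; rewrite inE//=.
rewrite /finite_norm unlock; apply: poweR_lty; apply: le_lt_trans i2.
rewrite le_eqVlt; apply/orP; left; apply/eqP; apply: eq_integral => z _.
by rewrite /= normrX powR_mulrn.
Qed.

Lemma Lfun_measurable (f : RxT -> R) : (f : mRxT -> R) \in Lfun mu 2%:E ->
  measurable_fun setT (f : mRxT -> R).
Proof. by move=> /sub_Lfun_mfun; rewrite inE. Qed.

(** The tests of [strip_fundamental] are admissible in the definition of the weak derivative. *)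
Lemma is_De_unique e (U : RxT -> R) (V V' : RxT -> 'rV[R]_d) (i : 'I_d) :
  is_De e U V -> is_De e U V' -> {ae mu, forall z, V z ord0 i = V' z ord0 i}.
Proof.
move=> [_ _ V2 Vtest] [_ _ V2' Vtest'].
have mV := Lfun_measurable (V2 i); have mV' := Lfun_measurable (V2' i).
have iV M := Lfun2_slab M (V2 i); have iV' M := Lfun2_slab M (V2' i).
suff : {ae mu, forall z, V z ord0 i - V' z ord0 i = 0}.
  by apply: ae_imply => z /eqP; rewrite subr_eq0 => /eqP.
apply: (@strip_fundamental R d (fun z => V z ord0 i - V' z ord0 i)).
- exact: measurable_funB.
- by move=> M; apply: (integrableB (measurable_slab M) (iV M) (iV' M)).
- move=> a b al be k ab _ _ _; have tt := strip_test_test al be k ab.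
  have cs := test_compactly_supported tt.
  under eq_Rintegral do rewrite mulrBl.
  rewrite RintegralB//; [|exact: compactly_supported_integrable|exact: compactly_supported_integrable].
  have := Vtest _ tt i; rewrite (Vtest' _ tt i) => /oppr_inj ->.
  by rewrite subrr.
Qed.

End test_functions.

(** * Derivatives along lines and invariant functions *)

Section lines.
Context {R : realType} {V : normedModType R}.

Lemma is_derive_line (phi : V -> R) (z v : V) (s : R) :
  differentiable phi (z + s *: v) ->
  is_derive s (1 : R) (fun s => phi (z + s *: v)) ('D_v phi (z + s *: v)).
Proof.
move=> dphi; have dv := @diff_derivable _ _ _ phi _ v dphi.
have E (h : R) : h^-1 *: (((fun s => phi (z + s *: v)) \o shift s) (h *: (1 : R)) - phi (z + s *: v)) =
    h^-1 *: ((phi \o shift (z + s *: v)) (h *: v) - phi (z + s *: v)).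
  congr (_ *: (phi _ - _)); rewrite /= [h *: 1]mulr1 scalerDl.
  by rewrite addrCA addrA.
apply: DeriveDef; first by rewrite /derivable (funext E).
by rewrite /derive (funext E).
Qed.

End lines.

Section compact_1d.
Context {R : realType}.
Local Notation leb := (@lebesgue_measure R).

Lemma integrable_mul_compact (v psi : R -> R) M : measurable_fun setT v ->
    (forall a b, leb.-integrable `[a, b]%classic (EFin \o v)) ->
    continuous psi -> (forall t, M < `|t| -> psi t = 0) ->
  leb.-integrable setT (fun t => (v t * psi t)%:E).
Proof.
move=> mv iv cpsi psi0; pose N : R := `|M|.
have N0 : - N <= N by rewrite ge0_cp// /N.
have cn : continuous (fun t => `|psi t|).
  move=> z; apply: (@continuous_comp _ _ _ psi (fun x => `|x|)); first exact: cpsi.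
  exact: norm_continuous.
have [c _ Hc] := EVT_max N0 (continuous_subspaceT cn).
have ir : leb.-integrable setT ((EFin \o v) \_ `[- N, N]%classic).
  by apply/integrable_restrict => //; rewrite setTI; exact: iv.
apply: le_integrable (integrableZl _ `|psi c| ir) => //.
  apply/measurable_EFinP; apply: measurable_funM => //.
  exact: continuous_measurable_fun.
move=> t _; rewrite patchE; case: ifPn => [|tN].
  rewrite inE/= => tN; rewrite lee_fin !normrM normr_id mulrC.
  by rewrite ler_wpM2r// Hc.
rewrite psi0 ?mulr0 ?abse0 ?abse_ge0//.
apply: (le_lt_trans (ler_norm _)); rewrite ltNge; apply/negP => tM.
by move: tN; rewrite notin_setE /= in_itv/= -ler_norml.
Qed.

End compact_1d.

Section invariance.
Context {R : realType} {d : nat}.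
Local Notation mR := (measurableTypeR R).
Local Notation RxT := (R * 'rV[R]_d)%type.
Local Notation mRxT := (mR * 'rV[mR]_d)%type.
Local Notation mu := (strip_measure R d).

Lemma bounded_slab_integrable (G : RxT -> R) : measurable_fun setT (G : mRxT -> R) ->
  (forall z, `|G z| <= 1) -> forall M, mu.-integrable (slab M : set mRxT) (EFin \o G).
Proof.
move=> mG G1 M; have i1 : mu.-integrable (slab M : set mRxT) (EFin \o cst 1).
  apply/integrableP; split; first exact/measurable_EFinP.
  rewrite (eq_integral (cst 1%E)) => [|z _]; last by rewrite /= normr1.
  by rewrite integral_cst ?mul1e ?strip_measure_slab//; exact: measurable_slab.
apply: le_integrable i1.
- exact: measurable_slab.
- by apply/measurable_EFinP; exact: measurable_funTS.
by move=> z _; rewrite /= lee_fin normr1.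
Qed.

(** The difference quotients of [phi] in the direction [x_i] have zero integral against [G], by invariance under translation; the mean value theorem bounds them, and dominated convergence applies. *)
Lemma invariant_derivative_null (G phi : RxT -> R) (i : 'I_d) :
    measurable_fun setT (G : mRxT -> R) -> (forall z, `|G z| <= 1) -> on_torus G ->
    (forall h z, G (slide i (cst h) z) = G z) -> test_function phi ->
  \int[mu]_z (G z * 'D_((0, delta_mx 0 i) : RxT) phi z) = 0.
Proof.
move=> mG G1 perG Ginv tphi; pose v : RxT := (0, delta_mx 0 i).
have csD := derive_compactly_supported v tphi.
have csphi := test_compactly_supported tphi.
have iG := bounded_slab_integrable mG G1.
have [M [C [C0 DC]]] := compactly_supported_bounded csD.
have [sphi perphi _] := tphi.
have diffphi z : differentiable phi z by have [] := sphi 1%N.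
have slideE h z : slide i (cst h) z = z + h *: v.
  by case: z => s x; rewrite /slide /= /v; congr pair; rewrite /= scaler0 addr0.
pose q k z := G z * (k.+1%:R * (phi (slide i (cst k.+1%:R^-1) z) - phi z)).
have mphi : measurable_fun setT (phi : mRxT -> R).
  by apply: continuous_measurable_strip; have [] := csphi.
have mphis h : measurable_fun setT ((fun z => phi (slide i (cst h) z)) : mRxT -> R).
  exact: (measurableT_comp mphi (@measurable_slide R d i (cst h) (measurable_cst _))).
have mq k : measurable_fun setT ((fun z => (q k z)%:E) : mRxT -> _).
  apply/measurable_EFinP; apply: measurable_funM => //.
  by apply: measurable_funM; [exact: measurable_cst|exact: measurable_funB].
have iGphi := compactly_supported_integrable mG iG csphi.
have perGphi : on_torus (fun z => (G z * phi z)%:E).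
  by move=> s x y yZ; rewrite perG// perphi.
have iGphis h := @slide_integrable R d i (cst h) (measurable_cst _) _ perGphi iGphi.
have q0 k : (\int[mu]_z (q k z)%:E = 0)%E.
  pose h : R := k.+1%:R^-1.
  have -> : (fun z => (q k z)%:E) = (fun z => k.+1%:R%:E *
      ((((fun z => (G z * phi z)%:E) \o slide i (cst h)) \- (fun z => (G z * phi z)%:E)) z))%E.
    by apply/funext => z; rewrite /q /= Ginv -EFinB -EFinM; congr EFin; ring.
  rewrite integralZl//; last exact: integrableB.
  rewrite integralB//= (@slide_integral R d i (cst h) (measurable_cst _) _ perGphi).
    by rewrite subee ?mule0//; exact: integrable_fin_num.
  exact: measurable_int iGphi.
have qC k z : `|q k z| <= C * (`[< slab M z >])%:R.
  have k0 : 0 < k.+1%:R :> R by [].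
  have h0 : 0 <= k.+1%:R^-1 :> R by [].
  have dl s : is_derive s (1 : R) (fun s => phi (z + s *: v)) ('D_v phi (z + s *: v)).
    by apply: is_derive_line.
  have [|c _ E] := MVT_segment h0 (fun s _ => dl s).
    apply: continuous_subspaceT => s; apply: differentiable_continuous.
    by apply/derivable1_diffP; have [] := dl s.
  rewrite scale0r addr0 subr0 in E.
  rewrite /q slideE E [X in _ * X]mulrCA divff ?mulr1; last by rewrite gt_eqF.
  rewrite normrM (le_trans (ler_piMl _ (G1 z)))//.
  have := DC (z + c *: v); congr (_ <= _ * _).
  congr (_ %:R); congr (nat_of_bool _); apply/asboolP/asboolP; rewrite /slab/= scaler0 addr0//.
have ig : mu.-integrable setT ((fun z => (C * (`[< slab M z >])%:R)%:E) : mRxT -> _).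
  have ir : mu.-integrable setT ((cst (C%:E) : mRxT -> _) \_ (slab M)).
    apply/integrable_restrict => //; first exact: measurable_slab.
    rewrite setTI; apply/integrableP; split => //.
    rewrite (eq_integral (cst C%:E)) => [|z _]; last by rewrite /= ger0_norm.
    rewrite integral_cst; last exact: measurable_slab.
    by apply: lte_mul_pinfty => //; exact: strip_measure_slab.
  apply: eq_integrable ir => // z _; rewrite patchE.
  have [zM|zM] := asboolP (slab M z); first by rewrite mem_set// mulr1.
  by rewrite memNset// mulr0.
have cvq : {ae mu, forall z : mRxT, setT z ->
    (fun k => (q k z)%:E) @ \oo --> (G z * 'D_v phi z)%:E}.
  apply: aeW => z _; apply: cvg_EFin; first exact: nearW.
  rewrite /=; apply: cvgMr.
  have dv := @diff_derivable _ _ _ phi z v (diffphi z).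
  have hk : (fun k : nat => k.+1%:R^-1 : R) @ \oo --> (0 : R)^'.
    move=> B HB; have H : \forall k \near \oo, harmonic k != 0 :> R -> B (harmonic k) :=
      @cvg_harmonic R _ HB.
    have : \forall k \near \oo, B (harmonic k : R); last by [].
    by apply: filterS H => k; apply; rewrite /harmonic /= invr_eq0 pnatr_eq0.
  have := cvg_comp _ _ hk dv; apply: cvg_trans; apply: near_eq_cvg.
  apply: nearW => k /=; rewrite invrK slideE [X in phi X]addrC.
  by [].
have [_ _] := dominated_convergence measurableT mq
  (measurable_int _ (compactly_supported_integrable mG iG csD)) cvq ig
  ltac:(by apply: aeW => z k _; rewrite lee_fin; exact: qC).
under eq_fun do rewrite q0.
by move=> /(cvg_unique _ (cvg_cst _)) E; rewrite /Rintegral -E.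
Qed.

End invariance.

(** * Oblique lines and their labels *)

Section signs.
Context {R : realType}.
Implicit Types sg sigma x : R.

Lemma sign_cases sg : sg * sg = 1 -> sg = 1 \/ sg = - 1.
Proof.
move=> sg1; have : sg ^+ 2 = 1 ^+ 2 by rewrite !expr2 sg1 mulr1.
by move/eqP; rewrite eqf_sqr => /orP[/eqP|/eqP]; [left|right].
Qed.

Lemma norm_sign sg : sg * sg = 1 -> `|sg| = 1.
Proof. by move=> /sign_cases[] ->; rewrite ?normrN normr1. Qed.

Lemma wrong_sign_gap sigma x : sigma * sigma = 1 -> sigma * x <= 0 -> 1 <= `|x - sigma|.
Proof.
move=> s2 sx; have -> : `|x - sigma| = `|sigma * (x - sigma)| by rewrite normrM (norm_sign s2) mul1r.
rewrite mulrBr s2 distrC.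
by apply: le_trans (ler_norm _); rewrite lerBrDr gerDl.
Qed.

End signs.

Section translation.
Context {R : realType}.
Local Notation mR := (measurableTypeR R).
Local Notation leb := (@lebesgue_measure R).
Implicit Types (p dp : R -> R) (h : R).

Lemma measurable_translate h : measurable_fun setT ((fun t => t + h) : mR -> mR).
Proof. by have : measurable_fun setT (fun t : R => t + h) by exact: measurable_funD. Qed.

Lemma integrable_translate h (f : R -> \bar R) :
  leb.-integrable setT f -> leb.-integrable setT (fun t => f (t + h)).
Proof.
move=> /integrableP[mf iF]; apply/integrableP; split.
  exact: (measurableT_comp mf (measurable_translate h)).
rewrite (ge0_integral_translate h (f := abse \o f))//.
  exact: measurableT_comp.
by move=> t; exact: abse_ge0.
Qed.

Lemma integral_translate h (f : R -> \bar R) : measurable_fun setT f ->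
  (\int[leb]_t f (t + h)%R = \int[leb]_t f t)%E.
Proof.
move=> mf; rewrite -[LHS]/(integral leb setT (f \o (fun t => t + h))).
rewrite integralE [RHS]integralE funepos_comp funeneg_comp.
congr (_ - _)%E.
- exact: (ge0_integral_translate h (measurable_funepos mf) (funepos_ge0 _)).
- exact: (ge0_integral_translate h (measurable_funeneg mf) (funeneg_ge0 _)).
Qed.

Lemma primitive_translate h p dp : primitive p dp ->
  primitive (fun t => p (t + h)) (fun t => dp (t + h)).
Proof.
move=> pdp; have mdp := primitive_measurable pdp; have [idp pE] := pdp.
have E a b : ((EFin \o (fun t => dp (t + h))) \_ `[a, b]%classic) =
    fun t => ((EFin \o dp) \_ `[a + h, b + h]%classic) (t + h).
  apply/funext => t; rewrite !patchE; congr (if _ then _ else _).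
  by apply/idP/idP; rewrite !inE/= !in_itv/= !lerD2r.
have ir a b : leb.-integrable setT ((EFin \o dp) \_ `[a, b]%classic).
  by apply/integrable_restrict => //; rewrite setTI.
split=> [a b|s t st].
  have : leb.-integrable setT ((EFin \o (fun t => dp (t + h))) \_ `[a, b]%classic).
    by rewrite E; exact: integrable_translate.
  by move=> /integrable_restrict; rewrite setTI; apply.
rewrite pE ?lerD2r// /Rintegral integral_mkcond [in RHS]integral_mkcond; congr fine.
pose J : set R := `[s + h, t + h]%classic.
transitivity (\int[leb]_r (((EFin \o dp) \_ J) (r + h)%R))%E.
  rewrite (integral_translate h (f := (EFin \o dp) \_ J))//; exact: (measurable_int _ (ir (s + h) (t + h))).
apply: eq_integral => r _; by rewrite -[LHS]/((fun t => ((EFin \o dp) \_ J) (t + h)) r) -E.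
Qed.

End translation.

Section line_fubini.
Context {R : realType} {n : nat}.
Local Notation mR := (measurableTypeR R).
Local Notation RxT := (R * 'rV[R]_n.+1)%type.
Local Notation mRxT := (mR * 'rV[mR]_n.+1)%type.
Local Notation leb := (@lebesgue_measure R).
Local Notation nu := (torus_measure R n.+1).
Local Notation mu := (strip_measure R n.+1).
Variable sg : R.

Lemma measurable_shear : measurable_fun setT (shear sg : mRxT -> mRxT).
Proof. exact: measurable_slide (measurable_mulrl sg). Qed.

(** Up to the sign [sg], the first component of the operator is a derivative along the lines that [shear sg] straightens. *)
Lemma derive_oblique (phi : RxT -> R) z : sg * sg = 1 -> differentiable phi z ->
  'D_((sg, delta_mx 0 ord0) : RxT) phi z =
  sg * 'D_((1, sg *: delta_mx 0 ord0) : RxT) phi z.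
Proof.
move=> sg1 dphi; rewrite !deriveE//.
have -> : ((sg, delta_mx 0 ord0) : RxT) = sg *: ((1, sg *: delta_mx 0 ord0) : RxT).
  by congr pair; rewrite /= ?[sg *: 1]mulr1// scalerA sg1 scale1r.
by rewrite linearZ.
Qed.

Lemma ge0_line_fubini (F : RxT -> \bar R) : measurable_fun setT (F : mRxT -> _) ->
    (forall z, (0 <= F z)%E) -> on_torus F ->
  (\int[mu]_z F z = \int[nu]_y \int[leb]_s F (shear sg (s, y)))%E.
Proof.
move=> mF F0 perF; rewrite -(ge0_slide_integral ord0 (measurable_mulrl sg))//.
rewrite [LHS](fubini_tonelli2 (F \o shear sg : mRxT -> _))//.
exact: (measurableT_comp mF measurable_shear).
by move=> z; exact: F0.
Qed.

Lemma line_fubini (F : RxT -> \bar R) : on_torus F ->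
    mu.-integrable setT (F : mRxT -> _) ->
  (\int[mu]_z F z = \int[nu]_y \int[leb]_s F (shear sg (s, y)))%E.
Proof.
move=> perF iF; rewrite -(slide_integral ord0 (measurable_mulrl sg))//; last first.
  exact: measurable_int iF.
by rewrite -(integral21_prod_meas1 (slide_integrable ord0 (measurable_mulrl sg) perF iF)).
Qed.

(** The parameter of [z] on its line, with the phase chosen among those that differ by the periods so that it is well defined on the torus; this choice makes it discontinuous. *)
Definition label (z : RxT) : R :=
  let c := z.2 ord0 ord0 - sg * z.1 in z.1 + sg * (c - (Num.floor c)%:~R).

Lemma measurable_frac : measurable_fun setT (fun t : R => t - (Num.floor t)%:~R).
Proof.
apply: measurable_funB; first exact: measurable_id.
by apply: nondecreasing_measurable => // s t st; rewrite ler_int le_floor.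
Qed.

Lemma measurable_label : measurable_fun setT (label : mRxT -> R).
Proof.
apply: measurable_funD; first exact: measurable_fst.
apply: measurable_funM; first exact: measurable_cst.
apply: (measurableT_comp measurable_frac); apply: measurable_funB.
  exact: (measurableT_comp (measurable_rV_coord ord0) measurable_snd).
by apply: measurable_funM; [exact: measurable_cst|exact: measurable_fst].
Qed.

Lemma label_periodic : on_torus label.
Proof.
move=> s x y yZ; rewrite /label/= mxE; have /intrP[m ->] := yZ ord0 (ltn_ord _).
have -> : x ord0 ord0 + m%:~R - sg * s = x ord0 ord0 - sg * s + m%:~R by rewrite addrAC.
set c := x ord0 ord0 - _; rewrite floorDrz ?intr_int// intrKfloor intrD opprD.
by rewrite addrACA subrr addr0.
Qed.

Lemma label_shear s y :
  label (shear sg (s, y)) = s + sg * (y ord0 ord0 - (Num.floor (y ord0 ord0))%:~R).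
Proof. by rewrite /label /shear /slide/= !mxE eqxx mulr1 addrK. Qed.

Lemma label_near z : sg * sg = 1 -> `|label z - z.1| <= 1.
Proof.
move=> sg1; rewrite /label addrAC subrr add0r normrM.
rewrite norm_sign//; by have /andP[f0 f1] := frac_bounds (z.2 ord0 ord0 - sg * z.1); rewrite mul1r ger0_norm.
Qed.

(** On each line the label is a translate of the parameter, and the torus has total mass 1. *)
Lemma ge0_label_integral (K : R -> \bar R) : measurable_fun setT K ->
  (forall t, (0 <= K t)%E) -> (\int[mu]_z K (label z) = \int[leb]_t K t)%E.
Proof.
move=> mK K0; rewrite (@ge0_line_fubini (K \o label))//; last 3 first.
- exact: (measurableT_comp mK measurable_label).
- by move=> z; exact: K0.
- by move=> s x y yZ /=; rewrite label_periodic.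
under eq_integral do under eq_integral do rewrite /= label_shear.
under eq_integral do rewrite ge0_integral_translate//.
by rewrite integral_cst// [X in (_ * X)%E]probability_setT mule1.
Qed.

End line_fubini.

(** * The energy of a layered medium *)

Section layered_energy.
Context {R : realType} {n : nat}.
Local Notation mR := (measurableTypeR R).
Local Notation RxT := (R * 'rV[R]_n.+1)%type.
Local Notation mRxT := (mR * 'rV[mR]_n.+1)%type.
Local Notation mu := (strip_measure R n.+1).

Lemma dot_scalar (c : R) (v : 'rV[R]_n.+1) : dot (apply_mx c%:M v) v = c * dot v v.
Proof.
rewrite /dot /apply_mx mulr_sumr; apply: eq_bigr => i _.
by rewrite mul_scalar_mx !mxE mulrA.
Qed.

Variable a0 : R -> R.
Hypothesis ma0 : measurable_fun setT a0.
Hypothesis a0_ge0 : forall t, 0 <= a0 t.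

Definition layered (x : 'rV[R]_n.+1) : 'M[R]_n.+1 := (a0 (x ord0 ord0))%:M.

Definition strip_density (U : RxT -> R) (V : RxT -> 'rV[R]_n.+1) (z : RxT) : R :=
  2^-1 * (a0 (z.2 ord0 ord0) * dot (V z) (V z)) + double_well (U z).

Lemma dot_ge0 (v : 'rV[R]_n.+1) : 0 <= dot v v.
Proof. by apply: sumr_ge0 => i _; rewrite -expr2 sqr_ge0. Qed.

Lemma strip_density_ge0 U V z : 0 <= strip_density U V z.
Proof.
apply: addr_ge0; last exact: double_well_ge0.
by apply: mulr_ge0 => //; apply: mulr_ge0; [exact: a0_ge0|exact: dot_ge0].
Qed.

Lemma measurable_strip_density (U : RxT -> R) (V : RxT -> 'rV[R]_n.+1) :
  measurable_fun setT (U : mRxT -> R) ->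
  (forall i, measurable_fun setT ((fun z => V z ord0 i) : mRxT -> R)) ->
  measurable_fun setT ((fun z => (strip_density U V z)%:E) : mRxT -> _).
Proof.
move=> mU mV; apply/measurable_EFinP; apply: measurable_funD; last first.
  exact: (measurableT_comp measurable_double_well mU).
apply: measurable_funM; first exact: measurable_cst.
apply: measurable_funM.
  exact: (measurableT_comp ma0 (measurableT_comp (measurable_rV_coord ord0) measurable_snd)).
rewrite [X in measurable_fun _ X](_ : _ =
  fun z : mRxT => \sum_(i < n.+1) V z ord0 i * V z ord0 i) //.
by apply: measurable_sum => i; exact: measurable_funM.
Qed.

(** Two weak derivatives agree almost everywhere, so the one selected in the definition of the energy may be replaced by any other. *)
Lemma energyE e (U : RxT -> R) (V : RxT -> 'rV[R]_n.+1) :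
    measurable_fun setT (U : mRxT -> R) -> is_De e U V ->
  energy (@double_well R) layered e U = (\int[mu]_z (strip_density U V z)%:E)%E.
Proof.
move=> mU UV; rewrite /energy; have exV : exists V, is_De e U V by exists V.
rewrite (asboolT exV); have UD : is_De e U (De e U).
  by rewrite /De; apply: (@xgetPex _ _ [set V | is_De e U V]).
have mVi (W : RxT -> 'rV[R]_n.+1) : is_De e U W ->
    forall i, measurable_fun setT ((fun z => W z ord0 i) : mRxT -> R).
  by move=> [_ _ W2 _] i; exact: Lfun_measurable (W2 i).
transitivity (\int[mu]_z (strip_density U (De e U) z)%:E)%E.
  by apply: eq_integral => z _; rewrite dot_scalar.
apply: ge0_ae_eq_integral => //.
- by apply: measurable_strip_density => //; exact: mVi.
- by apply: measurable_strip_density => //; exact: mVi.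
- by move=> z _; rewrite lee_fin; exact: strip_density_ge0.
- by move=> z _; rewrite lee_fin; exact: strip_density_ge0.
have : {ae mu, forall z : mRxT, forall i, De e U z ord0 i = V z ord0 i}.
  by apply: filter_forall => i; exact: (is_De_unique i UD UV).
apply: ae_imply => z E _; rewrite /strip_density; congr ((_ * (_ * _) + _)%:E).
by apply: eq_bigr => i _; rewrite !E.
Qed.

End layered_energy.

Section competitor.
Context {R : realType} {n : nat}.
Local Notation mR := (measurableTypeR R).
Local Notation RxT := (R * 'rV[R]_n.+1)%type.
Local Notation mRxT := (mR * 'rV[mR]_n.+1)%type.
Local Notation leb := (@lebesgue_measure R).
Local Notation mu := (strip_measure R n.+1).

Variable sg : R.
Hypothesis sg1 : sg * sg = 1.
Local Notation label := (@label R n sg).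

Variables p dp : R -> R.
Hypothesis pdp : profile p dp.

Definition competitor (z : RxT) : R := p (label z).

Definition competitor_De (z : RxT) : 'rV[R]_n.+1 :=
  (sg * dp (label z)) *: delta_mx 0 ord0.

Let mdp : measurable_fun setT dp.
Proof. by have [/primitive_measurable] := pdp. Qed.

Let cp : continuous p.
Proof. by have [/primitive_continuous] := pdp. Qed.

Let p_le1 t : `|p t| <= 1. Proof. by have [_] := pdp. Qed.

Lemma competitor_DeE z i : competitor_De z ord0 i = sg * dp (label z) * (i == ord0)%:R.
Proof. by rewrite !mxE eqxx. Qed.

Lemma measurable_competitor : measurable_fun setT (competitor : mRxT -> R).
Proof.
exact: (measurableT_comp (continuous_measurable_fun cp) (@measurable_label R n sg)).
Qed.

Lemma measurable_competitor_De i :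
  measurable_fun setT ((fun z => competitor_De z ord0 i) : mRxT -> R).
Proof.
under eq_fun do rewrite competitor_DeE; apply: measurable_funM; last exact: measurable_cst.
apply: measurable_funM; first exact: measurable_cst.
exact: (measurableT_comp mdp (@measurable_label R n sg)).
Qed.

Lemma competitor_periodic : on_torus competitor.
Proof. by move=> s x y yZ; rewrite /competitor label_periodic. Qed.

Lemma competitor_De_periodic : on_torus competitor_De.
Proof. by move=> s x y yZ; rewrite /competitor_De label_periodic. Qed.

Let e : 'rV[R]_n.+1 := sg *: delta_mx 0 ord0.

Lemma competitor_De_L2 i : ((fun z => competitor_De z ord0 i) : mRxT -> R) \in Lfun mu 2%:E.
Proof.
apply: Lfun2_intro; first exact: measurable_competitor_De.
apply/integrableP; split.
  by apply/measurable_EFinP; apply: measurable_funX; exact: measurable_competitor_De.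
have [_ _ /integrableP[m2 i2] _ _] := pdp.
apply: le_lt_trans i2.
pose K : R -> \bar R := abse \o (EFin \o (fun t => dp t ^+ 2)).
have mK : measurable_fun setT K by exact: measurableT_comp.
rewrite -[leRHS]/(integral leb setT K) -(@ge0_label_integral R n sg K)//; last first.
- by move=> t; exact: abse_ge0.
apply: ge0_le_integral => //.
- apply: measurableT_comp => //; apply/measurable_EFinP; apply: measurable_funX.
  exact: measurable_competitor_De.
- exact: (measurableT_comp mK (@measurable_label R n sg)).
move=> z _; rewrite lee_fin competitor_DeE !normrX ler_sqr ?nnegrE// !normrM.
by rewrite (norm_sign sg1) mul1r; case: (i == ord0); rewrite ?normr1 ?normr0 ?mulr1 ?mulr0.
Qed.

(** Integration by parts on a single line, where [competitor] is a translate of [p]. *)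
Lemma competitor_line (phi : RxT -> R) (y : 'rV[R]_n.+1) : test_function phi ->
  (\int[leb]_s (competitor (shear sg (s, y)) *
      'D_((sg, delta_mx 0 ord0) : RxT) phi (shear sg (s, y)))%:E =
   \int[leb]_s (- (competitor_De (shear sg (s, y)) ord0 ord0 * phi (shear sg (s, y))))%:E)%E.
Proof.
move=> tphi; pose v : RxT := (1, sg *: delta_mx 0 ord0).
pose c := sg * (y ord0 ord0 - (Num.floor (y ord0 ord0))%:~R).
have [sphi _ [M phi0]] := tphi.
have diffphi z : differentiable phi z by have [] := sphi 1%N.
have [cD _ _] := derive_compactly_supported v tphi.
have shE s : shear sg (s, y) = (0, y) + s *: v.
  by rewrite /shear /slide /v; congr pair; rewrite /= ?add0r ?[s *: 1]mulr1// scalerA mulrC.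
have DE z := derive_oblique sg1 (diffphi z).
pose psi s := phi (shear sg (s, y)); pose dpsi s := 'D_v phi (shear sg (s, y)).
have psiP s : is_derive s (1 : R) psi (dpsi s).
  rewrite /psi /dpsi shE (_ : (fun s => _) = fun s => phi ((0, y) + s *: v)).
    exact: is_derive_line.
  by apply/funext => r; rewrite shE.
have csh : continuous (fun s : R => shear sg (s, y)).
  move=> s; rewrite (_ : (fun s => _) = fun s => (0, y) + s *: v); last first.
    by apply/funext => r; rewrite shE.
  by apply: cvgD; [exact: cvg_cst|apply: cvgZl; exact: cvg_id].
have cdpsi : continuous dpsi.
  by move=> s; apply: (@continuous_comp _ _ _ (fun s : R => shear sg (s, y)) ('D_v phi)); [exact: csh|exact: cD].
have psi0 s : M < `|s| -> psi s = 0.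
  by move=> Ms; apply: phi0; rewrite /slab/= => /(lt_le_trans Ms); rewrite ltxx.
have [pp _ _ _ _] := pdp.
have ppc := primitive_translate c pp.
have cpc := primitive_continuous ppc; have mdpc := primitive_measurable ppc.
have IBP := primitive_by_parts ppc cpc psiP cdpsi psi0.
have cpsi : continuous psi.
  move=> t; apply: differentiable_continuous; apply/derivable1_diffP.
  by have [] := psiP t.
have i1 : leb.-integrable setT (fun t => (p (t + c) * dpsi t)%:E).
  apply: (@integrable_compact_support _ (fun t => p (t + c) * dpsi t) M).
    by move=> t; apply: cvgM; [exact: cpc|exact: cdpsi].
  by move=> t Mt; rewrite (derive_eq0_out psiP psi0)// mulr0.
have i2 : leb.-integrable setT (fun t => (dp (t + c) * psi t)%:E).
  by apply: (@integrable_mul_compact _ _ psi M) => //; have [] := ppc.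
transitivity (\int[leb]_s (sg%:E * (p (s + c) * dpsi s)%:E))%E.
  apply: eq_integral => s _; rewrite /competitor label_shear DE -EFinM; congr EFin.
  by rewrite /dpsi mulrCA.
transitivity (\int[leb]_s ((- sg)%:E * (dp (s + c) * psi s)%:E))%E; last first.
  apply: eq_integral => s _; rewrite competitor_DeE eqxx mulr1 label_shear -EFinM.
  by rewrite mulrA mulNr mulNr.
rewrite !integralZl//.
rewrite -(fineK (integrable_fin_num measurableT i1)) -(fineK (integrable_fin_num measurableT i2)).
by rewrite -!EFinM; congr EFin; move: IBP; rewrite /Rintegral => ->; rewrite mulrN mulNr.
Qed.

(** The first component is tested line by line. The others vanish because the label does not involve the other coordinates. *)
Lemma competitor_is_De : is_De e competitor competitor_De.
Proof.
have imc M := @bounded_slab_integrable R _ _ measurable_competitor (fun z => p_le1 (label z)) M.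
split=> //; [exact: competitor_De_periodic|exact: competitor_De_L2|].
move=> phi tphi i; have csphi := test_compactly_supported tphi.
have mDe j := measurable_competitor_De j.
have [i0|i0] := eqVneq i ord0; last first.
  rewrite [in RHS](_ : (fun z => _) = cst 0); last first.
    by apply/funext => z; rewrite competitor_DeE (negbTE i0) mulr0 mul0r.
  rewrite [in RHS]/Rintegral integral0 oppr0 /De_smooth.
  have -> : e ord0 i = 0 by rewrite !mxE (negbTE i0) andbF mulr0.
  apply: invariant_derivative_null => //.
  - exact: measurable_competitor.
  - by move=> z; exact: p_le1.
  - exact: competitor_periodic.
  - move=> h z; rewrite /competitor /label /slide/= !mxE eqxx/=.
    by rewrite [ord0 == i]eq_sym (negbTE i0) mulr0 addr0.
rewrite i0; have -> : De_smooth e ord0 phi = 'D_((sg, delta_mx 0 ord0) : RxT) phi.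
  by rewrite /De_smooth !mxE eqxx/= mulr1.
have csD := derive_compactly_supported ((sg, delta_mx 0 ord0) : RxT) tphi.
have iDe M := Lfun2_slab M (competitor_De_L2 ord0).
have i1 := compactly_supported_integrable measurable_competitor imc csD.
have i2 := compactly_supported_integrable (mDe ord0) iDe csphi.
have [_ perphi _] := csphi; have [_ perD _] := csD.
rewrite /Rintegral (@line_fubini R n sg) //; last first.
  by move=> s x y yZ; rewrite perD// competitor_periodic.
rewrite -(fineN) -integralN; last exact: integrable_add_def.
congr fine.
rewrite [RHS](@line_fubini R n sg)//.
- by apply: eq_integral => y _; rewrite competitor_line.
- by move=> s x y yZ; rewrite perphi// competitor_De_periodic.
- exact: integrableN.
Qed.

End competitor.

Lemma cvge0_le (R : realType) (T : Type) (F : set_system T) (FF : Filter F) (f : T -> \bar R) :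
  (forall t, 0 <= f t)%E ->
  (forall eps : R, 0 < eps -> \forall t \near F, (f t <= eps%:E)%E) ->
  f @ F --> 0%E.
Proof.
move=> f0 fe; have ffin : \forall t \near F, f t \is a fin_num.
  apply: filterS (fe 1 ltr01) => t ft; rewrite ge0_fin_numE//.
  exact: le_lt_trans ft (ltry _).
apply/fine_cvgP; split => //; apply/cvgr0Pnorm_le => eps e0.
apply: filterS2 ffin (fe _ e0) => t tfin; rewrite -{1}(fineK tfin) lee_fin => te /=.
by rewrite ger0_norm// fine_ge0.
Qed.

Section competitor_energy.
Context {R : realType} {n : nat}.
Local Notation mR := (measurableTypeR R).
Local Notation RxT := (R * 'rV[R]_n.+1)%type.
Local Notation mRxT := (mR * 'rV[mR]_n.+1)%type.
Local Notation leb := (@lebesgue_measure R).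
Local Notation mu := (strip_measure R n.+1).

Variable sg : R.
Hypothesis sg1 : sg * sg = 1.
Variables p dp : R -> R.
Hypothesis pdp : profile p dp.
Local Notation U := (@competitor R n sg p).
Local Notation e := ((sg *: delta_mx 0 ord0)%R : 'rV[R]_n.+1).

Let slab_cvg (F : set_system R) (c : R) : Filter F ->
  (forall eta, 0 < eta -> forall M, \forall s \near F, forall z : RxT, slab M z ->
    `|U (z.1 + s, z.2) - c| <= eta) ->
  forall M, (\int[mu]_(z in slab M) `|U (z.1 + s, z.2) - c|%:E)%E @[s --> F] --> 0%E.
Proof.
move=> FF H M; apply: cvge0_le => [s|eps e0].
  by apply: integral_ge0 => z _; rewrite lee_fin.
have muM := @strip_measure_slab R n.+1 M.
have mM := @measurable_slab R n.+1 M.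
pose m := fine (mu (slab M)).
have muE : mu (slab M) = m%:E by rewrite /m fineK// ge0_fin_numE.
have m0 : 0 <= m by rewrite /m fine_ge0.
have m1 : 0 < m + 1 by rewrite ltr_wpDl.
have eta0 : 0 < eps / (m + 1) by rewrite divr_gt0.
apply: filterS (H _ eta0 M) => s Hs.
have mUs : measurable_fun setT ((fun z => U (z.1 + s, z.2)) : mRxT -> R).
  apply: (measurableT_comp (@measurable_competitor R n sg p dp pdp)).
  apply: measurable_fun_pair; last exact: measurable_snd.
  by apply: measurable_funD; [exact: measurable_fst|exact: measurable_cst].
apply: (@le_trans _ _ (\int[mu]_(z in slab M) (eps / (m + 1))%:E)%E).
  apply: ge0_le_integral => //.
  - apply: measurable_funTS; apply/measurable_EFinP; apply: measurableT_comp => //.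
    by apply: measurable_funB => //; exact: measurable_cst.
rewrite integral_cst// muE -EFinM lee_fin mulrAC ler_pdivrMr//.
by rewrite ler_wpM2l ?lerDl// ltW.
Qed.

Lemma competitor_admissible : admissible U.
Proof.
have [_ p_le1 _ pR pL] := pdp.
have lab_near (z : RxT) := label_near z sg1.
split.
- exact: measurable_competitor pdp.
- exact: competitor_periodic.
- by apply: aeW => z; exact: p_le1.
- apply: slab_cvg => eta eta0 M; have [N HN] := pR _ eta0.
  near=> s; move=> z; rewrite /slab/= ler_norml => /andP[zM _].
  apply: HN; have := lab_near (z.1 + s, z.2); rewrite ler_norml /= => /andP[+ _].
  have : N + M + 1 < s by near: s; apply: nbhs_pinfty_gt; exact: num_real.
  by lra.
- move=> M; under eq_fun do under eq_integral do rewrite -[in X in _ + X](opprK 1).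
  move: M.
  move=> M; apply: slab_cvg => eta eta0 {}M; have [N HN] := pL _ eta0.
  near=> s; move=> z; rewrite /slab/= ler_norml opprK => /andP[_ zM].
  apply: HN; have := lab_near (z.1 + s, z.2); rewrite ler_norml /= => /andP[_].
  have : s < - (N + M + 1) by near: s; apply: nbhs_ninfty_lt; exact: num_real.
  by lra.
Unshelve. all: by end_near. Qed.

Variable a0 : R -> R.
Hypothesis ma0 : measurable_fun setT a0.
Hypothesis a0_ge0 : forall t, 0 <= a0 t.
Hypothesis a0_even : forall t, a0 (- t) = a0 t.
Hypothesis a0_per : forall t z, z \is a Num.int -> a0 (t + z) = a0 t.

(** Evenness absorbs the sign [sg], periodicity the integer part hidden in the label. *)
Lemma coefficient_label (z : RxT) : a0 (z.2 ord0 ord0) = a0 (label sg z).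
Proof.
rewrite /label; set x := z.2 ord0 ord0; set m := (Num.floor _)%:~R.
have mZ : m \is a Num.int by exact: intr_int.
case: (sign_cases sg1) => ->; last rewrite -[LHS]a0_even.
  rewrite -[LHS](@a0_per x (- m)) ?rpredN//; congr a0; ring.
rewrite -[LHS](@a0_per (- x) m)//; congr a0; ring.
Qed.

(** The energy of [competitor] is an integral of a function of the label. *)
Lemma min_energy_le :
  (min_energy (@double_well R) (layered a0) e <=
   \int[leb]_t (density a0 p dp t)%:E)%E.
Proof.
apply: ge_ereal_inf.
exists (energy (@double_well R) (layered a0) (sg *: delta_mx 0 ord0) U).
  by exists U => //; exact: competitor_admissible.
rewrite (energyE ma0 a0_ge0 (@measurable_competitor R n sg p dp pdp) (@competitor_is_De R n sg sg1 p dp pdp)).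
have mD : measurable_fun setT (fun t => (density a0 p dp t)%:E).
  have [pp _ _ _ _] := pdp; apply/measurable_EFinP; apply: measurable_density => //.
    by apply: continuous_measurable_fun; exact: primitive_continuous pp.
  exact: primitive_measurable pp.
have D0 t : (0 <= (density a0 p dp t)%:E)%E by rewrite lee_fin density_ge0.
rewrite -(@ge0_label_integral R n sg _ mD D0) le_eqVlt; apply/orP; left; apply/eqP.
apply: eq_integral => z _; rewrite /strip_density /density coefficient_label.
congr ((_ * (_ * _) + _)%:E); rewrite /dot big_ord_recl big1 => [|i _].
  by rewrite addr0 competitor_DeE eqxx mulr1 mulrACA sg1 mul1r.
by rewrite !competitor_DeE/= mulr0 mul0r.
Qed.

End competitor_energy.

(** * A cheap profile and the coefficient *)

Section clamp.
Context {R : realType}.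
Local Notation leb := (@lebesgue_measure R).
Variable al : R.
Local Notation core := (`[(- al)%R, al%R]%classic : set (measurableTypeR R)).
Hypothesis al0 : 0 < al.

Definition clamp (t : R) : R := Num.max (- 1) (Num.min 1 (al^-1 * t)).

Definition dclamp (t : R) : R := al^-1 * \1_core t.

Lemma clamp_le1 t : `|clamp t| <= 1.
Proof. by rewrite /clamp ler_norml le_max lexx/= ge_max ge_min lexx andbT (le_trans (lerN10 _) ler01). Qed.

Lemma clamp_right t : al <= t -> clamp t = 1.
Proof.
move=> alt; have h : 1 <= al^-1 * t by rewrite mulrC ler_pdivlMr// mul1r.
by rewrite /clamp min_l// max_r//; lra.
Qed.

Lemma clamp_left t : t <= - al -> clamp t = - 1.
Proof.
move=> alt; have h : al^-1 * t <= - 1 by rewrite mulrC ler_pdivrMr// mulN1r.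
by rewrite /clamp min_r ?max_l// (le_trans h)//; lra.
Qed.

Lemma clamp_mid t : - al <= t <= al -> clamp t = al^-1 * t.
Proof.
move=> /andP[h1 h2]; have k1 : al^-1 * t <= 1 by rewrite mulrC ler_pdivrMr// mul1r.
have k2 : - 1 <= al^-1 * t by rewrite mulrC ler_pdivlMr// mulN1r.
by rewrite /clamp min_r ?max_r.
Qed.

Lemma clamp_primitive : primitive clamp dclamp.
Proof.
have idc : leb.-integrable setT (EFin \o dclamp).
  rewrite (_ : EFin \o dclamp = fun t => (al^-1)%R%:E * (EFin \o \1_core) t)%E.
    by apply: integrableZl => //; exact: integrable_indic_itv.
  by apply/funext => t.
split=> [a b|s t st]; first by apply: integrableS idc.
rewrite /Rintegral /dclamp.
have -> : (\int[leb]_(r in `[s, t]) (al^-1 * \1_core r)%R%:E =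
    (al^-1)%R%:E * leb (`[s, t]%classic `&` core))%E.
  under eq_integral do rewrite EFinM.
  rewrite integralZl//; last by apply: integrableS (integrable_indic_itv _ _ _ _).
  by rewrite integral_indic// setIC.
have -> : `[s, t]%classic `&` core =
    `[Num.max s (- al), Num.min t al]%classic.
  apply/seteqP; split => r; rewrite /= !in_itv/= ge_max le_min.
    by move=> [/andP[-> ->] /andP[-> ->]].
  by move=> /andP[/andP[-> ->] /andP[-> ->]].
rewrite lebesgue_measure_itv/= lte_fin.
have cmp a b : - al <= a -> a <= b -> b <= al -> clamp b - clamp a = al^-1 * (b - a).
  by move=> h1 h2 h3; rewrite !clamp_mid ?mulrBr// ?h1 ?h3 ?(le_trans h1)// (le_trans h2).
have cm : al^-1 * (al - - al) = 2 :> R.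
  by rewrite opprK mulrDr mulVf ?gt_eqF.
have al2 : - al <= al by rewrite ge0_cp// ltW.
have [sl|sl] := leP s (- al); have [tl|tl] := leP t al.
- rewrite (clamp_left sl); have [lt|lt] := ltP (- al) t.
    by rewrite -(clamp_left (lexx _)) cmp// ?ltW// -EFinB -EFinM.
  by rewrite mule0 (clamp_left lt) subrr.
- rewrite (clamp_left sl) (clamp_right (ltW tl)) ifT; last by rewrite -subr_gt0 opprK addr_gt0.
  by rewrite -EFinB -EFinM /= cm opprK.
- have [lt|lt] := ltP s t.
    by rewrite cmp// ?ltW// -EFinB -EFinM.
  by rewrite mule0 (@le_anti _ _ s t) ?st// subrr.
- rewrite (clamp_right (ltW tl)); have [lt|lt] := ltP s al.
    by rewrite -(clamp_right (lexx _)) cmp// ?ltW// -EFinB -EFinM.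
  by rewrite mule0 (clamp_right lt) subrr.
Qed.

Lemma clamp_profile : profile clamp dclamp.
Proof.
split.
- exact: clamp_primitive.
- exact: clamp_le1.
- rewrite (_ : EFin \o _ = fun t => (al^-1 ^+ 2)%R%:E * (EFin \o \1_core) t)%E.
    by apply: integrableZl => //; exact: integrable_indic_itv.
  apply/funext => t; rewrite /= /dclamp exprMn -EFinM; congr (_ * _)%:E.
  by rewrite indicE; case: (_ \in _); rewrite ?expr1n ?expr0n.
- move=> eta e0; exists al => t alt; rewrite clamp_right ?subrr ?normr0 ltW//.
- move=> eta e0; exists al => t alt; rewrite clamp_left ?addNr ?normr0 ltW//.
Qed.

(** On the core the kinetic part is at most [1/2] and the potential at most [1/4]; outside, the function sits in a well. *)
Lemma clamp_energy (a0 : R -> R) : measurable_fun setT a0 -> (forall t, 0 <= a0 t) ->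
  (forall t, - al <= t <= al -> a0 t <= al ^+ 2) ->
  (\int[leb]_t (density a0 clamp dclamp t)%:E <= (3 / 2 * al)%:E)%E.
Proof.
move=> ma0 a00 a0al.
apply: (@le_trans _ _ (\int[leb]_t ((3 / 4)%R%:E * (\1_core t)%:E))%E).
  have pp := clamp_primitive.
  have mcl : measurable_fun setT clamp.
    by apply: continuous_measurable_fun; exact: primitive_continuous pp.
  apply: ge0_le_integral => //.
  - by move=> t _; rewrite lee_fin density_ge0.
  - apply/measurable_EFinP; apply: measurable_density => //.
    exact: primitive_measurable pp.
  - apply/measurable_EFinP; apply: measurable_funM; first exact: measurable_cst.
    exact: measurable_indic.
  move=> t _; rewrite -EFinM lee_fin /density /dclamp indicE.
  have [tal|tal] := boolP (t \in core).
    rewrite !mulr1; move: tal; rewrite inE/= in_itv/= => tal.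
    have w : double_well (clamp t) <= 4^-1.
      rewrite /double_well ler_piMr// expr_le1// ?subr_ge0 ?lerBlDr ?lerDl ?sqr_ge0//.
      by rewrite -real_normK ?num_real// expr_le1// clamp_le1.
    have k : a0 t * al^-1 ^+ 2 <= 1.
      by rewrite exprVn ler_pdivrMr ?exprn_gt0// mul1r a0al.
    by lra.
  rewrite !mulr0 expr0n/= !mulr0 add0r.
  have -> : double_well (clamp t) = 0; last by [].
  move: tal; rewrite notin_setE/= in_itv/= => /negP; rewrite negb_and -!ltNge.
  case/orP => /ltW tal; first by rewrite clamp_left// /double_well sqrrN expr1n subrr expr0n mulr0.
  by rewrite clamp_right// /double_well expr1n subrr expr0n mulr0.
rewrite integralZl//; last exact: integrable_indic_itv.
rewrite integral_indic// setIT [X in (_ * X)%E](lebesgue_measure_itv `[(- al)%R, al%R])/= lte_fin ifT; last by rewrite -subr_gt0 opprK addr_gt0.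
by rewrite -EFinB -EFinM lee_fin; lra.
Qed.

End clamp.

Section coefficient.
Context {R : realType}.

(** Any width below [1/96] makes [3/2 * core_width], the cost of a transition in the trough, smaller than [1/64], the cost of a transition near one half. *)
Definition core_width : R := 128^-1.

Definition coefficient (t : R) : R := core_width ^+ 2 / 2 + sin (pi * t) ^+ 2 / 32.

Lemma coefficient_arc t : coefficient t = core_width ^+ 2 / 2 - arc 0 0 t / 32.
Proof. by rewrite /coefficient /arc subr0 sub0r mulrN sinN mulrN mulNr opprK. Qed.

Lemma coefficient_ge t : core_width ^+ 2 / 2 <= coefficient t.
Proof. by rewrite lerDl; apply: mulr_ge0 => //; exact: sqr_ge0. Qed.

Lemma core_width_gt0 : 0 < core_width.
Proof. by rewrite /core_width. Qed.

Lemma coefficient_gt0 t : 0 < coefficient t.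
Proof.
apply: lt_le_trans (coefficient_ge t); apply: mulr_gt0 => //.
by apply: exprn_gt0; exact: core_width_gt0.
Qed.

Lemma coefficient_ge0 t : 0 <= coefficient t.
Proof. exact: ltW (coefficient_gt0 t). Qed.

Lemma coefficient_le1 t : coefficient t <= 1.
Proof.
have : sin (pi * t) ^+ 2 <= 1 by rewrite -real_normK ?num_real// expr_le1// sin_max.
by rewrite /coefficient /core_width; lra.
Qed.

Lemma coefficient_even t : coefficient (- t) = coefficient t.
Proof. by rewrite /coefficient mulrN sinN sqrrN. Qed.

Lemma coefficient_periodic t z : z \is a Num.int -> coefficient (t + z) = coefficient t.
Proof. by move=> zZ; rewrite !coefficient_arc arc_periodic. Qed.

Lemma sin_le_norm (x : R) : `|sin x| <= `|x|.
Proof.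
wlog x0 : x / 0 <= x.
  move=> H; have [|/ltW x0] := leP 0 x; first exact: H.
  by rewrite -normrN -sinN -(normrN x) H// oppr_ge0.
have [|c _] := @MVT_segment R (@sin R) (@cos R) 0 x x0 (fun s _ => @is_derive_sin R s).
  by apply: continuous_subspaceT => s; exact: continuous_sin.
rewrite sin0 !subr0 => ->; rewrite normrM ler_piMl//; exact: cos_max.
Qed.

(** Uses [`|sin x| <= `|x|] and [pi <= 4]. *)
Lemma coefficient_core t : - core_width <= t <= core_width -> coefficient t <= core_width ^+ 2.
Proof.
move=> tw; have : `|sin (pi * t)| ^+ 2 <= (4 * core_width) ^+ 2.
  rewrite lerXn2r ?nnegrE ?mulr_ge0// ?(ltW core_width_gt0)//.
  apply: (le_trans (sin_le_norm _)); rewrite normrM; apply: ler_pM => //.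
    rewrite ger0_norm ?pi_ge0//; have := @pihalf_lt2 R; lra.
  by rewrite ler_norml.
by rewrite real_normK ?num_real// exprMn /coefficient; lra.
Qed.

Lemma coefficient_mid t : 1 / 4 <= t <= 3 / 4 -> 1 / 64 <= coefficient t.
Proof.
move=> /andP[t1 t2].
have p0 := @pi_gt0 R.
have : 0 <= cos (pi * t *+ 2 - pi).
  apply: cos_ge0_pihalf; have h1 := ler_wpM2l (ltW p0) t1; have h2 := ler_wpM2l (ltW p0) t2.
  move: h1 h2; rewrite -mulr_natr; set y := pi * t; set q : R := pi => h1 h2.
  by apply/andP; split; lra.
have -> : cos (pi * t *+ 2 - pi) = - cos (pi * t *+ 2) by rewrite -[X in - cos X](subrK pi) cosDpi opprK.
rewrite cos_mulr2n cos2sin2 => h.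
have := @core_width_gt0; rewrite /coefficient => w0.
have : 0 <= core_width ^+ 2 by exact: sqr_ge0.
move: h; rewrite mulr2n; set x := sin _ ^+ 2; lra.
Qed.

Lemma elementary_coefficient (V : normedModType R) (u : V -> R) :
  elementary u -> elementary (fun z => coefficient (u z)).
Proof.
move=> eu; pose s z := sin (pi * u z).
have es : elementary s.
  by apply: elementary_sin; apply: elementaryM => //; exact: (elementary_cst pi).
apply: (elementaryD (elementary_cst (core_width ^+ 2 / 2))).
apply: (@elementaryM _ _ (fun z => s z ^+ 2) (cst 32^-1)); last exact: elementary_cst.
exact: (elementaryM es es).
Qed.

Lemma measurable_coefficient : measurable_fun setT coefficient.
Proof.
apply: continuous_measurable_fun.
have : elementary (fun t : R => coefficient t).
  by apply: elementary_coefficient; apply: elementary_linear => // z.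
by move=> /elementary_smooth /(_ 0%N).
Qed.

(** A line that starts close to [1/2] stays in the middle half of the period for a time [1/5], whatever its direction. *)
Lemma coefficient_exit (sg x c t : R) : sg * sg = 1 -> 49 / 100 < x < 51 / 100 ->
  0 <= c <= 1 / 100 -> 0 <= t <= 1 / 5 -> 1 / 64 <= coefficient (x + c + sg * t).
Proof.
move=> /sign_cases sgs /andP[x0 x1] /andP[c0 c1] /andP[t0 t1]; apply: coefficient_mid.
by case: sgs => ->; rewrite ?mul1r ?mulN1r; apply/andP; split; lra.
Qed.

End coefficient.

(** * Restriction of weak derivatives to lines *)

Section restriction_to_lines.
Context {R : realType} {n : nat}.
Local Notation mR := (measurableTypeR R).
Local Notation RxT := (R * 'rV[R]_n.+1)%type.
Local Notation mRxT := (mR * 'rV[mR]_n.+1)%type.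
Local Notation leb := (@lebesgue_measure R).
Local Notation nu := (torus_measure R n.+1).
Local Notation mu := (strip_measure R n.+1).
Variable sg : R.

Lemma shearK (z : RxT) : shear (- sg) (shear sg z) = z.
Proof. by case: z => s y; rewrite /shear /slide/= mulNr scaleNr addrK. Qed.

Lemma line_integrable (F : RxT -> \bar R) : on_torus F ->
    mu.-integrable setT (F : mRxT -> _) ->
  {ae nu, forall y, leb.-integrable setT (fun s => F (shear sg (s, y)))}.
Proof. by move=> perF iF; apply: (ae_integrable2 (slide_integrable ord0 (measurable_mulrl sg) perF iF)). Qed.

Lemma measurable_line_integral (K : RxT -> \bar R) : measurable_fun setT (K : mRxT -> _) ->
    (forall z, (0 <= K z)%E) ->
  measurable_fun setT (fun y : 'rV[mR]_n.+1 => \int[leb]_s K (shear sg (s, y)))%E.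
Proof.
move=> mK K0; apply: (measurable_fun_fubini_tonelli_G (K \o shear sg : mRxT -> _)).
  exact: (measurableT_comp mK (measurable_shear sg)).
by move=> z; exact: K0.
Qed.

(** Fubini's theorem applied to [`|F|]. *)
Lemma ae_line (F : RxT -> R) : measurable_fun setT (F : mRxT -> R) -> on_torus F ->
    {ae mu, forall z, F z = 0} ->
  {ae nu, forall y, {ae leb, forall s, F (shear sg (s, y)) = 0}}.
Proof.
move=> mF perF F0; pose K z := `|(F z)%:E|%E.
have mK : measurable_fun setT (K : mRxT -> _) by apply: measurableT_comp => //; exact/measurable_EFinP.
have K0 z : (0 <= K z)%E by exact: abse_ge0.
have perK : on_torus K by move=> s x y yZ; rewrite /K perF.
have E : (\int[nu]_y \int[leb]_s K (shear sg (s, y)) = 0)%E.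
  rewrite -(ge0_line_fubini sg mK K0 perK).
  apply/(ae_eq_integral_abs mu measurableT _).2; first exact/measurable_EFinP.
  by move: F0; apply: ae_imply => z -> _.
have G0 y : (0 <= \int[leb]_s K (shear sg (s, y)))%E by apply: integral_ge0 => s _.
have : ae_eq nu setT (fun y => \int[leb]_s K (shear sg (s, y)))%E (cst 0%E).
  apply/ae_eq_integral_abs => //.
    exact: measurable_line_integral.
  by rewrite -[RHS]E; apply: eq_integral => y _; rewrite gee0_abs.
apply: ae_imply => y /(_ I) Ey.
have : ae_eq leb setT (fun s => (F (shear sg (s, y)))%:E) (cst 0%E).
  apply/ae_eq_integral_abs => //; apply/measurable_EFinP.
  exact: (measurableT_comp (measurableT_comp mF (measurable_shear sg)) (pair2_measurable y)).
by apply: ae_imply => s /(_ I) [].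
Qed.

(** The integrals over the lines define an integrable function on the torus, which is orthogonal to all the bumps [theta]. *)
Lemma line_null (F : RxT -> R) : on_torus F ->
    mu.-integrable setT (EFin \o F : mRxT -> _) ->
    (forall al be k, \int[mu]_z (F z * theta al be k (shear (- sg) z).2) = 0) ->
  {ae nu, forall y, \int[leb]_s F (shear sg (s, y)) = 0}.
Proof.
move=> perF iF Fnull; pose Fs := F \o shear sg.
have perEF : on_torus (EFin \o F) by move=> s x y yZ /=; rewrite perF.
have iFs : mu.-integrable setT (EFin \o Fs : mRxT -> _).
  exact: (slide_integrable ord0 (measurable_mulrl sg) perEF iF).
have mFs : measurable_fun setT (Fs : mRxT -> R).
  by apply/measurable_EFinP; exact: measurable_int iFs.
have mA : measurable_fun setT (fun y : 'rV[mR]_n.+1 => \int[leb]_s F (shear sg (s, y))).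
  by apply: (measurableT_comp (fine_measurable measurableT)); exact: (measurable_fubini_G iFs).
apply: torus_fundamental.
  have [_ iH] := integrableP _ _ _ iFs.
  have mabs : measurable_fun setT (abse \o (EFin \o Fs) : mRxT -> _).
    by apply: measurableT_comp => //; exact/measurable_EFinP.
  apply/integrableP; split; first exact/measurable_EFinP.
  have abs0 z : (0 <= (abse \o (EFin \o Fs)) z)%E by exact: abse_ge0.
  have iH2 := fubini_tonelli2 (abse \o (EFin \o Fs) : mRxT -> _) mabs abs0.
  apply: le_lt_trans iH; rewrite [leRHS]iH2; apply: ge0_le_integral => //.
  - by apply: measurableT_comp => //; exact/measurable_EFinP.
  - exact: (measurable_fun_fubini_tonelli_G (abse \o (EFin \o Fs) : mRxT -> _)).
  move=> y _; have mFy : measurable_fun setT (fun s : mR => (Fs (s, y))%:E).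
    by apply/measurable_EFinP; exact: (measurableT_comp mFs (pair2_measurable y)).
  apply: le_trans (le_abse_integral leb measurableT mFy).
  rewrite /= /Rintegral -[X in (_ <= `|X|)%E]/(\int[leb]_s (F (shear sg (s, y)))%:E)%E.
  by case: (\int[leb]_s _)%E => [r||] /=; rewrite ?normr0 ?leey.
move=> al be k _ _ _; pose f (z : mRxT) := (Fs z * theta al be k z.2)%:E.
have mth := @measurable_theta R n.+1 al be k.
have if_ : mu.-integrable setT f.
  apply: le_integrable iFs => //.
    apply/measurable_EFinP; apply: measurable_funM => //.
    exact: (measurableT_comp mth measurable_snd).
  move=> z _; rewrite /= lee_fin normrM ler_piMr// ger0_norm ?theta_ge0//.
  exact: theta_le1.
pose f0 z : \bar R := (F z * theta al be k (shear (- sg) z).2)%:E.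
have fE z : f z = f0 (shear sg z) by rewrite /f /f0 shearK.
have mf0 : measurable_fun setT (f0 : mRxT -> _).
  apply/measurable_EFinP; apply: measurable_funM.
    by apply/measurable_EFinP; exact: measurable_int iF.
  apply: (measurableT_comp mth); apply: (measurableT_comp measurable_snd).
  exact: measurable_shear.
have perf0 : on_torus f0.
  move=> s x y yZ; rewrite /f0 perF//; congr (_ * _)%:E.
  by rewrite /shear /slide/= addrAC; exact: theta_periodic.
have E0 : (\int[nu]_y \int[leb]_s f (s, y) = 0)%E.
  rewrite (integral21_prod_meas1 if_) (_ : (fun z => f z) = f0 \o shear sg); last exact/funext.
  rewrite (slide_integral ord0 (measurable_mulrl sg))// -[LHS]fineK.
    by rewrite [fine _]Fnull.
  rewrite -(slide_integral ord0 (measurable_mulrl sg))//.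
  rewrite (_ : (fun z => _) = f); last by apply/funext => z; rewrite fE.
  exact: integrable_fin_num.
rewrite /Rintegral -[RHS]/(fine 0%E) -[in RHS]E0; congr fine.
apply: ae_eq_integral => //.
- by apply/measurable_EFinP; exact: measurable_funM.
- exact: (measurable_fubini_G if_).
have := line_integrable perEF iF; apply: ae_imply => y iy _.
rewrite /f/=; under [RHS]eq_integral do rewrite EFinM.
rewrite integralZr// EFinM /Rintegral fineK//; exact: integrable_fin_num.
Qed.

(** A plateau in the parameter times a function that is constant along the lines: the derivative along the lines only sees the plateau. *)
Definition line_test (q1 q2 : R) j al be k (z : RxT) : R :=
  plateau q1 q2 j z.1 * theta al be k (shear (- sg) z).2.

Lemma elementary_line_test q1 q2 j al be k : elementary (line_test q1 q2 j al be k).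
Proof.
apply: elementaryM; first exact: elementary_plateau elementary_fst.
rewrite (_ : (fun z => _) = fun z : RxT => theta al be k
   (\row_i (z.2 ord0 i + (- sg * (i == ord0)%:R) * z.1))); last first.
  apply/funext => z; congr theta; apply/rowP => i; rewrite !mxE eqxx/=; ring.
apply: elementary_theta => i; apply: elementaryD; first exact: elementary_snd.
by apply: elementaryM; [exact: elementary_cst|exact: elementary_fst].
Qed.

Lemma line_test_test q1 q2 j al be k : test_function (line_test q1 q2 j al be k).
Proof.
split.
- exact: elementary_smooth (elementary_line_test _ _ _ _ _ _).
- move=> s x y yZ; rewrite /line_test /shear /slide/= addrAC; congr (_ * _).
  exact: theta_periodic.
- exists (`|q1| + `|q2| + 1) => z /negP; rewrite -ltNge => zM.
  by rewrite /line_test plateau_out// mul0r.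
Qed.

Lemma derive_line_test q1 q2 j al be k (z : RxT) :
  'D_((1, sg *: delta_mx 0 ord0) : RxT) (line_test q1 q2 j al be k) z =
  dplateau q1 q2 j z.1 * theta al be k (shear (- sg) z).2.
Proof.
set v : RxT := (1, _); set phi := line_test _ _ _ _ _ _.
have dphi x : differentiable phi x.
  exact: elementary_differentiable (elementary_line_test _ _ _ _ _ _).
have := @is_derive_line R _ phi z v 0; rewrite scale0r addr0 => /(_ (dphi _)) [_ <-].
have -> : (fun s : R => phi (z + s *: v)) =
    fun s => theta al be k (shear (- sg) z).2 *: plateau q1 q2 j (z.1 + s).
  apply/funext => s; rewrite /phi /line_test /v mulrC; congr (theta al be k _ * plateau q1 q2 j _).
    rewrite /shear /slide/= [s *: 1]mulr1; apply/rowP => i; rewrite !mxE eqxx/=; ring.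
  by rewrite /= [s *: 1]mulr1.
have dp : is_derive (0 : R) (1 : R) (fun s => plateau q1 q2 j (z.1 + s)) (dplateau q1 q2 j z.1).
  have dl : is_derive (0 : R) (1 : R) (fun s : R => z.1 + s) (0 + 1) by exact: is_deriveD.
  have := @is_derive1_comp _ (plateau q1 q2 j) (fun s : R => z.1 + s) 0 _ _
    (is_derive_plateau q1 q2 j (z.1 + 0)) dl.
  by rewrite add0r mulr1 addr0.
set c := theta _ _ _ _.
have : is_derive (0 : R) (1 : R) (fun s : R => c *: plateau q1 q2 j (z.1 + s))
  (c *: dplateau q1 q2 j z.1) by exact: is_deriveZ.
by move=> [_ ->]; rewrite mulrC.
Qed.

End restriction_to_lines.

Lemma ae_forall_countable d (T : measurableType d) (R : realType)
    (mu : {measure set T -> \bar R}) (I : countType) (P : I -> T -> Prop) :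
  (forall i, {ae mu, forall x, P i x}) -> {ae mu, forall x, forall i, P i x}.
Proof.
move=> aeP; have : {ae mu, forall x, forall k, forall i, unpickle k = Some i -> P i x}.
  apply: ae_foralln => k; case E: (unpickle k) => [i|].
    by apply: ae_imply (aeP i) => x Pix _ [<-].
  by apply: aeW => x.
by apply: ae_imply => x H i; exact: (H (pickle i) _ (pickleK i)).
Qed.

Lemma continuous_ae_zero (R : realType) (f : R -> R) : continuous f ->
  {ae (@lebesgue_measure R), forall t, f t = 0} -> forall t, f t = 0.
Proof.
move=> cf aef t; apply/eqP; apply: contrapT => /negP ft0.
have : \forall s \near t, f s != 0 by exact: (cvgr_neq0 _ (cf t)).
move=> /nbhs_ballP[e /= e0 te].
have : (@lebesgue_measure R).-negligible (ball t e).
  by apply: negligibleS aef => s /te /= /eqP.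
move=> nb; have /eqP : (@lebesgue_measure R) (ball t e) = 0%E.
  by apply/negligibleP => //; exact: measurable_ball.
by rewrite [X in X == _](lebesgue_measure_ball _ (ltW e0)) eqe mulrn_eq0/= gt_eqF.
Qed.

Section minimizer_lines.
Context {R : realType} {n : nat}.
Local Notation mR := (measurableTypeR R).
Local Notation RxT := (R * 'rV[R]_n.+1)%type.
Local Notation mRxT := (mR * 'rV[mR]_n.+1)%type.
Local Notation leb := (@lebesgue_measure R).
Local Notation nu := (torus_measure R n.+1).
Local Notation mu := (strip_measure R n.+1).
Variable sg : R.
Hypothesis sg1 : sg * sg = 1.
Local Notation e := ((sg *: delta_mx 0 ord0)%R : 'rV[R]_n.+1).

Variables (g : RxT -> R) (V : RxT -> 'rV[R]_n.+1).
Hypothesis cg : continuous g.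
Hypothesis perg : on_torus g.
Hypothesis gV : is_De e g V.
Let v z := V z ord0 ord0.

Let mg : measurable_fun setT (g : mRxT -> R).
Proof. exact: continuous_measurable_strip. Qed.

Let mv : measurable_fun setT (v : mRxT -> R).
Proof. by have [_ _ V2 _] := gV; exact: Lfun_measurable (V2 ord0). Qed.

Let perv : on_torus v.
Proof. by have [_ perV _ _] := gV; move=> s x y yZ; rewrite /v perV. Qed.

Lemma continuous_line (y : 'rV[R]_n.+1) : continuous (fun s : R => g (shear sg (s, y))).
Proof.
move=> s; apply: (@continuous_comp _ _ _ (fun s : R => shear sg (s, y)) g); last exact: cg.
rewrite (_ : (fun s : R => shear sg (s, y)) = fun s => (0, y) + s *: ((1, sg *: delta_mx 0 ord0) : RxT)).
  by apply: cvgD; [exact: cvg_cst|apply: cvgZl; exact: cvg_id].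
apply/funext => r; rewrite /shear /slide; congr pair; rewrite /= ?add0r ?[r *: 1]mulr1//.
by rewrite scalerA mulrC.
Qed.

Let line_locally_integrable : {ae nu, forall y, forall a b,
  leb.-integrable `[a, b]%classic (EFin \o (fun s => v (shear sg (s, y))))}.
Proof.
pose F (N : nat) z := ((EFin \o v) \_ (slab N%:R)) z.
have iF N : mu.-integrable setT (F N : mRxT -> _).
  apply/integrable_restrict => //; first exact: measurable_slab.
  by rewrite setTI; have [_ _ V2 _] := gV; exact: (Lfun2_slab N%:R (V2 ord0)).
have perF N : on_torus (F N).
  by move=> s x y yZ; rewrite /F !patchE /= perv.
have : {ae nu, forall y, forall N, leb.-integrable setT (fun s => F N (shear sg (s, y)))}.
  by apply: ae_foralln => N; exact: line_integrable.
apply: ae_imply => y iy a b.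
pose N := (Num.truncn (`|a| + `|b|)).+1.
have : leb.-integrable `[- N%:R, N%:R]%classic (EFin \o (fun s => v (shear sg (s, y)))).
  have := iy N; rewrite (_ : (fun s => _) = ((EFin \o (fun s => v (shear sg (s, y)))) \_ `[- N%:R, N%:R]%classic)).
    by move=> /integrable_restrict; rewrite setTI; apply.
  apply/funext => s; rewrite /F !patchE; congr (if _ then _ else _).
  by apply/idP/idP; rewrite !inE/= /slab/= in_itv/= ler_norml.
apply: integrableS => //; have abN : `|a| + `|b| < N%:R by exact: truncnS_gt.
have a0 := normr_ge0 a; have b0 := normr_ge0 b.
have a1 : - `|a| <= a by rewrite -lerN2 opprK -normrN ler_norm.
have b1 := ler_norm b.
move=> s; rewrite /= !in_itv/= => /andP[h1 h2]; apply/andP; split; lra.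
Qed.

Let strip_function (f : R -> R) M : continuous f -> (forall t, M < `|t| -> f t = 0) ->
  compactly_supported (fun z : RxT => f z.1).
Proof.
move=> cf f0; split => //.
- by move=> z; apply: (@continuous_comp _ _ _ fst f); [exact: cvg_fst|exact: cf].
- by exists M => z /negP; rewrite -ltNge => /f0.
Qed.

Let plateau_line (q1 q2 : R) j : {ae nu, forall y,
  \int[leb]_s (sg * (g (shear sg (s, y)) * dplateau q1 q2 j s) +
               v (shear sg (s, y)) * plateau q1 q2 j s) = 0}.
Proof.
pose F z := sg * (g z * dplateau q1 q2 j z.1) + v z * plateau q1 q2 j z.1.
have csp : compactly_supported (fun z : RxT => plateau q1 q2 j z.1).
  apply: (@strip_function _ (`|q1| + `|q2| + 1)); last exact: plateau_out.
  move=> t; apply: differentiable_continuous; apply/derivable1_diffP.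
  by have [] := is_derive_plateau q1 q2 j t.
have csd : compactly_supported (fun z : RxT => dplateau q1 q2 j z.1).
  apply: (@strip_function _ (`|q1| + `|q2| + 1)); first exact: continuous_dplateau.
  exact: derive_eq0_out (is_derive_plateau q1 q2 j) (@plateau_out _ _ _ _).
have [ig _ V2 testV] := gV.
have iv M := Lfun2_slab M (V2 ord0).
have igd := compactly_supported_integrable mg ig csd.
have ivp := compactly_supported_integrable mv iv csp.
apply: (@line_null R n sg F).
- by move=> s x y yZ; rewrite /F perg// perv.
- rewrite (_ : EFin \o F = (fun z => sg%:E * (g z * dplateau q1 q2 j z.1)%:E +
    (v z * plateau q1 q2 j z.1)%:E)%E); last exact/funext.
  by apply: integrableD => //; exact: integrableZl.
move=> al be k; have tt := @line_test_test R n sg q1 q2 j al be k.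
have cst_ := test_compactly_supported tt.
have csD := derive_compactly_supported ((sg, delta_mx 0 ord0) : RxT) tt.
have diff z : differentiable (line_test sg q1 q2 j al be k) z.
  exact: elementary_differentiable (elementary_line_test _ _ _ _ _ _ _).
have := testV _ tt ord0; rewrite /De_smooth !mxE eqxx/= mulr1 => testE.
have i1 := compactly_supported_integrable mg ig csD.
have i2 := compactly_supported_integrable mv iv cst_.
transitivity (\int[mu]_z (g z * 'D_((sg, delta_mx 0 ord0) : RxT) (line_test sg q1 q2 j al be k) z +
    V z ord0 ord0 * line_test sg q1 q2 j al be k z)); last first.
  by rewrite RintegralD// testE addNr.
apply: eq_Rintegral => z _; rewrite derive_oblique// derive_line_test /F /line_test; rewrite /v; ring.
Qed.

(** For each pair of rational end points, testing the weak derivative with [line_test] gives an identity on almost every line; countably many identities hold together. *)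
Lemma lines_primitive : {ae nu, forall y,
  primitive (fun s => g (shear sg (s, y))) (fun s => sg * v (shear sg (s, y)))}.
Proof.
have H : {ae nu, forall y, forall q : rat * rat * nat,
   \int[leb]_s (sg * (g (shear sg (s, y)) * dplateau (ratr q.1.1) (ratr q.1.2) q.2 s) +
               v (shear sg (s, y)) * plateau (ratr q.1.1) (ratr q.1.2) q.2 s) = 0}.
  by apply: ae_forall_countable => q; exact: plateau_line.
apply: ae_imply2 line_locally_integrable H => y iy Hy.
have isv a b : leb.-integrable `[a, b]%classic (EFin \o (fun s => sg * v (shear sg (s, y)))).
  rewrite (_ : EFin \o _ = fun s => sg%:E * (v (shear sg (s, y)))%:E)%E; last exact/funext.
  by apply: integrableZl => //; exact: iy.
apply: primitive_of_plateaus => //; first exact: continuous_line.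
move=> q1 q2 k.
have := Hy (q1, q2, k); rewrite /=.
set dP := dplateau _ _ _; set P := plateau _ _ _; set u := fun s => g (shear sg (s, y)).
set w := fun s => v (shear sg (s, y)).
have P0 t : `|ratr q1 : R| + `|ratr q2| + 1 < `|t| -> P t = 0 by exact: plateau_out.
have dP0 := derive_eq0_out (is_derive_plateau (ratr q1) (ratr q2) k) P0.
have cP : continuous P.
  move=> t; apply: differentiable_continuous; apply/derivable1_diffP.
  by have [] := is_derive_plateau (ratr q1) (ratr q2) k t.
have mw : measurable_fun setT w.
  exact: (measurableT_comp (measurableT_comp mv (measurable_shear sg)) (pair2_measurable y)).
have iu : leb.-integrable setT (fun s => (u s * dP s)%:E).
  apply: (@integrable_compact_support _ (fun s => u s * dP s)) => [t|t /dP0]; last first.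
    by rewrite /dP => ->; rewrite mulr0.
  by apply: cvgM; [exact: continuous_line|exact: continuous_dplateau].
have iw : leb.-integrable setT (fun s => (w s * P s)%:E).
  exact: (integrable_mul_compact mw iy cP P0).
have isu : leb.-integrable setT (fun s => (sg * (u s * dP s))%:E).
  by rewrite (_ : (fun s => _) = fun s => sg%:E * (u s * dP s)%:E)%E; [exact: integrableZl|exact/funext].
rewrite (RintegralD _ isu iw)// RintegralZl// => E.
have -> : \int[leb]_s (sg * w s * P s) = sg * \int[leb]_s (w s * P s).
  by rewrite -RintegralZl//; apply: eq_Rintegral => s _; rewrite mulrA.
rewrite -[LHS]mul1r -sg1 -mulrA -mulrN; congr (_ * _).
by apply/eqP; rewrite -addr_eq0; apply/eqP.
Qed.

End minimizer_lines.

(** * Ends of the cylinder *)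

Section continuous_representative.
Context {R : realType} {d : nat}.
Local Notation mR := (measurableTypeR R).
Local Notation RxT := (R * 'rV[R]_d)%type.
Local Notation mRxT := (mR * 'rV[mR]_d)%type.
Local Notation leb := (@lebesgue_measure R).
Local Notation mu := (strip_measure R d).
Variables U g : RxT -> R.
Hypothesis mU : measurable_fun setT (U : mRxT -> R).
Hypothesis mg : measurable_fun setT (g : mRxT -> R).
Hypothesis Ug : {ae mu, forall z, U z = g z}.

Lemma is_De_ae e V : is_De e U V -> is_De e g V.
Proof.
move=> [iU perV V2 testV]; split=> //.
  move=> M; have mM := @measurable_slab R d M.
  have /integrableP[_ iUM] := iU M; apply/integrableP; split.
    by apply/measurable_EFinP; exact: measurable_funTS.
  apply: le_lt_trans iUM; rewrite le_eqVlt; apply/orP; left; apply/eqP.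
  apply: ae_eq_integral => //.
  - by apply: measurableT_comp => //; apply/measurable_EFinP; exact: measurable_funTS.
  - by apply: measurableT_comp => //; apply/measurable_EFinP; exact: measurable_funTS.
  - by move: Ug; apply: ae_imply => z /= ->.
move=> phi tphi i; rewrite -testV//.
have csD : compactly_supported (De_smooth e i phi) by exact: derive_compactly_supported.
have mD : measurable_fun setT (De_smooth e i phi : mRxT -> R).
  by apply: continuous_measurable_strip; have [] := csD.
rewrite /Rintegral; congr fine; apply: ae_eq_integral => //.
- by apply/measurable_EFinP; exact: measurable_funM.
- by apply/measurable_EFinP; exact: measurable_funM.
- by move: Ug; apply: ae_imply => z ->.
Qed.

Lemma ge0_strip_translate (s : R) (F : RxT -> \bar R) : measurable_fun setT (F : mRxT -> _) ->
  (forall z, (0 <= F z)%E) ->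
  (\int[mu]_z F ((z.1 + s)%R, z.2) = \int[mu]_z F z)%E.
Proof.
move=> mF F0; have mtr : measurable_fun setT ((fun z => (z.1 + s, z.2)) : mRxT -> mRxT).
  apply: measurable_fun_pair; last exact: measurable_snd.
  by apply: measurable_funD; [exact: measurable_fst|exact: measurable_cst].
pose Fs : mRxT -> \bar R := F \o (fun z => (z.1 + s, z.2)).
have mFs : measurable_fun setT Fs by exact: (measurableT_comp mF mtr).
have Fs0 z : (0 <= Fs z)%E by exact: F0.
transitivity (\int[torus_measure R d]_y \int[leb]_t Fs (t, y))%E.
  exact: (fubini_tonelli2 Fs mFs Fs0).
rewrite [RHS](fubini_tonelli2 (F : mRxT -> _) mF F0); apply: eq_integral => y _.
apply: (ge0_integral_translate s (f := fun t => F (t, y))) => //.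
exact: (measurableT_comp mF (pair2_measurable y)).
Qed.

Definition window (a : R) : set RxT := [set z | `|z.1 - a| <= 1].

Lemma measurable_window a : measurable (window a : set mRxT).
Proof.
have -> : (window a : set mRxT) = `[a - 1, a + 1]%classic `*` setT.
  by apply/seteqP; split => z; rewrite /window/= in_itv/= ler_distl; [|case].
exact: measurableX.
Qed.

Definition window_gap (c a : R) (z : RxT) : \bar R :=
  ((fun z => `|g z - c|%:E) \_ (window a)) z.

Lemma measurable_window_gap c a : measurable_fun setT (window_gap c a : mRxT -> _).
Proof.
have mgc : measurable_fun (window a : set mRxT) ((fun z => `|g z - c|%:E) : mRxT -> _).
  apply: measurable_funTS; apply/measurable_EFinP; apply: measurableT_comp => //.
  exact: measurable_funB.
exact: ((measurable_restrictT _ (measurable_window a)).1 mgc).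
Qed.

Lemma window_gap_ge0 c a z : (0 <= window_gap c a z)%E.
Proof. by rewrite /window_gap patchE; case: ifP. Qed.

Lemma window_gap_integral c a :
  (\int[mu]_(z in slab 1) `|U ((z.1 + a)%R, z.2) - c|%:E = \int[mu]_z window_gap c a z)%E.
Proof.
pose K (z : RxT) : \bar R := ((fun z => `|U z - c|%:E) \_ (window a)) z.
have mK : measurable_fun setT (K : mRxT -> _).
  have mUc : measurable_fun (window a : set mRxT) ((fun z => `|U z - c|%:E) : mRxT -> _).
    apply: measurable_funTS; apply/measurable_EFinP; apply: measurableT_comp => //.
    exact: measurable_funB.
  exact: ((measurable_restrictT _ (measurable_window a)).1 mUc).
have K0 z : (0 <= K z)%E by rewrite /K patchE; case: ifP.
transitivity (\int[mu]_z K ((z.1 + a)%R, z.2))%E.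
  rewrite integral_mkcond; apply: eq_integral => z _; rewrite /K !patchE.
  congr (if _ then _ else _); apply/idP/idP; rewrite !inE /slab /window/= addrK//.
rewrite ge0_strip_translate//; apply: ae_eq_integral => //.
  exact: measurable_window_gap.
by move: Ug; apply: ae_imply => z E _; rewrite /K /window_gap !patchE E.
Qed.

(** Convergence in mean on the slab of half-width 1, transported to the window by translation. *)
Lemma window_gap_small (sigma T eps : R) : admissible U -> sigma = 1 \/ sigma = - 1 -> 0 < eps ->
  exists2 a, T + 1 < sigma * a & (\int[mu]_z window_gap sigma a z <= eps%:E)%E.
Proof.
move=> [_ _ _ cvR cvL] sigmaE e0.
have near_le (F : set_system R) (FF : ProperFilter F) c (P : set R) :
    (\int[mu]_(z in slab 1) `|U ((z.1 + s)%R, z.2) - c|%:E)%E @[s --> F] --> 0%E -> F P ->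
    exists2 a, P a & (\int[mu]_z window_gap c a z <= eps%:E)%E.
  move=> /fine_cvgP[ffin /cvgr0Pnorm_le /(_ _ e0) fle] FP.
  have [a [[Pa fa] la]] := @filter_ex _ F FF _ (@filterI _ F _ _ _ (@filterI _ F _ _ _ FP ffin) fle).
  exists a => //; rewrite -window_gap_integral -(fineK fa) lee_fin.
  exact: le_trans (ler_norm _) la.
case: sigmaE => ->.
  have [a Pa ea] := near_le _ _ 1 [set a | T + 1 < a] (cvR 1) (nbhs_pinfty_gt (num_real _)).
  by exists a => //; rewrite mul1r.
have cvL' : (\int[mu]_(z in slab 1) `|U ((z.1 + s)%R, z.2) - (- 1)|%:E)%E @[s --> -oo] --> 0%E.
  by under eq_fun do under eq_integral do rewrite opprK; exact: cvL.
have [a Pa ea] := near_le _ _ (- 1) [set a | a < - (T + 1)] cvL' (nbhs_ninfty_lt (num_real _)).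
by exists a => //; rewrite mulN1r ltrNr.
Qed.

End continuous_representative.

Section signs.
Context {R : realType} {n : nat}.
Local Notation mR := (measurableTypeR R).
Local Notation RxT := (R * 'rV[R]_n.+1)%type.
Local Notation mRxT := (mR * 'rV[mR]_n.+1)%type.
Local Notation leb := (@lebesgue_measure R).
Local Notation nu := (torus_measure R n.+1).
Local Notation mu := (strip_measure R n.+1).
Variables (sg sigma : R) (g : RxT -> R).
Hypothesis sigmaE : sigma = 1 \/ sigma = - 1.
Hypothesis mg : measurable_fun setT (g : mRxT -> R).
Hypothesis perg : on_torus g.
Hypothesis small : forall T eps, 0 < eps ->
  exists2 a, T + 1 < sigma * a & (\int[mu]_z window_gap g sigma a z <= eps%:E)%E.

Let phi a y := (\int[leb]_s window_gap g sigma a (shear sg (s, y)))%E.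

Let phi_integral a : (\int[nu]_y phi a y = \int[mu]_z window_gap g sigma a z)%E.
Proof.
rewrite [RHS](ge0_line_fubini sg)//.
- exact: measurable_window_gap.
- exact: window_gap_ge0.
- move=> s x y yZ; rewrite /window_gap !patchE perg//.
Qed.

Let phi_ge T a (y : 'rV[R]_n.+1) : T + 1 < sigma * a ->
  (forall t, T < sigma * t -> sigma * g (shear sg (t, y)) <= 0) -> (2%:E <= phi a y)%E.
Proof.
move=> Ta neg; pose J : set mR := `[a - 1, a + 1]%classic.
have mJ : measurable J by exact: measurable_itv.
have -> : 2%:E = (\int[leb]_s (\1_J s)%:E)%E.
  rewrite integral_indic// setIT [RHS](lebesgue_measure_itv `[(a - 1)%R, (a + 1)%R])/=.
  rewrite lte_fin ifT; last by lra.
  by rewrite -EFinB; congr EFin; ring.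
apply: ge0_le_integral => //.
- by apply/measurable_EFinP; exact: measurable_indic.
- have mG := measurableT_comp (measurable_window_gap mg sigma a) (measurable_shear sg).
  exact: (measurableT_comp mG (pair2_measurable y)).
move=> s _; rewrite indicE /window_gap patchE.
have -> : (shear sg (s, y) \in window a) = (s \in J).
  by apply/idP/idP; rewrite !inE /window /J/= in_itv/= ler_distl.
case: ifP => sJ //; rewrite lee_fin.
have : T < sigma * s.
  move: sJ; rewrite inE /J/= in_itv/= => /andP[s1 s2].
  by case: sigmaE Ta => ->; rewrite !(mul1r, mulN1r); lra.
move=> /neg; apply: wrong_sign_gap; by case: sigmaE => ->; rewrite ?mulrNN mulr1.
Qed.

(** If a line has the wrong sign beyond [T], it contributes at least 2 to the integral of [window_gap] for all windows beyond [T]; by Markov's inequality such lines have measure smaller than any positive number. *)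
Lemma line_signs : {ae nu, forall y, forall T,
  exists2 t, T < sigma * t & 0 < sigma * g (shear sg (t, y))}.
Proof.
suff : {ae nu, forall y, forall k : nat,
    exists2 t, k%:R < sigma * t & 0 < sigma * g (shear sg (t, y))}.
  apply: ae_imply => y H T; have [t tk gt] := H (Num.truncn `|T|).+1.
  by exists t => //; apply: le_lt_trans tk; apply: (le_trans (ler_norm _)); rewrite ltW// truncnS_gt.
apply: ae_foralln => k.
have ex j : exists a, k%:R + 1 < sigma * a /\
    (\int[mu]_z window_gap g sigma a z <= (j.+1%:R^-1)%:E)%E.
  have e0 : 0 < j.+1%:R^-1 :> R by rewrite invr_gt0.
  by have [a ka ea] := small k%:R e0; exists a.
have [a Ha] := choice ex.
have mphi b : measurable_fun setT (phi b : 'rV[mR]_n.+1 -> _).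
  by apply: measurable_line_integral; [exact: measurable_window_gap|exact: window_gap_ge0].
pose B j := setT `&` [set y : 'rV[mR]_n.+1 | (2%:E <= phi (a j) y)%E].
have mB j : measurable (B j) by exact: emeasurable_fun_c_infty.
have phi0 b y : (0 <= phi b y)%E by apply: integral_ge0 => s _; exact: window_gap_ge0.
have nuB j : (nu (B j) <= (j.+1%:R^-1)%:E)%E.
  have [_ aj] := Ha j; apply: le_trans aj; rewrite -phi_integral.
  apply: (@le_trans _ _ (\int[nu]_(y in B j) phi (a j) y)%E); last first.
    by apply: ge0_subset_integral.
  apply: (@le_trans _ _ (\int[nu]_(y in B j) 1%:E)%E).
    by rewrite integral_cst// mul1e.
  apply: ge0_le_integral => //; first exact: measurable_funTS.
  by move=> y [_ /=]; apply: le_trans; rewrite lee_fin ler1n.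
have mN : measurable (\bigcap_j B j) by exact: bigcap_measurable.
have nuN : nu (\bigcap_j B j) = 0.
  apply/eqP; rewrite eq_le measure_ge0 andbT; apply/lee_addgt0Pr => eps e0.
  rewrite add0e; pose j := Num.truncn eps^-1.
  apply: (@le_trans _ _ (nu (B j))).
    by apply: le_measure; rewrite ?inE//; exact: bigcap_inf.
  apply: (le_trans (nuB j)); rewrite lee_fin invf_ple ?posrE//.
  by rewrite ltW// truncnS_gt.
have : nu.-negligible (\bigcap_j B j) by apply/negligibleP.
apply: negligibleS => y /= H j _; split => //=; have [ja _] := Ha j.
apply: phi_ge ja _ => t kt; rewrite leNgt; apply/negP => gt.
by apply: H; exists t.
Qed.

End signs.

(** * The energy of the lines of a continuous minimizer *)

Section line_energies.
Context {R : realType} {n : nat}.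
Local Notation mR := (measurableTypeR R).
Local Notation RxT := (R * 'rV[R]_n.+1)%type.
Local Notation mRxT := (mR * 'rV[mR]_n.+1)%type.
Local Notation leb := (@lebesgue_measure R).
Local Notation nu := (torus_measure R n.+1).
Local Notation mu := (strip_measure R n.+1).
Variable sg : R.
Hypothesis sg1 : sg * sg = 1.
Local Notation e := ((sg *: delta_mx 0 ord0)%R : 'rV[R]_n.+1).
Local Notation a0 := (@coefficient R).
Local Notation W := (@double_well R).
Local Notation m := (min_energy W (layered a0) e).

Let coefficient_sg t : a0 (sg * t) = a0 t.
Proof. by case: (sign_cases sg1) => ->; rewrite ?mul1r// mulN1r coefficient_even. Qed.

Let ma0 := @measurable_coefficient R.
Let a0_ge0 := @coefficient_ge0 R.

Lemma min_energy_small : (m <= (3 / 2 * core_width)%:E)%E.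
Proof.
have w0 := @core_width_gt0 R.
apply: le_trans (clamp_energy w0 ma0 a0_ge0 (@coefficient_core R)).
exact: (@min_energy_le R n sg sg1 _ _ (clamp_profile w0) _ ma0 a0_ge0 (@coefficient_even R) (@coefficient_periodic R)).
Qed.

Variables (g : RxT -> R) (V : RxT -> 'rV[R]_n.+1).
Hypothesis cg : continuous g.
Hypothesis perg : on_torus g.
Hypothesis gV : is_De e g V.
Let v z := V z ord0 ord0.

Let mg : measurable_fun setT (g : mRxT -> R).
Proof. exact: continuous_measurable_strip. Qed.

Let mv : measurable_fun setT (v : mRxT -> R).
Proof. by have [_ _ V2 _] := gV; exact: Lfun_measurable (V2 ord0). Qed.

Let perv : on_torus v.
Proof. by have [_ perV _ _] := gV; move=> s x y yZ; rewrite /v perV. Qed.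

Definition line_density (z : RxT) : R :=
  2^-1 * (a0 (z.2 ord0 ord0) * v z ^+ 2) + double_well (g z).

Definition line_energy (y : 'rV[R]_n.+1) : \bar R :=
  (\int[leb]_s (line_density (shear sg (s, y)))%:E)%E.

Let line_density_ge0 z : 0 <= line_density z.
Proof.
apply: addr_ge0; last exact: double_well_ge0.
by apply: mulr_ge0 => //; apply: mulr_ge0 => //; exact: sqr_ge0.
Qed.

Let measurable_line_density : measurable_fun setT ((fun z => (line_density z)%:E) : mRxT -> _).
Proof.
apply/measurable_EFinP; apply: measurable_density => //.
exact: (measurableT_comp ma0 (measurableT_comp (measurable_rV_coord ord0) measurable_snd)).
Qed.

Lemma line_energy_ge0 y : (0 <= line_energy y)%E.
Proof. by apply: integral_ge0 => s _; rewrite lee_fin. Qed.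

Lemma measurable_line_energy : measurable_fun setT (line_energy : 'rV[mR]_n.+1 -> _).
Proof.
have D0 z : (0 <= (line_density z)%:E)%E by rewrite lee_fin.
exact: (measurable_line_integral sg measurable_line_density D0).
Qed.

(** The components of the derivative across the lines can only increase the energy. *)
Lemma line_energy_integral :
  (\int[nu]_y line_energy y <= \int[mu]_z (strip_density a0 g V z)%:E)%E.
Proof.
have -> : (\int[nu]_y line_energy y = \int[mu]_z (line_density z)%:E)%E.
  have D0 z : (0 <= (line_density z)%:E)%E by rewrite lee_fin.
  rewrite [RHS](ge0_line_fubini sg measurable_line_density D0)//.
  move=> s x y yZ; rewrite /line_density perv// perg//=; congr (_ * (_ * _) + _)%:E.
  by rewrite mxE coefficient_periodic//; exact: yZ.
have mVi i : measurable_fun setT ((fun z => V z ord0 i) : mRxT -> R).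
  by have [_ _ V2 _] := gV; exact: Lfun_measurable (V2 i).
apply: ge0_le_integral => //.
- by move=> z _; rewrite lee_fin.
- exact: measurable_strip_density.
move=> z _; rewrite lee_fin lerD2r ler_wpM2l// ler_wpM2l//.
rewrite /dot big_ord_recl -expr2 lerDl.
by apply: sumr_ge0 => i _; rewrite -expr2 sqr_ge0.
Qed.

(** The restriction of [g] to the line of [y], reparametrised so that the coefficient on the line is [a0] itself. *)
Definition line_value (y : 'rV[R]_n.+1) (t : R) : R :=
  g (shear sg (t - sg * y ord0 ord0, y)).

Definition line_slope (y : 'rV[R]_n.+1) (t : R) : R :=
  sg * v (shear sg (t - sg * y ord0 ord0, y)).

Lemma line_energyE y :
  line_energy y = (\int[leb]_t (density a0 (line_value y) (line_slope y) t)%:E)%E.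
Proof.
pose h := sg * y ord0 ord0.
have mline (f : RxT -> R) : measurable_fun setT (f : mRxT -> R) ->
    measurable_fun setT (fun t : mR => f (shear sg (t - h, y))).
  move=> mf.
  have := measurableT_comp (measurableT_comp (measurableT_comp mf (measurable_shear sg))
    (pair2_measurable y)) (measurable_translate (- h)).
  exact.
rewrite -[RHS](ge0_integral_translate h).
- apply: eq_integral => s _; rewrite /density /line_value /line_slope addrK.
  rewrite exprMn.
  rewrite /line_density; congr (_ * _ + _)%:E.
  have -> : sg ^+ 2 = 1 by rewrite expr2.
  rewrite mul1r; congr (_ * _); rewrite -[RHS]coefficient_sg; congr a0.
  by rewrite /shear /slide/= !mxE eqxx mulr1 /h mulrDr mulrA sg1 mul1r addrC.
- apply/measurable_EFinP; apply: measurable_density => //.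
    exact: mline.
  by apply: measurable_funM; [exact: measurable_cst|exact: (mline v mv)].
- by move=> t; rewrite lee_fin density_ge0.
Qed.

Lemma primitive_line : {ae nu, forall y, primitive (line_value y) (line_slope y)}.
Proof.
have := lines_primitive sg1 cg perg gV; apply: ae_imply => y.
by move=> /(primitive_translate (- (sg * y ord0 ord0))).
Qed.

(** This is [exit_energy] on the reparametrised line, from the time that corresponds to [s0]. *)
Lemma line_energy_exit y s0 : primitive (line_value y) (line_slope y) ->
    `|g (shear sg (s0, y))| <= 1 / 4 ->
    (forall t, 0 <= t <= 1 / 5 -> 1 / 64 <= a0 (y ord0 ord0 + sg * (s0 + t))) ->
  ((1 / 64)%:E <= line_energy y)%E.
Proof.
move=> pl g0 acore; rewrite line_energyE; set t0 := s0 + sg * y ord0 ord0.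
have D0 t : 0 <= density a0 (line_value y) (line_slope y) t by exact: density_ge0.
(* double_well (1/2) = 9/64, and (1/16)^2 <= 2 * (1/64) * (9/64); the minimum is (1/16) * (1/4) *)
have E := @exit_energy R a0 _ _ t0 (1 / 5) (1 / 64) (1 / 4) (1 / 2) (1 / 16) pl ma0 a0_ge0.
apply: (@le_trans _ _ (\int[leb]_(t in `[t0, (t0 + 1 / 5)%R]) (density a0 (line_value y) (line_slope y) t)%:E)%E).
  apply: le_trans (E _ _ _ _ _ _ _).
  - by rewrite lee_fin le_min /double_well; apply/andP; split; lra.
  - by lra.
  - by lra.
  - move=> t /andP[t1 t2]; rewrite -coefficient_sg.
    have -> : sg * t = y ord0 ord0 + sg * (s0 + (t - t0)).
      transitivity (y ord0 ord0 + sg * t - (sg * sg) * y ord0 ord0); first by rewrite sg1; ring.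
      by rewrite /t0; ring.
    apply: acore; rewrite subr_ge0 t1/= lerBlDl; exact: t2.
  - by rewrite /line_value /t0 addrK.
  - by lra.
  - by lra.
  - by rewrite /double_well; lra.
apply: ge0_subset_integral => //; last by move=> t _; rewrite lee_fin.
apply/measurable_EFinP; apply: measurable_density => //.
  by apply: continuous_measurable_fun; exact: primitive_continuous pl.
exact: primitive_measurable pl.
Qed.

Hypothesis g_le1 : {ae mu, forall z, `|g z| <= 1}.
Hypothesis g_small : forall sigma T eps, sigma = 1 \/ sigma = - 1 -> 0 < eps ->
  exists2 a, T + 1 < sigma * a & (\int[mu]_z window_gap g sigma a z <= eps%:E)%E.

Let lines_le1 : {ae nu, forall y, forall s, `|g (shear sg (s, y))| <= 1}.
Proof.
(* twice the positive part of |g| - 1 *)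
pose F z := `| `|g z| - 1 | + (`|g z| - 1).
have FE z : (F z = 0) <-> (`|g z| <= 1).
  rewrite /F -[in X in _ <-> X]subr_le0; set x := `|g z| - 1; split => [|x0].
    by move=> /eqP; rewrite addr_eq0 => /eqP h; rewrite -oppr_ge0 -h.
  by rewrite ler0_norm// addNr.
have mF : measurable_fun setT (F : mRxT -> R).
  have mn : measurable_fun setT ((fun z => `|g z| - 1) : mRxT -> R).
    by apply: measurable_funB => //; exact: measurableT_comp.
  by apply: measurable_funD => //; exact: measurableT_comp.
have perF : on_torus F by move=> s x y yZ; rewrite /F perg.
have F0 : {ae mu, forall z, F z = 0} by move: g_le1; apply: ae_imply => z /FE.
have := ae_line sg mF perF F0; apply: ae_imply => y Fy s; apply/FE.
apply: (@continuous_ae_zero _ (fun s => F (shear sg (s, y)))) Fy s => s.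
have cl : {for s, continuous (fun s : R => g (shear sg (s, y)))}.
  exact: (@continuous_line R n sg g cg y s).
have cn : {for s, continuous (fun s : R => `|g (shear sg (s, y))| - 1)}.
  by apply: cvgB; [exact: cvg_norm|exact: cvg_cst].
by apply: cvgD => //; exact: cvg_norm.
Qed.

(** Almost every line with finite energy is a profile, hence provides a competitor. *)
Lemma line_energy_ge : {ae nu, forall y, (m <= line_energy y)%E}.
Proof.
have H1 := line_signs sg (or_introl erefl) mg perg (fun T eps => @g_small 1 T eps (or_introl erefl)).
have H2 := line_signs sg (or_intror erefl) mg perg (fun T eps => @g_small (- 1) T eps (or_intror erefl)).
have H3 : {ae nu, forall y, primitive (line_value y) (line_slope y) /\
    forall s, `|g (shear sg (s, y))| <= 1}.
  by move: primitive_line lines_le1; apply: ae_imply2.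
move: H3; apply: ae_imply2 (ae_imply2 (fun y a b => conj a b) H1 H2) => y [pos neg] [pl le1].
have [->|Eoo] := eqVneq (line_energy y) +oo%E; first exact: leey.
rewrite line_energyE in Eoo *.
apply: (@min_energy_le R n sg sg1 _ _ _ _ ma0 a0_ge0 (@coefficient_even R) (@coefficient_periodic R)).
have A0 : 0 < core_width ^+ 2 / 2 :> R.
  by apply: mulr_gt0 => //; apply: exprn_gt0; exact: core_width_gt0.
apply: (profile_intro pl ma0 A0 (@coefficient_ge R)).
- by rewrite ltey.
- by move=> t; exact: le1.
- move=> N; have [t Nt gt] := pos (N - sg * y ord0 ord0).
  exists (t + sg * y ord0 ord0); first by move: Nt; rewrite mul1r ltrBlDr.
  by rewrite /line_value addrK; move: gt; rewrite mul1r.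
- move=> N; have [t Nt gt] := neg (N + sg * y ord0 ord0).
  exists (t + sg * y ord0 ord0); last by rewrite /line_value addrK; move: gt; rewrite mulN1r oppr_gt0.
  by move: Nt; rewrite mulN1r; lra.
Qed.

End line_energies.

(** * Lines through a zero near one half *)

Section labels_near_zero.
Context {R : realType} {n : nat}.
Local Notation mR := (measurableTypeR R).
Local Notation RxT := (R * 'rV[R]_n.+1)%type.
Local Notation mRxT := (mR * 'rV[mR]_n.+1)%type.
Local Notation leb := (@lebesgue_measure R).
Local Notation nu := (torus_measure R n.+1).
Local Notation mu := (strip_measure R n.+1).
Variable g : RxT -> R.
Hypothesis cg : continuous g.
Hypothesis perg : on_torus g.

(** Otherwise the window would contain a box, of measure independent of [a], on which [g] is at distance at least 1 from [sigma]. *)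
Lemma sign_in_window (sigma lo hi : R) : sigma = 1 \/ sigma = - 1 ->
    0 <= lo -> lo < hi -> hi <= 1 ->
    (forall eps, 0 < eps -> exists a, (\int[mu]_z window_gap g sigma a z <= eps%:E)%E) ->
  exists2 z : RxT, lo < z.2 ord0 ord0 < hi & 0 < sigma * g z.
Proof.
move=> sigmaE lo0 lohi hi1 small; apply: contrapT => nex.
pose al (i : 'I_n.+1) : R := if i == ord0 then lo else 0.
pose be (i : 'I_n.+1) : R := if i == ord0 then hi else 1.
have al0 i : 0 <= al i by rewrite /al; case: ifP.
have albe i : al i < be i by rewrite /al /be; case: ifP.
have be1 i : be i <= 1 by rewrite /be; case: ifP.
pose B := [set x : 'rV[R]_n.+1 | forall i, al i < x ord0 i < be i].
pose k := \prod_(i < n.+1) (be i - al i).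
have k0 : 0 < k by apply: prodr_gt0 => i _; rewrite subr_gt0.
have nuB : nu B = k%:E by rewrite (torus_box al0 (fun i => ltW (albe i)) be1).
have mB : measurable (B : set 'rV[mR]_n.+1) by exact: measurable_rV_itvoo.
have [a ea] := small _ k0.
pose C : set mRxT := `[a - 1, a + 1]%classic `*` B.
have mC : measurable C by apply: measurableX.
have muC : mu C = (2 * k)%:E.
  have E := product_measure1E leb nu (measurable_itv `[a - 1, a + 1]) mB.
  apply: (etrans E); rewrite [X in (_ * X)%E]nuB.
  rewrite [X in (X * _)%E](lebesgue_measure_itv `[(a - 1)%R, (a + 1)%R])/=.
  rewrite lte_fin ifT; last by rewrite ltrD2l (lt_trans _ ltr01)// ltrN10.
  by rewrite -EFinB -EFinM; congr (_ * _)%:E; ring.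
have mg : measurable_fun setT (g : mRxT -> R) by exact: continuous_measurable_strip.
suff : ((2 * k)%:E <= k%:E)%E.
  by rewrite lee_fin ger_pMl// leNgt ltr1n.
apply: le_trans ea; rewrite -muC -[X in (mu X <= _)%E]setIT -integral_indic//.
apply: ge0_le_integral => //.
- by apply/measurable_EFinP; exact: measurable_indic.
- exact: measurable_window_gap.
move=> z _; rewrite indicE /window_gap patchE.
have [zC|zC] := boolP (z \in C); last exact: (window_gap_ge0 g sigma a z).
move: zC; rewrite inE => -[/= z1 zB].
rewrite mem_set; last by move: z1; rewrite /window/= in_itv/= ler_distl.
rewrite lee_fin; apply: wrong_sign_gap.
  by case: sigmaE => ->; rewrite ?mulrNN mulr1.
rewrite leNgt; apply/negP => gz; apply: nex; exists z => //.
by have := zB ord0; rewrite /al /be eqxx.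
Qed.

(** The intermediate value theorem on a segment, which stays between the two bounds by convexity. *)
Lemma zero_in_window (lo hi : R) (z1 z2 : RxT) :
    lo < z1.2 ord0 ord0 < hi -> lo < z2.2 ord0 ord0 < hi -> 0 < g z1 -> g z2 < 0 ->
  exists2 z : RxT, lo < z.2 ord0 ord0 < hi & g z = 0.
Proof.
move=> /andP[l1 h1] /andP[l2 h2] g1 g2.
pose f (t : R) := z2 + t *: (z1 - z2).
have cf : continuous (g \o f).
  move=> t; apply: continuous_comp; last exact: cg.
  by apply: cvgD; [exact: cvg_cst|apply: cvgZl; exact: cvg_id].
have f0 : f 0 = z2 by rewrite /f scale0r addr0.
have f1 : f 1 = z1 by rewrite /f scale1r addrCA subrr addr0.
have [|t] := @IVT _ (g \o f) 0 1 0 ler01 (continuous_subspaceT cf).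
  by rewrite /= f0 f1 ge_min le_max (ltW g1) (ltW g2) orbT.
rewrite in_itv/= => /andP[t0 t1] gt; exists (f t) => //.
rewrite /f /= !mxE; set x := z1.2 _ _ in l1 h1 *; set y := z2.2 _ _ in l2 h2 *.
have conv (a b : R) : 0 < a -> 0 < b -> 0 < (1 - t) * a + t * b.
  move=> a0 b0; move: t1; rewrite le_eqVlt => /predU1P[->|t1'].
    by rewrite subrr mul0r add0r mul1r.
  apply: ltr_wpDr; first by apply: mulr_ge0 => //; exact: ltW.
  by apply: mulr_gt0 => //; rewrite subr_gt0.
apply/andP; split; rewrite -subr_gt0.
  have -> : y + t * (x - y) - lo = (1 - t) * (y - lo) + t * (x - lo) by ring.
  by apply: conv; rewrite subr_gt0.
have -> : hi - (y + t * (x - y)) = (1 - t) * (hi - y) + t * (hi - x) by ring.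
by apply: conv; rewrite subr_gt0.
Qed.

(** The line through [z] is moved by an integer vector so that its foot lies in the half-open unit cell; then a small box with the foot as its lowest corner fits inside the cell. *)
Lemma labels_near_zero (sg : R) (z : RxT) (eps : R) : 0 < eps -> g z = 0 ->
  exists al be : 'I_n.+1 -> R,
    [/\ forall i, 0 <= al i, forall i, al i < be i, forall i, be i <= 1 &
      forall y : 'rV[R]_n.+1, (forall i, al i < y ord0 i < be i) ->
        `|g (shear sg (z.1, y))| <= 1 / 4 /\
        exists c k, [/\ 0 <= c <= eps, k \is a Num.int &
          y ord0 ord0 + sg * z.1 = z.2 ord0 ord0 + c + k]].
Proof.
move=> e0 gz; have : \forall w \near z, `|g w| < 1 / 4.
  have : {for z, continuous (fun w => `|g w|)} by apply: cvg_norm; exact: cg.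
  by move=> /cvgr_lt; apply; rewrite gz normr0.
move=> /nbhs_box[dl0 dl00 zdl0]; pose dl := Num.min dl0 eps.
have dlp : 0 < dl by rewrite lt_min dl00.
pose ys : 'rV[R]_n.+1 := z.2 - (sg * z.1) *: delta_mx 0 ord0.
pose fl i : R := (Num.floor (ys ord0 i))%:~R.
pose c i := ys ord0 i - fl i.
have c0 i : 0 <= c i by rewrite subr_ge0 floor_le.
have c1 i : c i < 1.
  by rewrite /c ltrBlDl -[X in _ < _ + X]/(1%:~R) -intrD floorD1_gt.
exists c, (fun i => Num.min (c i + dl) 1); split => //.
- by move=> i; rewrite lt_min c1 ltrDl dlp.
- by move=> i; rewrite ge_min lexx orbT.
move=> y yc; have yc' i : 0 < y ord0 i - c i < dl.
  have /andP[h1] := yc i; rewrite lt_min => /andP[h2 _].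
  by rewrite subr_gt0 h1/= ltrBlDl.
split.
  pose k : 'rV[R]_n.+1 := \row_i fl i.
  have -> : g (shear sg (z.1, y)) = g (z.1, (y + (sg * z.1) *: delta_mx 0 ord0) + k).
    by apply/esym; apply: (perg z.1) => i _; rewrite mxE intr_int.
  apply/ltW/zdl0; split => [|i]; first by rewrite subrr normr0.
  have /andP[h1 h2] := yc' i.
  have -> : (y + (sg * z.1) *: delta_mx 0 ord0 + k) ord0 i - z.2 ord0 i = y ord0 i - c i.
    by rewrite /c /ys !mxE; ring.
  by rewrite gtr0_norm// (lt_le_trans h2)// ge_min lexx.
exists (y ord0 ord0 - c ord0), (- fl ord0); have /andP[h1 h2] := yc' ord0; split.
- by rewrite (ltW h1)/=; apply: (le_trans (ltW h2)); rewrite ge_min lexx orbT.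
- by rewrite rpredN intr_int.
- by rewrite /c /ys !mxE eqxx mulr1; ring.
Qed.

End labels_near_zero.

Section nonexistence.
Context {R : realType} {n : nat}.
Local Notation mR := (measurableTypeR R).
Local Notation RxT := (R * 'rV[R]_n.+1)%type.
Local Notation mRxT := (mR * 'rV[mR]_n.+1)%type.
Local Notation nu := (torus_measure R n.+1).
Local Notation mu := (strip_measure R n.+1).

(** The lines cost at least [m] almost everywhere, at least [1/64 > m] on a set of positive measure, and at most [m] on average. *)
Theorem no_continuous_minimizer (sg : R) : sg * sg = 1 ->
  ~ has_continuous_minimizer (@double_well R) (layered (@coefficient R))
      (sg *: delta_mx 0 ord0 : 'rV[R]_n.+1).
Proof.
move=> sg1 [U [g [[admU EU] cg perg Ug]]]; have [mU perU U1 _ _] := admU.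
set e := (sg *: delta_mx 0 ord0) : 'rV[R]_n.+1 in EU *.
have small := @min_energy_small R n sg sg1.
have mg : measurable_fun setT (g : mRxT -> R) by exact: continuous_measurable_strip.
have a0_ge0 := @coefficient_ge0 R; have ma0 := @measurable_coefficient R.
have [V UV] : exists V, is_De e U V.
  by apply: contrapT => nV; move: small; rewrite -EU /energy asboolF.
have gV := is_De_ae mU mg Ug UV.
have g1 : {ae mu, forall z, `|g z| <= 1}.
  by move: U1 Ug; apply: ae_imply2 => z + <-.
have gap sigma T eps (sigmaE : sigma = 1 \/ sigma = - 1) (e0 : 0 < eps) :=
  @window_gap_small R n.+1 U g mU mg Ug sigma T eps admU sigmaE e0.
pose m := fine (min_energy (@double_well R) (layered (@coefficient R)) e).
have m0 : (0 <= min_energy (@double_well R) (layered (@coefficient R)) e)%E.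
  rewrite -EU (energyE ma0 a0_ge0 mU UV); apply: integral_ge0 => z _.
  by rewrite lee_fin; exact: strip_density_ge0.
have mE : min_energy (@double_well R) (layered (@coefficient R)) e = m%:E.
  by rewrite /m fineK// ge0_fin_numE//; exact: le_lt_trans small (ltry _).
have mle : m < 1 / 64.
  by move: small; rewrite mE lee_fin /core_width; lra.
have Eg : (\int[mu]_z (strip_density (@coefficient R) g V z)%:E = m%:E)%E.
  rewrite -mE -EU (energyE ma0 a0_ge0 mU UV); apply: ae_eq_integral => //.
  - apply: measurable_strip_density => // i.
    by have [_ _ V2 _] := UV; exact: Lfun_measurable (V2 i).
  - apply: measurable_strip_density => // i.
    by have [_ _ V2 _] := UV; exact: Lfun_measurable (V2 i).
  - by move: Ug; apply: ae_imply => z E _; rewrite /strip_density E.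
have lo0 : 0 <= 49 / 100 :> R by [].
have lohi : 49 / 100 < 51 / 100 :> R by lra.
have hi1 : 51 / 100 <= 1 :> R by lra.
have [z1 z1w] : exists2 z : RxT, 49 / 100 < z.2 ord0 ord0 < 51 / 100 & 0 < 1 * g z.
  apply: (sign_in_window cg (or_introl erefl) lo0 lohi hi1) => eps e0.
  by have [a _ ?] := gap 1 0 eps (or_introl erefl) e0; exists a.
rewrite mul1r => g1p.
have [z2 z2w] : exists2 z : RxT, 49 / 100 < z.2 ord0 ord0 < 51 / 100 & 0 < - 1 * g z.
  apply: (sign_in_window cg (or_intror erefl) lo0 lohi hi1) => eps e0.
  by have [a _ ?] := gap (- 1) 0 eps (or_intror erefl) e0; exists a.
rewrite mulN1r oppr_gt0 => g2n.
have [z /andP[zl zh] gz] := zero_in_window cg z1w z2w g1p g2n.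
have eps0 : 0 < 1 / 100 :> R by lra.
have [al [be [al0 albe be1 bad]]] := labels_near_zero cg perg sg eps0 gz.
pose B := [set x : 'rV[mR]_n.+1 | forall i, al i < x ord0 i < be i].
have mB : measurable B by exact: measurable_rV_itvoo.
pose k := \prod_(i < n.+1) (be i - al i).
have k0 : 0 < k by apply: prodr_gt0 => i _; rewrite subr_gt0.
have nuB : nu B = k%:E by rewrite (torus_box al0 (fun i => ltW (albe i)) be1).
have badE : {ae nu, forall y, B y -> ((1 / 64)%:E <= line_energy sg g V y)%E}.
  have := primitive_line sg1 cg perg gV; apply: ae_imply => y ply yB.
  have [gy [c [l [/andP[c0 c1] lZ El]]]] := bad y yB.
  apply: (line_energy_exit sg1 cg gV ply gy) => t /andP[t0 t1].
  rewrite mulrDr addrA El addrAC coefficient_periodic//; by apply: coefficient_exit; rewrite ?t0 ?zl ?c0.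
have geE := line_energy_ge sg1 cg perg gV g1 gap.
(* a lower bound of the cost of the lines, of integral larger than m *)
pose f (y : 'rV[mR]_n.+1) : \bar R := (m + (1 / 64 - m) * \1_B y)%:E.
have mfine : 0 <= m by rewrite -lee_fin -mE.
have gap0 : 0 < 1 / 64 - m by rewrite subr_gt0.
have : (\int[nu]_y f y <= m%:E)%E.
  rewrite -Eg; apply: le_trans (line_energy_integral cg perg gV).
  apply: ae_ge0_le_integral => //.
  - move=> y _; rewrite lee_fin addr_ge0// mulr_ge0// ltW//.
  - apply/measurable_EFinP; apply: measurable_funD => //; apply: measurable_funM => //.
  - by move=> y _; exact: line_energy_ge0.
  - exact: measurable_line_energy.
  move: badE geE; apply: ae_imply2 => y By my _; rewrite /f indicE.
  have [yB|yB] := boolP (y \in B); last by rewrite mulr0 addr0 -mE.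
  by rewrite mulr1 addrC subrK; apply: By; rewrite inE in yB.
have -> : (\int[nu]_y f y = (m + (1 / 64 - m) * k)%:E)%E.
  under eq_integral do rewrite /f EFinD EFinM.
  rewrite ge0_integralD//.
  - rewrite integral_cst// [X in (_ * X + _)%E]probability_setT mule1.
    rewrite ge0_integralZl_EFin//; last 2 first.
    + by apply/measurable_EFinP; exact: measurable_indic.
    + exact: ltW.
    by rewrite integral_indic// setIT [X in (_ + _ * X)%E]nuB -EFinM -EFinD.
  - by move=> y _; rewrite -EFinM lee_fin mulr_ge0// ltW.
  - under eq_fun do rewrite -EFinM; apply/measurable_EFinP.
    by apply: measurable_funM => //; exact: measurable_indic.
by rewrite lee_fin gerDl leNgt mulr_gt0.
Qed.

End nonexistence.

(** * The layered coefficient field *)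

Section layered_coefficient.
Context {R : realType} {n : nat}.
Local Notation a := (@layered R n (@coefficient R)).

Lemma layered_smooth : smooth_field a.
Proof.
move=> i j; apply: elementary_smooth.
have eu : elementary (fun x : 'rV[R]_n.+1 => x ord0 ord0).
  apply: elementary_linear => [c x y|]; first by rewrite !mxE.
  exact: coord_continuous.
have : elementary (fun x : 'rV[R]_n.+1 => coefficient (x ord0 ord0) * (i == j)%:R).
  by apply: elementaryM; [exact: elementary_coefficient|exact: elementary_cst].
by congr elementary; apply/funext => x; rewrite !mxE mulr_natr.
Qed.

Lemma layered_invariant k : (0 < k)%N -> invariant_upto k a.
Proof.
by move=> k0 x y yZ; rewrite /layered mxE coefficient_periodic//; exact: yZ.
Qed.

Lemma layered_elliptic : uniformly_elliptic a.
Proof.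
have A0 : 0 < core_width ^+ 2 / 2 :> R.
  by apply: mulr_gt0 => //; apply: exprn_gt0; exact: core_width_gt0.
have cge := @coefficient_ge R; have cle := @coefficient_le1 R.
exists (core_width ^+ 2 / 2), 1; split => //; first exact: le_trans (cge 0) (cle 0).
move=> x v; rewrite dot_scalar; apply/andP; split.
  by apply: ler_wpM2r; [exact: dot_ge0|exact: cge].
by apply: ler_wpM2r; [exact: dot_ge0|exact: cle].
Qed.

End layered_coefficient.

Theorem theorem5 (R : realType) :
  (exists a0 : R -> R,
    [/\ smooth a0, periodic a0 1, forall t, 0 < a0 t &
      forall e : 'rV[R]_1, sphere e ->
        ~ has_continuous_minimizer (@double_well R)
            (fun x : 'rV[R]_1 => (a0 (x ord0 ord0))%:M) e])
  /\
  (forall d : nat, (2 <= d)%N ->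
    exists a : 'rV[R]_d -> 'M[R]_d,
      [/\ smooth_field a, symmetric_field a, Zperiodic a, laminar a &
          uniformly_elliptic a] /\
      exists e1 e2 : 'rV[R]_d,
        [/\ sphere e1, sphere e2, e1 <> e2,
            ~ has_continuous_minimizer (@double_well R) a e1 &
            ~ has_continuous_minimizer (@double_well R) a e2]).
Proof.
split.
  exists (@coefficient R); split.
  - apply: elementary_smooth; apply: elementary_coefficient.
    by apply: elementary_linear => // z.
  - by move=> t; rewrite coefficient_periodic// int_num1.
  - exact: coefficient_gt0.
  move=> e; rewrite /sphere/= /dot big_ord1 => e1.
  have -> : e = e ord0 ord0 *: delta_mx 0 ord0.
    by apply/rowP => i; rewrite !mxE (ord1 i) eqxx mulr1.
  exact: no_continuous_minimizer e1.
case=> [//|[//|n]] _; exists (layered (@coefficient R)); split.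
  split.
  - exact: layered_smooth.
  - by move=> x; rewrite /layered tr_scalar_mx.
  - exact: layered_invariant.
  - by exists 1%N; split => //; exact: layered_invariant.
  - exact: layered_elliptic.
have sph (sg : R) : sg * sg = 1 -> sphere (sg *: delta_mx 0 ord0 : 'rV[R]_n.+2).
  move=> sg1; rewrite /sphere/= /dot big_ord_recl big1 => [|i _].
    by rewrite !mxE eqxx mulr1 addr0.
  by rewrite !mxE/= mulr0 mul0r.
have m1 : - 1 * - 1 = 1 :> R by rewrite mulrNN mulr1.
exists (1 *: delta_mx 0 ord0), (- 1 *: delta_mx 0 ord0); split.
- by apply: sph; rewrite mulr1.
- exact: sph.
- move=> /rowP/(_ ord0); rewrite !mxE eqxx !mulr1 => /eqP.
  by rewrite eq_sym eqNr oner_eq0.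
- by apply: no_continuous_minimizer; rewrite mulr1.
- exact: no_continuous_minimizer.
Qed.
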